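(* Consider problem (P) and suppose Assumptions A, B, C and D hold and that $\bar F$ is a KL function. Let $\{(x^t,L_g^t)\}$ be generated by SCP$_{ls}$ and let $\Omega$ be the set of accumulation points of $\{(x^{t+1},x^t,L_g^t)\}$. Then $\{x^t\}$ converges to a stationary point $x^*$ of (P). Moreover, if $\bar F$ satisfies the KL property with exponent $\alpha\in[0,1)$ at every point of $\Omega$, then there exists $\underline t\in\mathbb N_+$ such that: (i) if $\alpha=0$, then $x^t=x^*$ for all $t>\underline t$; (ii) if $\alpha\in(0,\frac12]$, then there exist $a_0\in(0,1)$ and $a_1>0$ with $\|x^t-x^*\|\le a_1a_0^t$ for all $t>\underline t$; (iii) if $\alpha\in(\frac12,1)$, then there exists $a_2>0$ with $\|x^t-x^*\|\le a_2t^{-\frac{1-\alpha}{2\alpha-1}}$ for all $t>\underline t$.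
   Context: Problem (P): $\min_{x\in\mathbb R^n}F(x):=f(x)+P_1(x)-P_2(x)+\delta_{\{g\le 0\}}(x)$, where $f:\mathbb R^n\to\mathbb R$ is continuously differentiable, $P_1,P_2:\mathbb R^n\to\mathbb R$ are convex and continuous, $g=(g_1,\dots,g_m):\mathbb R^n\to\mathbb R^m$ is continuous with $\{x:g(x)\le0\}\neq\emptyset$ (componentwise inequalities), $\delta_C$ the indicator function of $C$; $\partial$ is the limiting subdifferential. Assumption A: (i) $\nabla f$ is Lipschitz with modulus $L_f$; (ii) each $g_i$ is differentiable with $\nabla g_i$ Lipschitz with modulus $L_{g_i}$; (iii) $F$ is level-bounded. Assumption B (MFCQ): each $g_i$ is continuously differentiable and for every $x$ with $g(x)\le0$ there is $d$ with $\langle\nabla g_i(x),d\rangle<0$ for all $i\in I(x):=\{j:g_j(x)=0\}$. Assumption C: each $g_i$ is twice continuously differentiable. Assumption D: $P_2$ is continuously differentiable on an open set $\Gamma$ containing all stationary points of (P), and $\nabla P_2$ is locally Lipschitz on $\Gamma$. Stationary point: $x$ with $g(x)\le0$ for which there is $\lambda\in\mathbb R^m_+$ with $\lambda_ig_i(x)=0$ for all $i$ and $0\in\nabla f(x)+\partial P_1(x)-\partial P_2(x)+\sum_i\lambda_i\nabla g_i(x)$. $\bar G(x,y,w)\in\mathbb R^m$ has components $\bar G_i(x,y,w)=g_i(y)+\langle\nabla g_i(y),x-y\rangle+\frac{w_i}{2}\|x-y\|^2$, and $\bar F(x,y,w):=f(x)+P_1(x)-P_2(x)+\delta_{\{\bar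 G\le0\}}(x,y,w)$ on $\mathbb R^n\times\mathbb R^n\times\mathbb R^m$. KL property: a proper closed $h$ satisfies the KL property at $\hat x\in{\rm dom}\,\partial h$ if there exist $a\in(0,\infty]$, a neighborhood $V$ of $\hat x$ and a continuous concave $\varphi:[0,a)\to[0,\infty)$ with $\varphi(0)=0$, $\varphi$ continuously differentiable on $(0,a)$ with $\varphi'>0$, such that $\varphi'(h(x)-h(\hat x))\,{\rm dist}(0,\partial h(x))\ge1$ for all $x\in V$ with $h(\hat x)<h(x)<h(\hat x)+a$. It has the KL property at $\hat x$ with exponent $\alpha\in[0,1)$ if $\varphi$ can be taken as $\varphi(s)=a_0s^{1-\alpha}$ with $a_0>0$. $h$ is a KL function if it has the KL property at every point of ${\rm dom}\,\partial h$. Algorithm SCP$_{ls}$: fix $c>0$, $0<\underline L<\bar L$, $\tau>1$ and $x^0$ with $g(x^0)\le0$. For $t=0,1,2,\dots$: (1) pick any $\xi^t\in\partial P_2(x^t)$; (2) choose $L_f^{t,0}\in[\underline L,\bar L]$, $L_g^{t,0}\in[\underline L,\bar L]^m$ arbitrarily, set $\tilde L_f=L_f^{t,0}$, $\tilde L_g=L_g^{t,0}$; (3) compute $\tilde x$ solving: minimize $\langle\nabla f(x^t)-\xi^t,x-x^t\rangle+\frac{\tilde L_f}{2}\|x-x^t\|^2+P_1(x)$ subject to $\bar G(x,x^t,\tilde L_g)\le0$. If $g(\tilde x)\le0$ and $F(\tilde x)\le F(x^t)-\frac c2\|\tilde x-x^t\|^2$, set $x^{t+1}=\tilde x$, $L_f^t=\tilde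 L_f$, $L_g^t=\tilde L_g$ and go to iteration $t+1$; otherwise, if $g(\tilde x)\not\le0$ replace $\tilde L_g$ by $\tau\tilde L_g$, while if $g(\tilde x)\le0$ but the decrease inequality fails replace $\tilde L_f$ by $\tau\tilde L_f$, and repeat step (3). *)

(* Defs.v *)
From Stdlib Require Import Reals Classical ClassicalEpsilon.
From mathcomp Require Import all_boot.

Set Implicit Arguments.
Unset Strict Implicit.
Unset Printing Implicit Defensive.

Open Scope R_scope.

Definition vec (n : nat) := 'I_n -> R.
Definition vadd n (x y : vec n) : vec n := fun i => x i + y i.
Definition vsub n (x y : vec n) : vec n := fun i => x i - y i.
Definition vscale n (a : R) (x : vec n) : vec n := fun i => a * x i.
Definition dot n (x y : vec n) : R := \big[Rplus/0]_(i < n) (x i * y i).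
Definition vnorm n (x : vec n) : R := sqrt (dot x x).
Definition vle0 m (x : vec m) : Prop := forall i, x i <= 0.

(* E is a real inner product space given by a subtraction and an inner product *)
Definition ex_norm {E : Type} (ip : E -> E -> R) (z : E) : R := sqrt (ip z z).

Definition conv_to {E : Type} (sub : E -> E -> E) (ip : E -> E -> R)
  (s : nat -> E) (l : E) : Prop :=
  forall eps, 0 < eps -> exists N : nat, forall k : nat, (N <= k)%nat ->
    ex_norm ip (sub (s k) l) < eps.

Definition acc_point {E : Type} (sub : E -> E -> E) (ip : E -> E -> R)
  (s : nat -> E) (l : E) : Prop :=
  forall eps, 0 < eps -> forall N : nat, exists k : nat, (N <= k)%nat /\
    ex_norm ip (sub (s k) l) < eps.

(* extended-real-valued functions: None stands for +infinity *)
Definition frechet_subdiff {E : Type} (sub : E -> E -> E) (ip : E -> E -> R)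
  (h : E -> option R) (x v : E) : Prop :=
  exists hx, h x = Some hx /\
   forall eps, 0 < eps -> exists delta, 0 < delta /\
     forall y hy, ex_norm ip (sub y x) < delta -> h y = Some hy ->
       hx + ip v (sub y x) - eps * ex_norm ip (sub y x) <= hy.

Definition limiting_subdiff {E : Type} (sub : E -> E -> E) (ip : E -> E -> R)
  (h : E -> option R) (x v : E) : Prop :=
  exists hx, h x = Some hx /\
  exists (xs vs : nat -> E),
    conv_to sub ip xs x /\ conv_to sub ip vs v /\
    (forall k, frechet_subdiff sub ip h (xs k) (vs k)) /\
    (forall eps, 0 < eps -> exists N : nat, forall k : nat, (N <= k)%nat ->
       exists hk, h (xs k) = Some hk /\ Rabs (hk - hx) < eps).

Definition KL_with {E : Type} (sub : E -> E -> E) (ip : E -> E -> R)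
  (h : E -> option R) (xh : E) (phi : R -> R) : Prop :=
  exists (a r : R) (phi' : R -> R),
    0 < a /\ 0 < r /\
    phi 0 = 0 /\
    (forall s, 0 <= s < a -> 0 <= phi s) /\
    (forall s, 0 <= s < a -> forall eps, 0 < eps -> exists d, 0 < d /\
        forall s', 0 <= s' < a -> Rabs (s' - s) < d -> Rabs (phi s' - phi s) < eps) /\
    (forall s1 s2 th, 0 <= s1 < a -> 0 <= s2 < a -> 0 <= th <= 1 ->
        th * phi s1 + (1 - th) * phi s2 <= phi (th * s1 + (1 - th) * s2)) /\
    (forall s, 0 < s < a ->
        derivable_pt_lim phi s (phi' s) /\ continuity_pt phi' s /\ 0 < phi' s) /\
    exists hxh, h xh = Some hxh /\
      forall x hx, ex_norm ip (sub x xh) < r -> h x = Some hx ->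
        hxh < hx < hxh + a ->
        (* phi'(h x - h xh) * dist(0, ∂h(x)) >= 1 *)
        forall v, limiting_subdiff sub ip h x v -> 1 <= phi' (hx - hxh) * ex_norm ip v.

Definition KL_at {E : Type} sub ip (h : E -> option R) (xh : E) : Prop :=
  exists phi, KL_with sub ip h xh phi.

Definition KL_function {E : Type} sub ip (h : E -> option R) : Prop :=
  forall xh, (exists v, limiting_subdiff sub ip h xh v) -> KL_at sub ip h xh.

Definition phi_pow (a0 alpha : R) (s : R) : R :=
  if Rle_dec s 0 then 0 else a0 * Rpower s (1 - alpha).

Definition KL_exponent {E : Type} sub ip (h : E -> option R) (xh : E) (alpha : R) : Prop :=
  exists a0, 0 < a0 /\ KL_with sub ip h xh (phi_pow a0 alpha).

Definition has_grad n (h : vec n -> R) (x g : vec n) : Prop :=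
  forall eps, 0 < eps -> exists delta, 0 < delta /\
    forall y, vnorm (vsub y x) < delta ->
      Rabs (h y - h x - dot g (vsub y x)) <= eps * vnorm (vsub y x).

Definition lipschitz n k (G : vec n -> vec k) (L : R) : Prop :=
  forall x y, vnorm (vsub (G x) (G y)) <= L * vnorm (vsub x y).

Definition cont_v n k (G : vec n -> vec k) : Prop :=
  forall x eps, 0 < eps -> exists delta, 0 < delta /\
    forall y, vnorm (vsub y x) < delta -> vnorm (vsub (G y) (G x)) < eps.

Definition cont_r n (h : vec n -> R) : Prop :=
  forall x eps, 0 < eps -> exists delta, 0 < delta /\
    forall y, vnorm (vsub y x) < delta -> Rabs (h y - h x) < eps.

Definition convex_fun n (h : vec n -> R) : Prop :=
  forall x y th, 0 <= th <= 1 ->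
    h (vadd (vscale th x) (vscale (1 - th) y)) <= th * h x + (1 - th) * h y.

Definition subdiff n (h : vec n -> R) (x v : vec n) : Prop :=
  limiting_subdiff (@vsub n) (@dot n) (fun z => Some (h z)) x v.

Definition Fval n (f P1 P2 : vec n -> R) (x : vec n) : R := f x + P1 x - P2 x.

Definition Fext n m (f P1 P2 : vec n -> R) (g : vec n -> vec m) (x : vec n) : option R :=
  if excluded_middle_informative (vle0 (g x)) then Some (Fval f P1 P2 x) else None.

Definition level_bounded n (F : vec n -> option R) : Prop :=
  forall r, exists M, forall x v, F x = Some v -> v <= r -> vnorm x <= M.

Definition wsum_grad n m (lam : vec m) (gradg : 'I_m -> vec n -> vec n) (x : vec n) : vec n :=
  fun j => \big[Rplus/0]_(i < m) (lam i * gradg i x j).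

Definition stationary n m (f P1 P2 : vec n -> R) (g : vec n -> vec m)
  (gradf : vec n -> vec n) (gradg : 'I_m -> vec n -> vec n) (x : vec n) : Prop :=
  vle0 (g x) /\
  exists lam : vec m, (forall i, 0 <= lam i) /\ (forall i, lam i * g x i = 0) /\
  exists u w, subdiff P1 x u /\ subdiff P2 x w /\
    forall j, gradf x j + u j - w j + wsum_grad lam gradg x j = 0.

Definition MFCQ n m (g : vec n -> vec m) (gradg : 'I_m -> vec n -> vec n) : Prop :=
  forall x, vle0 (g x) -> exists d : vec n,
    forall i, g x i = 0 -> dot (gradg i x) d < 0.

Definition Gbar n m (g : vec n -> vec m) (gradg : 'I_m -> vec n -> vec n)
  (x y : vec n) (w : vec m) : vec m :=
  fun i => g y i + dot (gradg i y) (vsub x y) + w i / 2 * (vnorm (vsub x y)) ^ 2.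

Definition E3 n m := (vec n * vec n * vec m)%type.
Definition sub3 n m (a b : E3 n m) : E3 n m :=
  let '(x1, y1, w1) := a in let '(x2, y2, w2) := b in
  (vsub x1 x2, vsub y1 y2, vsub w1 w2).
Definition ip3 n m (a b : E3 n m) : R :=
  let '(x1, y1, w1) := a in let '(x2, y2, w2) := b in
  dot x1 x2 + dot y1 y2 + dot w1 w2.

Definition Fbar n m (f P1 P2 : vec n -> R) (g : vec n -> vec m)
  (gradg : 'I_m -> vec n -> vec n) (z : E3 n m) : option R :=
  let '(x, y, w) := z in
  if excluded_middle_informative (vle0 (Gbar g gradg x y w))
  then Some (Fval f P1 P2 x) else None.

Definition sub_obj n (P1 : vec n -> R) (gradf : vec n -> vec n)
  (x xi : vec n) (Lf : R) (z : vec n) : R :=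
  dot (vsub (gradf x) xi) (vsub z x) + Lf / 2 * (vnorm (vsub z x)) ^ 2 + P1 z.

Definition sub_min n m (P1 : vec n -> R) (g : vec n -> vec m)
  (gradf : vec n -> vec n) (gradg : 'I_m -> vec n -> vec n)
  (x xi : vec n) (Lf : R) (Lg : vec m) (xt : vec n) : Prop :=
  vle0 (Gbar g gradg xt x Lg) /\
  forall z, vle0 (Gbar g gradg z x Lg) ->
    sub_obj P1 gradf x xi Lf xt <= sub_obj P1 gradf x xi Lf z.

(* ls_run ... x xi Lf0 Lg0 Lf Lg xn : the (terminating) line search of step (3),
   started from trial parameters (Lf0, Lg0) at iterate x with xi, accepts
   parameters (Lf, Lg) and the new iterate xn. *)
Inductive ls_run n m (f P1 P2 : vec n -> R) (g : vec n -> vec m)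
  (gradf : vec n -> vec n) (gradg : 'I_m -> vec n -> vec n) (c tau : R)
  (x xi : vec n) : R -> vec m -> R -> vec m -> vec n -> Prop :=
| ls_accept : forall Lf Lg xt,
    sub_min P1 g gradf gradg x xi Lf Lg xt ->
    vle0 (g xt) ->
    Fval f P1 P2 xt <= Fval f P1 P2 x - c / 2 * (vnorm (vsub xt x)) ^ 2 ->
    ls_run f P1 P2 g gradf gradg c tau x xi Lf Lg Lf Lg xt
| ls_incr_g : forall Lf Lg xt Lf' Lg' xn,
    sub_min P1 g gradf gradg x xi Lf Lg xt ->
    ~ vle0 (g xt) ->
    ls_run f P1 P2 g gradf gradg c tau x xi Lf (vscale tau Lg) Lf' Lg' xn ->
    ls_run f P1 P2 g gradf gradg c tau x xi Lf Lg Lf' Lg' xn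
| ls_incr_f : forall Lf Lg xt Lf' Lg' xn,
    sub_min P1 g gradf gradg x xi Lf Lg xt ->
    vle0 (g xt) ->
    ~ (Fval f P1 P2 xt <= Fval f P1 P2 x - c / 2 * (vnorm (vsub xt x)) ^ 2) ->
    ls_run f P1 P2 g gradf gradg c tau x xi (tau * Lf) Lg Lf' Lg' xn ->
    ls_run f P1 P2 g gradf gradg c tau x xi Lf Lg Lf' Lg' xn.

Definition SCP_ls_seq n m (f P1 P2 : vec n -> R) (g : vec n -> vec m)
  (gradf : vec n -> vec n) (gradg : 'I_m -> vec n -> vec n)
  (c Llo Lhi tau : R) (x : nat -> vec n) (Lf : nat -> R) (Lg : nat -> vec m) : Prop :=
  vle0 (g (x 0%nat)) /\
  forall t : nat, exists (xi : vec n) (Lf0 : R) (Lg0 : vec m),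
    subdiff P2 (x t) xi /\
    Llo <= Lf0 <= Lhi /\ (forall i, Llo <= Lg0 i <= Lhi) /\
    ls_run f P1 P2 g gradf gradg c tau (x t) xi Lf0 Lg0 (Lf t) (Lg t) (x (S t)).

(* Main.v *)
(** The points z_t = (x_{t+1}, x_t, Lg_t) form a gradient-like descent sequence for Fbar.  The line
    search keeps Lf_t and Lg_t bounded and yields F(x_{t+1}) <= F(x_t) - (c/2) |x_{t+1} - x_t|^2.
    MFCQ and compactness give a uniform Slater point for the subproblems, hence bounded multipliers;
    the KKT conditions then show that accumulation points are stationary and produce, once the
    iterates are close to the region where P2 is smooth, a Frechet subgradient of Fbar at z_t of norm
    at most C |x_{t+1} - x_t|.  Since Lg_t need not converge, the KL inequality is uniformized over
    all accumulation points of z_t; with d_t = |x_{t+1} - x_t| and s_t = F(x_t) - lim F it gives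
      d_{t+1} <= d_t / 2 + (C/c) (phi(s_{t+1}) - phi(s_{t+2})),
    so the trajectory has finite length and its tail after t is at most d_t + (2C/c) phi(s_{t+1}).
    For phi(s) = A s^(1-alpha) the same inequality reads s_{t+1}^(2 alpha) <= K (s_t - s_{t+1}), and
    the rates for s_t transfer to |x_t - x*| through this tail bound. *)

Require Import Defs.
From Stdlib Require Import Reals Classical ClassicalEpsilon FunctionalExtensionality Lra.
From HB Require Import structures.
From mathcomp Require Import all_boot zify.
Set Implicit Arguments.
Unset Strict Implicit.
Unset Printing Implicit Defensive.
Open Scope R_scope.
#[local] Arguments pow : simpl never.

(** * Vectors, inner products and norms *)

(** [Fbar] is the natural merit function because the subproblem at x_t is constrained by exactly
    [Gbar] <= 0 with y = x_t and w = Lg_t. Its KKT multipliers therefore also serve for [Fbar] at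
    z_t: the terms with the gradients of g cancel in the first block of the subgradient, and what
    remains is controlled by the step x_{t+1} - x_t. The price is an index shift, since [Fbar] at
    z_t is F(x_{t+1}): the slope of phi at s_{t+1} is paired with the earlier step d_t, whence the
    term d_t / 2 in the recursion. Two facts are missing at the outset and dictate the order. P2 is
    smooth only around stationary points, so stationarity of the accumulation points must come
    before any subgradient of [Fbar]. Neither x_t nor Lg_t is known to converge, so each local
    statement (Slater points, smoothness of P2, KL inequality) has to be made uniform; all of them
    go through one abstract form of compactness, used for sets of points as well as for sets of
    indices. *)

HB.instance Definition _ := Monoid.isComLaw.Build R 0 Rplus
  (fun x y z => esym (Rplus_assoc x y z)) Rplus_comm Rplus_0_l.

Lemma sumR_add (I : Type) (r : seq I) (P : pred I) (F G : I -> R) :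
  \big[Rplus/0]_(i <- r | P i) (F i + G i) =
  \big[Rplus/0]_(i <- r | P i) F i + \big[Rplus/0]_(i <- r | P i) G i.
Proof. exact: big_split. Qed.

Lemma sumR_scale (I : Type) (r : seq I) (P : pred I) (a : R) (F : I -> R) :
  \big[Rplus/0]_(i <- r | P i) (a * F i) = a * \big[Rplus/0]_(i <- r | P i) F i.
Proof.
symmetry; apply: (big_ind2 (fun s t => a * s = t)) => //; first by ring.
by move=> x1 x2 y1 y2 <- <-; ring.
Qed.

Lemma sumR_sub (I : Type) (r : seq I) (P : pred I) (F G : I -> R) :
  \big[Rplus/0]_(i <- r | P i) (F i - G i) =
  \big[Rplus/0]_(i <- r | P i) F i - \big[Rplus/0]_(i <- r | P i) G i.
Proof.
rewrite (_ : forall a b, a - b = a + -1 * b); last by move=> a b; ring.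
rewrite -sumR_scale -sumR_add; apply: eq_bigr => i _; ring.
Qed.

Lemma sumR_le (I : Type) (r : seq I) (P : pred I) (F G : I -> R) :
  (forall i, P i -> F i <= G i) ->
  \big[Rplus/0]_(i <- r | P i) F i <= \big[Rplus/0]_(i <- r | P i) G i.
Proof.
move=> H; apply: (big_ind2 (fun s t => s <= t)) => //; first by lra.
by move=> *; lra.
Qed.

Lemma sumR_ge0 (I : Type) (r : seq I) (P : pred I) (F : I -> R) :
  (forall i, P i -> 0 <= F i) -> 0 <= \big[Rplus/0]_(i <- r | P i) F i.
Proof. move=> H; apply: big_ind => //; [lra | move=> *; lra]. Qed.

Lemma sumR_term_le (I : finType) (F : I -> R) (i : I) :
  (forall j, 0 <= F j) -> F i <= \big[Rplus/0]_(j : I) F j.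
Proof.
move=> H; rewrite (bigD1 i) //=.
have := @sumR_ge0 _ (index_enum I) (fun j => j != i) F (fun j _ => H j); lra.
Qed.

Lemma sumR_eq0 (I : finType) (F : I -> R) :
  (forall j, F j <= 0) -> 0 <= \big[Rplus/0]_(j : I) F j -> forall j, F j = 0.
Proof.
move=> H H0 j.
have := @sumR_term_le _ (fun j => - F j) j.
have -> : \big[Rplus/0]_(j : I) - F j = - \big[Rplus/0]_(j : I) F j.
  rewrite (_ : forall a, - a = -1 * a); last by move=> a; ring.
  rewrite -sumR_scale; apply: eq_bigr => i _; ring.
move=> H1; have {}H1 := H1 (fun j => ltac:(have := H j; lra)).
have := H j; lra.
Qed.

Lemma sumR_const_bound (I : finType) (F : I -> R) (K : R) :
  (forall j, F j <= K) -> \big[Rplus/0]_(j : I) F j <= INR #|I| * K.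
Proof.
move=> H; apply: (Rle_trans _ (\big[Rplus/0]_(j : I) K)).
  by apply: sumR_le => i _; exact: H.
rewrite big_const; elim: #|I| => [|k IH]; first by rewrite /=; lra.
rewrite S_INR /=; lra.
Qed.

Lemma vec_ext n (x y : vec n) : (forall i, x i = y i) -> x = y.
Proof. exact: functional_extensionality. Qed.

Lemma dotC n (x y : vec n) : dot x y = dot y x.
Proof. by apply: eq_bigr => i _; rewrite Rmult_comm. Qed.

Lemma dotDl n (x y z : vec n) : dot (vadd x y) z = dot x z + dot y z.
Proof. by rewrite -sumR_add; apply: eq_bigr => i _; rewrite /vadd; ring. Qed.

Lemma dotBl n (x y z : vec n) : dot (vsub x y) z = dot x z - dot y z.
Proof. by rewrite -sumR_sub; apply: eq_bigr => i _; rewrite /vsub; ring. Qed.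

Lemma dotZl n a (x z : vec n) : dot (vscale a x) z = a * dot x z.
Proof. by rewrite -sumR_scale; apply: eq_bigr => i _; rewrite /vscale; ring. Qed.

Lemma dotDr n (x y z : vec n) : dot z (vadd x y) = dot z x + dot z y.
Proof. by rewrite !(dotC z) dotDl. Qed.

Lemma dotBr n (x y z : vec n) : dot z (vsub x y) = dot z x - dot z y.
Proof. by rewrite !(dotC z) dotBl. Qed.

Lemma dotZr n a (x z : vec n) : dot z (vscale a x) = a * dot z x.
Proof. by rewrite !(dotC z) dotZl. Qed.

Definition dotE := (dotDl, dotBl, dotZl, dotDr, dotBr, dotZr).

Lemma dot_wsum_grad n m (lam : vec m) (G : 'I_m -> vec n -> vec n) y z :
  dot (wsum_grad lam G y) z = \big[Rplus/0]_(i < m) (lam i * dot (G i y) z).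
Proof.
rewrite /dot /wsum_grad.
under eq_bigr => i _ do rewrite Rmult_comm -sumR_scale.
rewrite exchange_big /=; apply: eq_bigr => i _; rewrite -sumR_scale.
by apply: eq_bigr => j _; ring.
Qed.

Lemma dot_ge0 n (x : vec n) : 0 <= dot x x.
Proof. by apply: sumR_ge0 => i _; have := Rle_0_sqr (x i); rewrite /Rsqr. Qed.

Lemma vnorm_ge0 n (x : vec n) : 0 <= vnorm x.
Proof. exact: sqrt_pos. Qed.

Lemma vnorm_sq n (x : vec n) : vnorm x ^ 2 = dot x x.
Proof. by rewrite -Rsqr_pow2 Rsqr_sqrt //; exact: dot_ge0. Qed.

(** The quadratic is evaluated at its minimizer -b / c. If c = 0 it is affine, and b <> 0 would let
    it reach -1. *)
Lemma discriminant_le (a b c : R) :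
  0 <= a -> 0 <= c -> (forall t, 0 <= a + 2 * t * b + t * t * c) -> b * b <= a * c.
Proof.
move=> Ha Hc H; case: (Req_dec c 0) => [c0|c0].
  case: (Req_dec b 0) => [->|b0]; first nra.
  have := H (- (a + 1) / (2 * b)); rewrite c0.
  have -> : a + 2 * (- (a + 1) / (2 * b)) * b = -1 by field.
  lra.
have := H (- b / c).
have -> : a + 2 * (- b / c) * b + - b / c * (- b / c) * c = a - b * b / c by field.
move=> H1.
have : b * b / c * c <= a * c by apply: Rmult_le_compat_r; lra.
by have -> : b * b / c * c = b * b by field.
Qed.

Lemma cauchy_schwarz n (x y : vec n) : Rabs (dot x y) <= vnorm x * vnorm y.
Proof.
apply: Rsqr_incr_0_var; last by apply: Rmult_le_pos; exact: vnorm_ge0.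
rewrite -Rsqr_abs Rsqr_mult (Rsqr_pow2 (vnorm x)) (Rsqr_pow2 (vnorm y)) !vnorm_sq.
apply: discriminant_le; try exact: dot_ge0.
move=> t; have := dot_ge0 (vadd x (vscale t y)); rewrite !dotE (dotC y x); lra.
Qed.

Lemma dot_le n (x y : vec n) : dot x y <= vnorm x * vnorm y.
Proof. by have := cauchy_schwarz x y; have := Rle_abs (dot x y); lra. Qed.

Lemma vnormD n (x y : vec n) : vnorm (vadd x y) <= vnorm x + vnorm y.
Proof.
have ? := vnorm_ge0 x; have ? := vnorm_ge0 y.
apply: Rsqr_incr_0_var; last lra.
rewrite !Rsqr_pow2 vnorm_sq !dotE (dotC y x) -!vnorm_sq.
have := dot_le x y; lra.
Qed.

Lemma vnormZ n a (x : vec n) : vnorm (vscale a x) = Rabs a * vnorm x.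
Proof.
by rewrite /vnorm !dotE -Rmult_assoc sqrt_mult ?sqrt_Rsqr_abs //;
  [have := Rle_0_sqr a | exact: dot_ge0].
Qed.

Lemma vnormZ_pos n a (x : vec n) : 0 <= a -> vnorm (vscale a x) = a * vnorm x.
Proof. by move=> H; rewrite vnormZ Rabs_pos_eq. Qed.

Lemma vnorm_sub_sym n (x y : vec n) : vnorm (vsub x y) = vnorm (vsub y x).
Proof.
have -> : vsub x y = vscale (-1) (vsub y x) by apply: vec_ext => i; rewrite /vsub /vscale; ring.
by rewrite vnormZ Rabs_Ropp Rabs_R1 Rmult_1_l.
Qed.

Lemma vnorm_sub_tri n (x y z : vec n) : vnorm (vsub x z) <= vnorm (vsub x y) + vnorm (vsub y z).
Proof.
have -> : vsub x z = vadd (vsub x y) (vsub y z); last exact: vnormD.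
by apply: vec_ext => i; rewrite /vsub /vadd; ring.
Qed.

Lemma vnormB n (x y : vec n) : vnorm (vsub x y) <= vnorm x + vnorm y.
Proof.
have -> : vsub x y = vadd x (vscale (-1) y) by apply: vec_ext => i; rewrite /vsub /vadd /vscale; ring.
have := vnormD x (vscale (-1) y); rewrite vnormZ Rabs_Ropp Rabs_R1; lra.
Qed.

Lemma vnorm_le_sub n (x y : vec n) : vnorm x <= vnorm (vsub x y) + vnorm y.
Proof.
have {1}-> : x = vadd (vsub x y) y; last exact: vnormD.
by apply: vec_ext => i; rewrite /vsub /vadd; ring.
Qed.

Lemma coord_le n (x : vec n) i : Rabs (x i) <= vnorm x.
Proof.
apply: Rsqr_incr_0_var; last exact: vnorm_ge0.
rewrite -Rsqr_abs Rsqr_pow2 (Rsqr_pow2 (vnorm x)) vnorm_sq -Rsqr_pow2.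
by apply: (sumR_term_le (F := fun i => x i * x i)) => j; have := Rle_0_sqr (x j).
Qed.

Lemma vnorm_le_sum n (x : vec n) : vnorm x <= \big[Rplus/0]_(i < n) Rabs (x i).
Proof.
have S0 : 0 <= \big[Rplus/0]_(i < n) Rabs (x i) by apply: sumR_ge0 => i _; exact: Rabs_pos.
apply: Rsqr_incr_0_var => //.
rewrite Rsqr_pow2 vnorm_sq /Rsqr -sumR_scale; apply: sumR_le => i _.
have := @sumR_term_le _ (fun i => Rabs (x i)) i (fun j => Rabs_pos _).
have H0 := Rabs_pos (x i).
have -> : x i * x i = Rabs (x i) * Rabs (x i) by rewrite -Rabs_mult Rabs_pos_eq //; exact: Rle_0_sqr.
by move=> /= H; apply: Rmult_le_compat_r.
Qed.

Lemma vnorm_le_coords n (x : vec n) K : (forall i, Rabs (x i) <= K) -> vnorm x <= INR n * K.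
Proof.
move=> H; apply: Rle_trans; first exact: vnorm_le_sum.
have := @sumR_const_bound _ (fun i => Rabs (x i)) K H; by rewrite card_ord.
Qed.

Lemma vnorm_lt_coords n eps : 0 < eps ->
  exists d, 0 < d /\ forall x : vec n, (forall i, Rabs (x i) < d) -> vnorm x < eps.
Proof.
move=> He; have Hn := pos_INR n.
(* The + 1 keeps the divisor positive in dimension 0. *)
have Hp : 0 < eps / (INR n + 1) by apply: Rdiv_lt_0_compat; lra.
exists (eps / (INR n + 1)); split => // x H.
apply: Rle_lt_trans; first by apply: (@vnorm_le_coords _ _ (eps / (INR n + 1))) => i; have := H i; lra.
apply: (Rlt_le_trans _ ((INR n + 1) * (eps / (INR n + 1)))); first nra.
by right; field; lra.
Qed.

Lemma vnorm0_eq n (x y : vec n) : vnorm (vsub x y) <= 0 -> x = y.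
Proof.
move=> H; apply: vec_ext => i; have H1 := coord_le (vsub x y) i.
have H2 := Rle_trans _ _ _ H1 H.
by have := Rle_abs (vsub x y i); have := Rle_abs (- vsub x y i); rewrite Rabs_Ropp /vsub in H2 *; lra.
Qed.

Lemma vsubxx n (x : vec n) : vnorm (vsub x x) = 0.
Proof.
have -> : vsub x x = vscale 0 x by apply: vec_ext => i; rewrite /vsub /vscale; ring.
by rewrite vnormZ Rabs_R0 Rmult_0_l.
Qed.

Lemma vnorm0 n : vnorm (fun _ : 'I_n => 0) = 0.
Proof.
have -> : (fun _ => 0) = vsub (fun _ : 'I_n => 0) (fun _ => 0) by apply: vec_ext => i; rewrite /vsub; ring.
exact: vsubxx.
Qed.

Definition norm3 n m (z : E3 n m) := ex_norm (@ip3 n m) z.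

Section Norm3.
Variables n m : nat.
Implicit Types (x y : vec n) (w : vec m).

Lemma norm3_ge0 (z : E3 n m) : 0 <= norm3 z.
Proof. exact: sqrt_pos. Qed.

Lemma norm3_sq x y w : norm3 (x, y, w) ^ 2 = vnorm x ^ 2 + vnorm y ^ 2 + vnorm w ^ 2.
Proof.
rewrite !vnorm_sq -Rsqr_pow2 Rsqr_sqrt //=.
have := dot_ge0 x; have := dot_ge0 y; have := dot_ge0 w; lra.
Qed.

Lemma norm3_le_sum x y w : norm3 (x, y, w) <= vnorm x + vnorm y + vnorm w.
Proof.
have ? := vnorm_ge0 x; have ? := vnorm_ge0 y; have ? := vnorm_ge0 w.
apply: Rsqr_incr_0_var; last lra.
rewrite !Rsqr_pow2 norm3_sq; nra.
Qed.

Lemma norm3_ge_comp x y w :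
  vnorm x <= norm3 (x, y, w) /\ vnorm y <= norm3 (x, y, w) /\ vnorm w <= norm3 (x, y, w).
Proof.
have ? := norm3_ge0 (x, y, w).
by split; [|split]; apply: Rsqr_incr_0_var => //; rewrite !Rsqr_pow2 norm3_sq;
 have := pow2_ge_0 (vnorm x); have := pow2_ge_0 (vnorm y); have := pow2_ge_0 (vnorm w); lra.
Qed.

End Norm3.

(** * Compactness *)

(** The members of an ideal are its negligible sets. Taking the finite sets of indices gives
    Bolzano-Weierstrass; taking the sets on which an estimate holds with some constant gives a
    uniform constant. *)
Definition ideal (T : Type) (Q : (T -> Prop) -> Prop) : Prop :=
  [/\ Q (fun _ => False), (forall A B : T -> Prop, (forall t, A t -> B t) -> Q B -> Q A) &
      (forall A B : T -> Prop, Q A -> Q B -> Q (fun t => A t \/ B t))].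

(** The cluster value is the supremum of the levels a for which the part of [A] with u < a lies in
    [Q]. If a window around it were in [Q], joining it to such a part with a > l - eps would make l
    + eps an admissible level. *)
Lemma ideal_cluster_coord (T : Type) (Q : (T -> Prop) -> Prop) (u : T -> R) (A : T -> Prop) (M : R) :
  ideal Q -> (forall t, A t -> Rabs (u t) <= M) -> ~ Q A ->
  exists l, forall eps, 0 < eps -> ~ Q (fun t => A t /\ Rabs (u t - l) < eps).
Proof.
move=> [Q0 Qs QU] HM HA.
have ab t : A t -> - M <= u t <= M.
  by move=> /HM H; have := Rle_abs (u t); have := Rle_abs (- u t); rewrite Rabs_Ropp; lra.
pose E a := Q (fun t => A t /\ u t < a).
have Ebd : is_upper_bound E M.
  move=> a Ea; apply: Rnot_lt_le => Ma; apply: HA; apply: Qs Ea => t At; split=> //.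
  by have := ab t At; lra.
have Ene : exists a, E a by exists (- M); apply: Qs Q0 => t [/ab H1 H2]; lra.
have [l [Hub Hlub]] := completeness E (ex_intro _ M Ebd) Ene.
exists l => eps He HQ.
have [a [Ea Ha]] : exists a, E a /\ l - eps < a.
  apply: NNPP => Hno; have : l <= l - eps; last by lra.
  apply: Hlub => a Ea; apply: Rnot_lt_le => Hlt; apply: Hno; by exists a.
have : E (l + eps).
  apply: Qs (QU _ _ Ea HQ) => t [At Ht].
  case: (Rlt_dec (u t) a) => Hta; [by left | right; split=> //].
  by apply: Rabs_def1; lra.
by move=> /Hub; lra.
Qed.

(** Induction on the coordinates: localizing near the values already found turns [Q] into a new
    ideal [Q'], and the one-dimensional case for [Q'] supplies the next coordinate. *)
Lemma ideal_cluster_seq (T : Type) (I : eqType) (s : seq I) (u : T -> I -> R) (A : T -> Prop) (M : R)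
    (Q : (T -> Prop) -> Prop) :
  ideal Q -> (forall t, A t -> forall i, Rabs (u t i) <= M) -> ~ Q A ->
  exists l : I -> R, forall eps, 0 < eps ->
    ~ Q (fun t => A t /\ forall i, i \in s -> Rabs (u t i - l i) < eps).
Proof.
move=> idQ HM HA; elim: s => [|i s [l' Hl']].
  exists (fun _ => 0) => eps He H; apply: HA; case: idQ => _ Qs _.
  by apply: Qs H => t At.
pose Q' B := exists eps, 0 < eps /\ Q (fun t => B t /\ forall j, j \in s -> Rabs (u t j - l' j) < eps).
have idQ' : ideal Q'.
  case: idQ => Q0 Qs QU; split.
  - exists 1; split; first lra. by apply: Qs Q0 => t [].
  - by move=> B C HBC [e [He HQ]]; exists e; split=> //; apply: Qs HQ => t [/HBC ? ?].
  - move=> B C [e [He HQ]] [e' [He' HQ']]; exists (Rmin e e'); split; first exact: Rmin_glb_lt.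
    apply: Qs (QU _ _ HQ HQ') => t [[Bt|Ct] Hj]; [left|right]; split=> // j /Hj H;
      apply: (Rlt_le_trans _ _ _ H); [exact: Rmin_l | exact: Rmin_r].
have nQ' : ~ Q' A by move=> [e [He]]; exact: Hl'.
have [li Hli] := ideal_cluster_coord idQ' (fun t At => HM t At i) nQ'.
exists (fun j => if j == i then li else l' j) => eps He HQ.
apply: (Hli eps He); exists eps; split=> //.
case: idQ => _ Qs _; apply: Qs HQ => t [[At Hti] Hj]; split=> // j.
by rewrite inE; case: eqVneq => [->|_] //= /Hj.
Qed.

Lemma ideal_cluster (T : Type) (k : nat) (u : T -> vec k) (A : T -> Prop) (M : R)
    (Q : (T -> Prop) -> Prop) :
  ideal Q -> (forall t, A t -> vnorm (u t) <= M) -> ~ Q A ->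
  exists l : vec k, forall eps, 0 < eps -> ~ Q (fun t => A t /\ vnorm (vsub (u t) l) < eps).
Proof.
move=> idQ HM HA.
have HM' t : A t -> forall i, Rabs (u t i) <= M by move=> /HM H i; apply: Rle_trans H; exact: coord_le.
have [l Hl] := ideal_cluster_seq (enum 'I_k) idQ HM' HA.
exists l => eps He HQ; have [d [Hd Hcoord]] := @vnorm_lt_coords k eps He.
apply: (Hl d Hd); case: idQ => _ Qs _; apply: Qs HQ => t [At Ht]; split=> //.
by apply: Hcoord => i; apply: Ht; rewrite mem_enum.
Qed.

(* Compactness of bounded sets, in the form: a property of sets that is inherited by subsets and
   finite unions holds on a bounded set as soon as it holds locally. *)
Lemma ideal_local_global (T : Type) (k : nat) (u : T -> vec k) (A : T -> Prop) (M : R)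
    (Q : (T -> Prop) -> Prop) :
  ideal Q -> (forall t, A t -> vnorm (u t) <= M) ->
  (forall l, exists eps, 0 < eps /\ Q (fun t => A t /\ vnorm (vsub (u t) l) < eps)) -> Q A.
Proof.
move=> idQ HM Hloc; apply: NNPP => HA; have [l Hl] := ideal_cluster idQ HM HA.
have [eps [He HQ]] := Hloc l; exact: (Hl eps He HQ).
Qed.

(** Compactness of a product without forming the product space: the second variable is treated with
    the ideal of sets that fall in [Q] after localization of the first one near [l1]. *)
Lemma ideal_local_global2 (T : Type) (k1 k2 : nat) (u : T -> vec k1) (w : T -> vec k2)
    (A : T -> Prop) (M1 M2 : R) (Q : (T -> Prop) -> Prop) :
  ideal Q -> (forall t, A t -> vnorm (u t) <= M1) -> (forall t, A t -> vnorm (w t) <= M2) ->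
  (forall l1 l2, exists eps, 0 < eps /\
     Q (fun t => A t /\ vnorm (vsub (u t) l1) < eps /\ vnorm (vsub (w t) l2) < eps)) -> Q A.
Proof.
move=> idQ HM1 HM2 Hloc; apply: (ideal_local_global idQ HM1) => l1; apply: NNPP => Hno.
pose Q' B := exists eps, 0 < eps /\ Q (fun t => B t /\ vnorm (vsub (u t) l1) < eps).
have idQ' : ideal Q'.
  case: idQ => Q0 Qs QU; split.
  - exists 1; split; first lra. by apply: Qs Q0 => t [].
  - by move=> B C HBC [e [He HQ]]; exists e; split=> //; apply: Qs HQ => t [/HBC ? ?].
  - move=> B C [e [He HQ]] [e' [He' HQ']]; exists (Rmin e e'); split; first exact: Rmin_glb_lt.
    apply: Qs (QU _ _ HQ HQ') => t [[Bt|Ct] H]; [left|right]; split=> //;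
      apply: (Rlt_le_trans _ _ _ H); [exact: Rmin_l | exact: Rmin_r].
apply: Hno; apply: (ideal_local_global idQ' HM2) => l2.
have [eps [He HQ]] := Hloc l1 l2; exists eps; split=> //; exists eps; split=> //.
by case: idQ => _ Qs _; apply: Qs HQ => t [[? ?] ?].
Qed.

(** * Convergence of sequences of vectors *)

Definition vcv k (u : nat -> vec k) (l : vec k) : Prop :=
  forall i, Un_cv (fun t => u t i) (l i).

Lemma Un_cv_ssr (u : nat -> R) (l : R) :
  Un_cv u l <-> forall eps, 0 < eps -> exists N : nat, forall t : nat, (N <= t)%nat -> Rabs (u t - l) < eps.
Proof.
by split=> H eps He; have [N HN] := H eps He; exists N => t Ht; apply: HN; lia.
Qed.

Lemma Un_cv_sub (u : nat -> R) (l : R) (s : nat -> nat) :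
  (forall k, (k <= s k)%nat) -> Un_cv u l -> Un_cv (fun k => u (s k)) l.
Proof.
move=> Hs H eps He; have [N HN] := H eps He; exists N => t Ht; apply: HN.
have := Hs t; lia.
Qed.

Lemma vcv_sub k (u : nat -> vec k) (l : vec k) (s : nat -> nat) :
  (forall k, (k <= s k)%nat) -> vcv u l -> vcv (fun k => u (s k)) l.
Proof. by move=> Hs H i; apply: (@Un_cv_sub (fun t => u t i)). Qed.

Lemma vcv_norm k (u : nat -> vec k) (l : vec k) :
  vcv u l <-> forall eps, 0 < eps -> exists N : nat, forall t : nat, (N <= t)%nat -> vnorm (vsub (u t) l) < eps.
Proof.
split=> [H eps He|H i]; last first.
  apply/Un_cv_ssr => eps He; have [N HN] := H eps He; exists N => t Ht.
  by apply: Rle_lt_trans (HN t Ht); exact: (coord_le (vsub (u t) l) i).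
have [d [Hd Hc]] := @vnorm_lt_coords k eps He.
pose Q (A : 'I_k -> Prop) := exists N : nat, forall t : nat, (N <= t)%nat -> forall i, A i -> Rabs (u t i - l i) < d.
have HQ (s : seq 'I_k) : Q (fun i => i \in s).
  elim: s => [|i s [N HN]]; first by exists 0%N.
  have [N' HN'] := (proj1 (Un_cv_ssr _ _) (H i)) d Hd.
  exists (maxn N N') => t Ht j; rewrite inE => /orP [/eqP ->|Hj]; first by apply: HN'; lia.
  by apply: HN => //; lia.
have [N HN] := HQ (enum 'I_k); exists N => t Ht; apply: Hc => i; apply: HN => //.
by rewrite mem_enum.
Qed.

(** The ideal is that of bounded sets of indices. The extracted [s] satisfies t <= s t, which lets
    tails pass to the subsequence and is stable under composition. *)
Lemma bolzano_weierstrass_vec k (u : nat -> vec k) (M : R) :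
  (forall t, vnorm (u t) <= M) ->
  exists (s : nat -> nat) (l : vec k), (forall t, (t <= s t)%nat) /\ vcv (fun t => u (s t)) l.
Proof.
move=> HM.
pose Q (A : nat -> Prop) := exists N : nat, forall t, A t -> (t < N)%nat.
have idQ : ideal Q.
  split; first by exists 0%N.
    by move=> A B HAB [N HN]; exists N => t /HAB /HN.
  by move=> A B [N HN] [N' HN']; exists (maxn N N') => t [/HN|/HN']; lia.
have nQ : ~ Q (fun _ => True) by move=> [N HN]; have := HN N I; lia.
have [l Hl] := ideal_cluster idQ (fun t _ => HM t) nQ.
have Hp (t : nat) : 0 < / (INR t + 1) by apply: Rinv_0_lt_compat; have := pos_INR t; lra.
have Hex (t : nat) : exists p : nat, (t <= p)%nat /\ vnorm (vsub (u p) l) < / (INR t + 1).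
  apply: NNPP => Hno; apply: (Hl _ (Hp t)); exists t => p [_ Hpl].
  by rewrite ltnNge; apply/negP => Htp; apply: Hno; exists p.
pose s t := proj1_sig (constructive_indefinite_description _ (Hex t)).
have Hs t : (t <= s t)%nat /\ vnorm (vsub (u (s t)) l) < / (INR t + 1).
  by rewrite /s; case: constructive_indefinite_description.
exists s, l; split=> [t|]; first by case: (Hs t).
apply/vcv_norm => eps He; have [N HN] := archimed_cor1 eps He.
exists N => t Ht; have [_ H1] := Hs t; apply: (Rlt_trans _ _ _ H1).
case: HN => H2 H3; apply: Rle_lt_trans H2; apply: Rinv_le_contravar; first by apply: lt_0_INR.
have := le_INR N t; have : (N <= t)%coq_nat by lia.
by move=> /[swap] /[apply]; lra.
Qed.

Lemma cv_sum (I : finType) (u : I -> nat -> R) (l : I -> R) :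
  (forall i, Un_cv (u i) (l i)) ->
  Un_cv (fun t => \big[Rplus/0]_(i : I) u i t) (\big[Rplus/0]_(i : I) l i).
Proof.
move=> H; elim: (index_enum I) => [|i r IH].
  rewrite big_nil => eps He; exists 0%N => t _; rewrite big_nil /Rdist Rminus_diag Rabs_R0; lra.
rewrite big_cons; apply: Un_cv_ext (CV_plus _ _ _ _ (H i) IH) => t.
by rewrite big_cons.
Qed.

Lemma cv_const (a : R) : Un_cv (fun _ => a) a.
Proof. by move=> eps He; exists 0%N => t _; rewrite /Rdist Rminus_diag Rabs_R0; lra. Qed.

Lemma cv_dot k (u v : nat -> vec k) a b :
  vcv u a -> vcv v b -> Un_cv (fun t => dot (u t) (v t)) (dot a b).
Proof. by move=> Hu Hv; apply: cv_sum => i; apply: CV_mult. Qed.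

Lemma cv_vsub k (u v : nat -> vec k) a b :
  vcv u a -> vcv v b -> vcv (fun t => vsub (u t) (v t)) (vsub a b).
Proof. by move=> Hu Hv i; apply: CV_minus; [apply: Hu | apply: Hv]. Qed.

Lemma vcv_const k (a : vec k) : vcv (fun _ => a) a.
Proof. by move=> i; exact: cv_const. Qed.

Lemma cont_r_cv n (h : vec n -> R) (u : nat -> vec n) l :
  cont_r h -> vcv u l -> Un_cv (fun t => h (u t)) (h l).
Proof.
move=> Hc /vcv_norm H; apply/Un_cv_ssr => eps He; have [d [Hd Hy]] := Hc l eps He.
by have [N HN] := H d Hd; exists N => t Ht; apply: Hy; apply: HN.
Qed.

Lemma cont_v_cv n k (h : vec n -> vec k) (u : nat -> vec n) l :
  cont_v h -> vcv u l -> vcv (fun t => h (u t)) (h l).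
Proof.
move=> Hc /vcv_norm H; apply/vcv_norm => eps He; have [d [Hd Hy]] := Hc l eps He.
by have [N HN] := H d Hd; exists N => t Ht; apply: Hy; apply: HN.
Qed.

(** The sets on which [h] is bounded above form an ideal. A one-sided bound suffices because [h]
    will be an absolute value or a norm. *)
Lemma loc_bounded_on_ball n (h : vec n -> R) (M : R) :
  (forall x, exists d K, 0 < d /\ forall y, vnorm (vsub y x) < d -> h y <= K) ->
  exists K, 0 <= K /\ forall x, vnorm x <= M -> h x <= K.
Proof.
move=> Hloc.
pose Q (A : vec n -> Prop) := exists K, 0 <= K /\ forall x, A x -> h x <= K.
apply: (@ideal_local_global _ _ id (fun x => vnorm x <= M) M Q) => //.
  split; first by exists 0; split; [lra|].
  - by move=> A B HAB [K [HK H]]; exists K; split=> // t /HAB /H.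
  - move=> A B [K [HK H]] [K' [HK' H']]; exists (K + K'); split; first lra.
    by move=> t [/H|/H'] ?; lra.
move=> l; have [d [K [Hd HK]]] := Hloc l; exists d; split=> //.
exists (Rabs K); split; first exact: Rabs_pos.
by move=> y [_ /HK]; have := Rle_abs K; lra.
Qed.

Lemma cont_r_bounded n (h : vec n -> R) (M : R) :
  cont_r h -> exists K, 0 <= K /\ forall x, vnorm x <= M -> Rabs (h x) <= K.
Proof.
move=> Hc; apply: (loc_bounded_on_ball (h := fun x => Rabs (h x))) => x.
have [d [Hd Hy]] := Hc x 1 Rlt_0_1; exists d, (Rabs (h x) + 1); split=> // y /Hy H.
by have := Rabs_triang (h y - h x) (h x); rewrite (_ : h y - h x + h x = h y); [lra | ring].
Qed.

Lemma cont_v_bounded n k (h : vec n -> vec k) (M : R) :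
  cont_v h -> exists K, 0 <= K /\ forall x, vnorm x <= M -> vnorm (h x) <= K.
Proof.
move=> Hc; apply: (loc_bounded_on_ball (h := fun x => vnorm (h x))) => x.
have [d [Hd Hy]] := Hc x 1 Rlt_0_1; exists d, (vnorm (h x) + 1); split=> // y /Hy H.
by have := vnorm_le_sub (h y) (h x); lra.
Qed.

Lemma finite_upper_bound (I : finType) (P : I -> R -> Prop) :
  (forall i K K', K <= K' -> P i K -> P i K') -> (forall i, exists K, P i K) ->
  exists K, 0 <= K /\ forall i, P i K.
Proof.
move=> Hmon Hex.
have : exists K, 0 <= K /\ forall i, i \in enum I -> P i K.
  elim: (enum I) => [|i s [K [HK H]]]; first by exists 0; split; [lra|].
  have [K' HK'] := Hex i; exists (K + Rabs K'); have := Rabs_pos K'; have := Rle_abs K'.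
  move=> H1 H2; split; first lra.
  move=> j; rewrite inE => /orP [/eqP ->|/H]; [apply: Hmon HK'|apply: Hmon]; lra.
by move=> [K [HK H]]; exists K; split=> // i; apply: H; rewrite mem_enum.
Qed.

(** * Convex functions and Lagrange multipliers *)

Definition convex_set n (X : vec n -> Prop) : Prop :=
  forall a b th, 0 <= th <= 1 -> X a -> X b -> X (vadd (vscale th a) (vscale (1 - th) b)).

Lemma convex_comb_sublevel n (G : vec n -> R) : convex_fun G -> convex_set (fun z => G z <= 0).
Proof.
move=> cG a b th Hth Ha Hb; apply: Rle_trans; first exact: cG.
by nra.
Qed.

(* The multiplier is the supremum of the slopes (v - h z) / G z over G z > 0; convexity bounds it
   by every slope over G z < 0. *)
Lemma lagrange_one n (X : vec n -> Prop) (h G : vec n -> R) (v : R) (z0 : vec n) :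
  convex_set X -> convex_fun h -> convex_fun G -> X z0 -> G z0 < 0 ->
  (forall z, X z -> G z <= 0 -> v <= h z) ->
  exists lam, 0 <= lam /\ forall z, X z -> v <= h z + lam * G z.
Proof.
move=> cX ch cG Xz0 Gz0 Hv.
(* The element 0 makes the set nonempty and its supremum nonnegative. *)
pose E a := a = 0 \/ exists z, [/\ X z, 0 < G z & a = (v - h z) / G z].
have cross z z' : X z -> X z' -> 0 < G z -> G z' < 0 ->
    (v - h z) / G z <= (h z' - v) / (- G z').
  move=> Xz Xz' Gz Gz'; set p := G z in Gz *; set q := - G z'.
  have q0 : 0 < q by rewrite /q; lra.
  have pq : 0 < p + q by lra.
  (* With weight q / (p + q) on z and p / (p + q) on z', the convex bound on [G] is exactly 0, so
     the combination is feasible. *)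
  have Hth : 0 <= q / (p + q) <= 1.
    split; first by apply: Rlt_le; apply: Rdiv_lt_0_compat.
    apply: (Rmult_le_reg_r (p + q)) => //; field_simplify; lra.
  have H1 : v <= q / (p + q) * h z + (1 - q / (p + q)) * h z'.
    apply: Rle_trans (ch z z' _ Hth); apply: Hv; first exact: cX.
    apply: Rle_trans; first exact: cG.
    by right; rewrite -/p (_ : G z' = - q); [field; lra | rewrite /q; ring].
  have H2 : (p + q) * v <= q * h z + p * h z'.
    have := Rmult_le_compat_l (p + q) _ _ (Rlt_le _ _ pq) H1.
    by rewrite (_ : (p + q) * (q / (p + q) * h z + (1 - q / (p + q)) * h z') = q * h z + p * h z');
      [|field; lra].
  apply: (Rmult_le_reg_r (p * q)); first nra.
  have -> : (v - h z) / p * (p * q) = (v - h z) * q by field; lra.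
  have -> : (h z' - v) / q * (p * q) = (h z' - v) * p by field; lra.
  lra.
have sl0 z' : X z' -> G z' < 0 -> 0 <= (h z' - v) / (- G z').
  move=> Xz' Gz'; have := Hv z' Xz' (Rlt_le _ _ Gz') => H.
  by apply: Rmult_le_pos; [lra | apply: Rlt_le; apply: Rinv_0_lt_compat; lra].
have ub z' : X z' -> G z' < 0 -> is_upper_bound E ((h z' - v) / (- G z')).
  by move=> Xz' Gz' a [->|[z [Xz Gz ->]]]; [exact: sl0 | exact: cross].
have [l [Hub Hlub]] := completeness E (ex_intro _ _ (ub z0 Xz0 Gz0)) (ex_intro _ 0 (or_introl erefl)).
exists l; split; first by apply: Hub; left.
move=> z Xz; case: (Rtotal_order (G z) 0) => [Gz|[Gz|Gz]].
- have H := Hlub _ (ub z Xz Gz).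
  have := Rmult_le_compat_r (- G z) _ _ (ltac:(lra)) H.
  have -> : (h z - v) / - G z * - G z = h z - v by field; lra.
  lra.
- by rewrite Gz; have := Hv z Xz (Req_le _ _ Gz); lra.
- have H : (v - h z) / G z <= l by apply: Hub; right; exists z.
  have := Rmult_le_compat_r (G z) _ _ (Rlt_le _ _ Gz) H.
  have -> : (v - h z) / G z * G z = v - h z by field; lra.
  lra.
Qed.

Lemma convex_add n (h G : vec n -> R) (a : R) :
  0 <= a -> convex_fun h -> convex_fun G -> convex_fun (fun z => h z + a * G z).
Proof.
move=> a0 ch cG x y th Hth.
have := ch x y th Hth; have := Rmult_le_compat_l a _ _ a0 (cG x y th Hth); lra.
Qed.

(** One constraint is dualized at a time: the remaining ones define the convex set X of
    [lagrange_one], then h + l * G_i is again convex and takes the place of h. Since the list has no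
    repetition, giving the index i its own multiplier does not disturb those of the tail. *)
Lemma lagrange_seq n m (s : seq 'I_m) (h : vec n -> R) (G : 'I_m -> vec n -> R) (v : R) (z0 : vec n) :
  uniq s -> convex_fun h -> (forall i, convex_fun (G i)) -> (forall i, G i z0 < 0) ->
  (forall z, (forall i, i \in s -> G i z <= 0) -> v <= h z) ->
  exists lam : vec m, (forall i, 0 <= lam i) /\
    forall z, v <= h z + \big[Rplus/0]_(i <- s) (lam i * G i z).
Proof.
move=> Us ch cG Hz0; elim: s h ch Us => [|i s IH] h ch /=.
  move=> _ Hv; exists (fun _ => 0); split=> [i|z]; first lra.
  by rewrite big_nil Rplus_0_r; apply: Hv.
move=> /andP [nis Us] Hv.
have cX : convex_set (fun z => forall j, j \in s -> G j z <= 0).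
  by move=> a b th Hth Ha Hb j Hj; apply: convex_comb_sublevel => //; [apply: Ha|apply: Hb].
have [l [l0 Hl]] : exists lam, 0 <= lam /\
    forall z, (forall j, j \in s -> G j z <= 0) -> v <= h z + lam * G i z.
  apply: lagrange_one cX ch (cG i) _ (Hz0 i) _ => [j _|z Hz Gz]; first by apply: Rlt_le.
  by apply: Hv => j; rewrite inE => /orP [/eqP ->|/Hz].
have [lam [Hlam H]] := IH _ (convex_add l0 ch (cG i)) Us Hl.
exists (fun j => if j == i then l else lam j); split=> [j|z]; first by case: eqP.
rewrite big_cons eqxx; have := H z.
rewrite -Rplus_assoc (_ : \big[Rplus/0]_(j <- s) _ = \big[Rplus/0]_(j <- s) (lam j * G j z)) //.
apply: eq_big_seq => j Hj.
by case: eqP => // E; rewrite -E Hj in nis.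
Qed.

Lemma lagrange_multipliers n m (h : vec n -> R) (G : 'I_m -> vec n -> R) (v : R) (z0 : vec n) :
  convex_fun h -> (forall i, convex_fun (G i)) -> (forall i, G i z0 < 0) ->
  (forall z, (forall i, G i z <= 0) -> v <= h z) ->
  exists lam : vec m, (forall i, 0 <= lam i) /\
    forall z, v <= h z + \big[Rplus/0]_(i < m) (lam i * G i z).
Proof.
move=> ch cG Hz0 Hv; apply: (lagrange_seq (index_enum_uniq _) ch cG Hz0) => z Hz.
by apply: Hv => i; apply: Hz; rewrite mem_index_enum.
Qed.

(** * Subgradients of convex functions and the KKT conditions of the subproblem *)

Definition csubgrad n (P : vec n -> R) (x u : vec n) : Prop :=
  forall y, P x + dot u (vsub y x) <= P y.

(** If the affine minorant failed at y by some gap, then by convexity it would fail by at least th *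
    gap at the point dividing the segment from x to y in ratio th. This exceeds eps times the
    distance to x when eps is small against gap / |y - x|, however small th is. *)
Lemma csubgrad_local n (P : vec n -> R) (x u : vec n) :
  convex_fun P ->
  (forall eps, 0 < eps -> exists d, 0 < d /\ forall y, vnorm (vsub y x) < d ->
     P x + dot u (vsub y x) - eps * vnorm (vsub y x) <= P y) ->
  csubgrad P x u.
Proof.
move=> cP Hloc y; apply: Rnot_lt_le => Hlt.
set N := vnorm (vsub y x).
have N0 : 0 <= N := vnorm_ge0 _.
set gap := P x + dot u (vsub y x) - P y.
have gap0 : 0 < gap by rewrite /gap; lra.
have e0 : 0 < gap / (2 * (N + 1)) by apply: Rdiv_lt_0_compat; lra.
have [d [d0 Hd]] := Hloc _ e0.
pose th := Rmin 1 (d / (2 * (N + 1))).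
have th0 : 0 < th by apply: Rmin_glb_lt; [lra | apply: Rdiv_lt_0_compat; lra].
have th1 : th <= 1 by exact: Rmin_l.
have thd : th * N < d.
  have H : th <= d / (2 * (N + 1)) by exact: Rmin_r.
  have := Rmult_le_compat_r N _ _ N0 H.
  have H2 : d / (2 * (N + 1)) * (2 * (N + 1)) = d by field; lra.
  have : 0 < d / (2 * (N + 1)) by apply: Rdiv_lt_0_compat; lra.
  nra.
set p := vadd (vscale th y) (vscale (1 - th) x).
have Ep : vsub p x = vscale th (vsub y x).
  by apply: vec_ext => i; rewrite /p /vsub /vadd /vscale; ring.
have Np : vnorm (vsub p x) = th * N by rewrite Ep vnormZ_pos //; lra.
have := Hd p; rewrite Np Ep dotZr => /(_ thd) H1.
have H2 := cP y x th (conj (Rlt_le _ _ th0) th1); rewrite -/p in H2.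
have H3 : th * gap <= gap / (2 * (N + 1)) * (th * N) by rewrite /gap in H1 *; lra.
have H4 : gap / (2 * (N + 1)) * (th * N) = th * gap * (N / (2 * (N + 1))) by field; lra.
have H5 : N / (2 * (N + 1)) <= 1 / 2.
  apply: (Rmult_le_reg_r (2 * (N + 1))); first lra.
  have -> : N / (2 * (N + 1)) * (2 * (N + 1)) = N by field; lra.
  lra.
have H6 : 0 < th * gap by apply: Rmult_lt_0_compat.
rewrite H4 in H3; nra.
Qed.

Lemma csubgrad_subdiff n (P : vec n -> R) (x u : vec n) : csubgrad P x u -> subdiff P x u.
Proof.
move=> H; exists (P x); split=> //; exists (fun _ => x), (fun _ => u); split; [|split; [|split]].
- by move=> eps He; exists 0%N => k _; rewrite -[ex_norm _ _]/(vnorm _) vsubxx.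
- by move=> eps He; exists 0%N => k _; rewrite -[ex_norm _ _]/(vnorm _) vsubxx.
- move=> k; exists (P x); split=> // eps He; exists 1; split; first lra.
  move=> y hy _ [<-]; have := H y; have := Rmult_le_pos _ _ (Rlt_le _ _ He) (vnorm_ge0 (vsub y x)).
  rewrite -[ex_norm _ _]/(vnorm (vsub y x)); lra.
- by move=> eps He; exists 0%N => k _; exists (P x); split=> //; rewrite Rminus_diag Rabs_R0.
Qed.

Lemma conv_to_vcv n (u : nat -> vec n) l : conv_to (@vsub n) (@dot n) u l <-> vcv u l.
Proof. by split=> [H|/vcv_norm H]; [apply/vcv_norm|]. Qed.

(** For convex P each Frechet subgradient is global, and global inequalities pass to the limit. With
    the converse [csubgrad_subdiff], limiting subgradients of P1 and P2 are handled as global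
    inequalities from here on. *)
Lemma subdiff_csubgrad n (P : vec n -> R) (x u : vec n) :
  convex_fun P -> cont_r P -> subdiff P x u -> csubgrad P x u.
Proof.
move=> cP cc [hx [_ [xs [vs [/conv_to_vcv Hx [/conv_to_vcv Hv [HF _]]]]]]] y.
have Hk k : csubgrad P (xs k) (vs k).
  have [h0 [[<-] H]] := HF k; apply: csubgrad_local => // eps He.
  by have [d [Hd Hy]] := H eps He; exists d; split=> // z Hz; apply: (Hy z).
apply: (@Rle_cv_lim (fun k => P (xs k) + dot (vs k) (vsub y (xs k))) (fun _ => P y)) => [k||].
- exact: Hk.
- apply: CV_plus; first exact: cont_r_cv.
  by apply: cv_dot => //; apply: cv_vsub => //; exact: vcv_const.
- exact: cv_const.
Qed.

Lemma csubgrad_cv n (P : vec n -> R) (xs us : nat -> vec n) x u :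
  cont_r P -> vcv xs x -> vcv us u -> (forall k, csubgrad P (xs k) (us k)) -> csubgrad P x u.
Proof.
move=> cc Hx Hu H y.
apply: (@Rle_cv_lim (fun k => P (xs k) + dot (us k) (vsub y (xs k))) (fun _ => P y)) => [k||].
- exact: H.
- apply: CV_plus; first exact: cont_r_cv.
  by apply: cv_dot => //; apply: cv_vsub => //; exact: vcv_const.
- exact: cv_const.
Qed.

(** Moving from x by the unit vector u / |u| raises P by at least |u|, while both points stay in the
    ball of radius M + 1. *)
Lemma csubgrad_bounded n (P : vec n -> R) (M : R) :
  cont_r P -> exists K, 0 <= K /\ forall x u, vnorm x <= M -> csubgrad P x u -> vnorm u <= K.
Proof.
move=> cc; have [K [K0 HK]] := cont_r_bounded (M + 1) cc.
exists (2 * K); split; first lra.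
move=> x u Hx Hu; case: (Rle_lt_dec (vnorm u) 0) => [?|u0]; first lra.
pose e := vscale (/ vnorm u) u.
have Ne : vnorm e = 1 by rewrite /e vnormZ_pos; [field; lra | apply: Rlt_le; apply: Rinv_0_lt_compat].
have := Hu (vadd x e); have -> : vsub (vadd x e) x = e.
  by apply: vec_ext => i; rewrite /vsub /vadd; ring.
have -> : dot u e = vnorm u.
  by rewrite /e dotZr -vnorm_sq; field; lra.
have := HK x (ltac:(lra)); have := HK (vadd x e) (ltac:(have := vnormD x e; lra)).
have := Rle_abs (P (vadd x e)); have := Rle_abs (- P x); rewrite Rabs_Ropp; lra.
Qed.

Lemma sq_norm_shift n (a e : vec n) :
  vnorm (vadd a e) ^ 2 = vnorm a ^ 2 + 2 * dot a e + vnorm e ^ 2.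
Proof. by rewrite !vnorm_sq !dotE (dotC e a); ring. Qed.

Lemma convex_affine_sq n (p : vec n) (y : vec n) (a b : R) (P : vec n -> R) :
  0 <= b -> convex_fun P ->
  convex_fun (fun z => a + dot p (vsub z y) + b * vnorm (vsub z y) ^ 2 + P z).
Proof.
move=> b0 cP x z th Hth.
have -> : vsub (vadd (vscale th x) (vscale (1 - th) z)) y =
  vadd (vscale th (vsub x y)) (vscale (1 - th) (vsub z y)).
  by apply: vec_ext => i; rewrite /vsub /vadd /vscale; ring.
have HP := cP x z th Hth; move: (vsub x y) (vsub z y) => s t.
rewrite !vnorm_sq !dotE (dotC t s).
have H := dot_ge0 (vsub s t); rewrite !dotE (dotC t s) in H.
(* The convexity defect of b |.|^2 is th (1 - th) b |s - t|^2. *)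
have : 0 <= th * (1 - th) * b by apply: Rmult_le_pos => //; nra.
move: (dot s s) (dot t t) (dot s t) (dot p s) (dot p t) H HP => ss tt st ps pt H HP H1.
have := Rmult_le_pos _ _ H1 H; nra.
Qed.

Lemma convex_const n (a : R) : convex_fun (fun _ : vec n => a).
Proof. by move=> x y th Hth; lra. Qed.

Lemma convex_ext n (h h' : vec n -> R) : (forall z, h z = h' z) -> convex_fun h -> convex_fun h'.
Proof. by move=> E c x y th Hth; rewrite -!E; apply: c. Qed.

(** The point xt minimizes the Lagrangian: its inequality at xt makes the sum of the nonpositive
    products lam_i Gbar_i nonnegative, so each product vanishes. The part of the Lagrangian other
    than P1 is quadratic with curvature [kap], hence the stated vector is a subgradient of P1 up to
    an error kap / 2 |y - xt|^2, and [csubgrad_local] removes the error. *)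
Lemma subproblem_kkt n m (P1 : vec n -> R) (g : vec n -> vec m)
    (gradf : vec n -> vec n) (gradg : 'I_m -> vec n -> vec n)
    (x xi : vec n) (L : R) (w : vec m) (xt z0 : vec n) :
  convex_fun P1 -> 0 <= L -> (forall i, 0 <= w i) ->
  (forall i, Gbar g gradg z0 x w i < 0) ->
  sub_min P1 g gradf gradg x xi L w xt ->
  exists lam : vec m,
    [/\ forall i, 0 <= lam i,
        forall z, sub_obj P1 gradf x xi L xt <=
          sub_obj P1 gradf x xi L z + \big[Rplus/0]_(i < m) (lam i * Gbar g gradg z x w i),
        forall i, lam i * Gbar g gradg xt x w i = 0 &
        csubgrad P1 xt (fun j => - (gradf x j - xi j + L * (xt j - x j)
           + \big[Rplus/0]_(i < m) (lam i * (gradg i x j + w i * (xt j - x j)))))].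
Proof.
move=> cP L0 w0 Hz0 [Hfeas Hmin].
have cobj : convex_fun (sub_obj P1 gradf x xi L).
  have L2 : 0 <= L / 2 by lra.
  apply: convex_ext (convex_affine_sq (vsub (gradf x) xi) x 0 L2 cP) => z.
  by rewrite /sub_obj; ring.
have cG i : convex_fun (fun z => Gbar g gradg z x w i).
  have w2 : 0 <= w i / 2 by have := w0 i; lra.
  apply: convex_ext (convex_affine_sq (gradg i x) x (g x i) w2 (@convex_const n 0)) => z.
  by rewrite /Gbar; ring.
have [lam [lam0 Hlam]] := lagrange_multipliers cobj cG Hz0 Hmin.
have compl : forall i, lam i * Gbar g gradg xt x w i = 0.
  apply: (@sumR_eq0 _ (fun i => lam i * Gbar g gradg xt x w i)) => [i|].
    by have := lam0 i; have := Hfeas i; nra.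
  by have := Hlam xt; rewrite -{1}[sub_obj _ _ _ _ _ _]Rplus_0_r => /Rplus_le_reg_l.
exists lam; split=> //.
set u := fun j => _.
pose kap := L + \big[Rplus/0]_(i < m) (lam i * w i).
have kap0 : 0 <= kap.
  by apply: Rplus_le_le_0_compat => //; apply: sumR_ge0 => i _; apply: Rmult_le_pos.
have key y : P1 xt + dot u (vsub y xt) - kap / 2 * vnorm (vsub y xt) ^ 2 <= P1 y.
  have [e Ee] : exists e, e = vsub y xt by exists (vsub y xt).
  have [d Ed] : exists d, d = vsub xt x by exists (vsub xt x).
  rewrite -Ee.
  have Eyx : vsub y x = vadd d e by apply: vec_ext => j; rewrite Ee Ed /vadd /vsub; ring.
  have Eu : dot u e = - (dot (gradf x) e - dot xi e + L * dot d e
      + \big[Rplus/0]_(i < m) (lam i * (dot (gradg i x) e + w i * dot d e))).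
    have -> : u = vscale (-1) (vadd (vadd (vsub (gradf x) xi) (vscale L d))
       (wsum_grad lam (fun i z => vadd (gradg i z) (vscale (w i) d)) x)).
      by apply: vec_ext => j; rewrite /u Ed /vscale /vadd /vsub /wsum_grad; ring.
    rewrite dotZl 2!dotDl dotBl dotZl dot_wsum_grad.
    under eq_bigr => i _ do rewrite dotDl dotZl.
    by rewrite -Ropp_mult_distr_l Rmult_1_l.
  have ES : \big[Rplus/0]_(i < m) (lam i * Gbar g gradg y x w i) =
      \big[Rplus/0]_(i < m) (lam i * (dot (gradg i x) e + w i * dot d e)) +
      vnorm e ^ 2 / 2 * \big[Rplus/0]_(i < m) (lam i * w i).
    rewrite -sumR_scale -sumR_add; apply: eq_bigr => i _.
    have := compl i; rewrite /Gbar Eyx -Ed sq_norm_shift dotDr => C.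
    have -> : lam i * (g x i + (dot (gradg i x) d + dot (gradg i x) e) +
       w i / 2 * (vnorm d ^ 2 + 2 * dot d e + vnorm e ^ 2)) =
       lam i * (g x i + dot (gradg i x) d + w i / 2 * vnorm d ^ 2) +
       lam i * (dot (gradg i x) e + w i * dot d e + w i / 2 * vnorm e ^ 2) by field.
    rewrite C; field.
  have := Hlam y; rewrite ES /sub_obj Eyx -Ed sq_norm_shift dotDr Eu /kap dotBl.
  move: (\big[Rplus/0]_(i < m) _) (\big[Rplus/0]_(i < m) _) => S1 S2.
  rewrite (dotBl (gradf x) xi e); lra.
apply: csubgrad_local => // eps He.
exists (2 * eps / (kap + 1)); split; first by apply: Rdiv_lt_0_compat; lra.
move=> y Hy; apply: Rle_trans (key y); set N := vnorm _ in Hy *.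
have N0 : 0 <= N := vnorm_ge0 _.
have : N * (kap + 1) <= 2 * eps.
  have := Rmult_le_compat_r (kap + 1) _ _ (ltac:(lra)) (Rlt_le _ _ Hy).
  by have -> : 2 * eps / (kap + 1) * (kap + 1) = 2 * eps by field; lra.
nra.
Qed.

(** * Descent lemma, uniform Slater points and the line search *)

Lemma derivable_along_line n (f : vec n -> R) (gradf : vec n -> vec n) (x d : vec n) (t : R) :
  (forall z, has_grad f z (gradf z)) ->
  derivable_pt_lim (fun s => f (vadd x (vscale s d))) t (dot (gradf (vadd x (vscale t d))) d).
Proof.
move=> Hg eps He; set p := vadd x (vscale t d); have N0 := vnorm_ge0 d.
have e1 : 0 < eps / (2 * (vnorm d + 1)) by apply: Rdiv_lt_0_compat; lra.
have [del [Hd Hy]] := Hg p _ e1.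
have d1 : 0 < del / (vnorm d + 1) by apply: Rdiv_lt_0_compat; lra.
exists (mkposreal _ d1) => h h0 /= Hh; have Hp : 0 < Rabs h by exact: Rabs_pos_lt.
set y := vadd x (vscale (t + h) d).
have Ey : vsub y p = vscale h d by apply: vec_ext => i; rewrite /y /p /vsub /vadd /vscale; ring.
have Ny : vnorm (vsub y p) = Rabs h * vnorm d by rewrite Ey vnormZ.
have := Hy y; rewrite Ny Ey dotZr => H.
have Hlt : Rabs h * vnorm d < del.
  apply: (Rlt_le_trans _ (del / (vnorm d + 1) * (vnorm d + 1))); last by right; field; lra.
  apply: (Rle_lt_trans _ (Rabs h * (vnorm d + 1))); first nra.
  by apply: Rmult_lt_compat_r => //; lra.
have {}H := H Hlt.
have -> : (f y - f p) / h - dot (gradf p) d = (f y - f p - h * dot (gradf p) d) / h by field.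
rewrite /Rdiv Rabs_mult Rabs_inv -/(Rdiv _ _); apply: (Rmult_lt_reg_r (Rabs h)) => //.
have -> : Rabs (f y - f p - h * dot (gradf p) d) / Rabs h * Rabs h =
  Rabs (f y - f p - h * dot (gradf p) d) by field; lra.
apply: Rle_lt_trans H _.
have -> : eps / (2 * (vnorm d + 1)) * (Rabs h * vnorm d) =
   eps * Rabs h * (vnorm d / (2 * (vnorm d + 1))) by field; lra.
have H2 : vnorm d / (2 * (vnorm d + 1)) <= 1 / 2.
  apply: (Rmult_le_reg_r (2 * (vnorm d + 1))); first lra.
  have -> : vnorm d / (2 * (vnorm d + 1)) * (2 * (vnorm d + 1)) = vnorm d by field; lra.
  lra.
have H3 : 0 < eps * Rabs h by apply: Rmult_lt_0_compat.
nra.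
Qed.

(** The mean value theorem is applied along the segment to f minus its quadratic model; the
    Lipschitz bound makes the derivative of this difference nonpositive, so no integral is
    involved. *)
Lemma descent_lemma n (f : vec n -> R) (gradf : vec n -> vec n) (L : R) (x y : vec n) :
  (forall z, has_grad f z (gradf z)) -> lipschitz gradf L ->
  f y <= f x + dot (gradf x) (vsub y x) + L / 2 * vnorm (vsub y x) ^ 2.
Proof.
move=> Hg HL; have [d Ed] : exists d, d = vsub y x by exists (vsub y x).
rewrite -Ed; set a := dot (gradf x) d; set b := L / 2 * vnorm d ^ 2.
pose psi s := f (vadd x (vscale s d)) - (a * s + b * (s * s)).
pose psi' s := dot (gradf (vadd x (vscale s d))) d - (a * 1 + b * (1 * s + s * 1)).
have [||c [Hc Hc01]] := @MVT_cor2 psi psi' 0 1; first lra.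
  move=> s _; apply: derivable_pt_lim_minus; first exact: derivable_along_line.
  apply: (derivable_pt_lim_plus (fun s => a * s) (fun s => b * (s * s))).
    by apply: (derivable_pt_lim_scal (fun s => s)); exact: derivable_pt_lim_id.
  apply: (derivable_pt_lim_scal (fun s => s * s)).
  by apply: (derivable_pt_lim_mult (fun s => s) (fun s => s)); exact: derivable_pt_lim_id.
have : psi' c <= 0.
  rewrite /psi' /a /b; set p := vadd x (vscale c d).
  have := dot_le (vsub (gradf p) (gradf x)) d; rewrite dotBl.
  have H := HL p x.
  have Ep : vsub p x = vscale c d by apply: vec_ext => i; rewrite /p /vsub /vadd /vscale; ring.
  rewrite Ep vnormZ_pos in H; last lra.
  have := Rmult_le_compat_r _ _ _ (vnorm_ge0 d) H; lra.
have E0 : vadd x (vscale 0 d) = x by apply: vec_ext => i; rewrite /vadd /vscale; ring.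
have E1 : vadd x (vscale 1 d) = y by apply: vec_ext => i; rewrite Ed /vadd /vscale /vsub; ring.
rewrite /psi E0 E1 in Hc; lra.
Qed.

Lemma finite_pos_lower_bound (I : finType) (P : I -> R -> Prop) :
  (forall i d d', 0 < d' <= d -> P i d -> P i d') -> (forall i, exists d, 0 < d /\ P i d) ->
  exists d, 0 < d /\ forall i, P i d.
Proof.
move=> Hmon Hex.
have : exists d, 0 < d /\ forall i, i \in enum I -> P i d.
  elim: (enum I) => [|i s [d [Hd H]]]; first by exists 1; split; [lra|].
  have [d' [Hd' HP]] := Hex i; have Hm : 0 < Rmin d d' by exact: Rmin_glb_lt.
  exists (Rmin d d'); split=> // j; rewrite inE => /orP [/eqP ->|/H].
    by move: HP; apply: Hmon; split=> //; exact: Rmin_r.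
  by apply: Hmon; split=> //; exact: Rmin_l.
by move=> [d [Hd H]]; exists d; split=> // i; apply: H; rewrite mem_enum.
Qed.

Lemma cont_v_dot n (G : vec n -> vec n) (d l : vec n) (eps : R) :
  cont_v G -> 0 < eps -> exists del, 0 < del /\
    forall x, vnorm (vsub x l) < del -> dot (G x) d < dot (G l) d + eps.
Proof.
move=> cG He; have N0 := vnorm_ge0 d.
have e0 : 0 < eps / (vnorm d + 1) by apply: Rdiv_lt_0_compat; lra.
have [del [Hd Hx]] := cG l _ e0; exists del; split=> // x /Hx H.
have := dot_le (vsub (G x) (G l)) d; rewrite dotBl.
have : vnorm (vsub (G x) (G l)) * (vnorm d + 1) < eps.
  have := Rmult_lt_compat_r (vnorm d + 1) _ _ (ltac:(lra)) H.
  by have -> : eps / (vnorm d + 1) * (vnorm d + 1) = eps by field; lra.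
have := vnorm_ge0 (vsub (G x) (G l)); nra.
Qed.

Section UniformSlater.
Variables (n m : nat) (g : vec n -> vec m) (gradg : 'I_m -> vec n -> vec n).
Hypothesis cg : forall i, cont_r (fun z => g z i).
Hypothesis cgradg : forall i, cont_v (gradg i).

Lemma Gbar_along x d s w i :
  Gbar g gradg (vadd x (vscale s d)) x w i =
  g x i + s * dot (gradg i x) d + w i / 2 * (s * s * vnorm d ^ 2).
Proof.
rewrite /Gbar; have -> : vsub (vadd x (vscale s d)) x = vscale s d.
  by apply: vec_ext => j; rewrite /vsub /vadd /vscale; ring.
by rewrite dotZr !vnorm_sq !dotE; ring.
Qed.

(** At a constraint active at l, the linear decrease s * eta beats the quadratic term, which is at
    most s^2 B |d|^2 / 2, as soon as s (B |d|^2 + 1) <= eta. At an inactive one, part of the slack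
    absorbs both terms. All small s are allowed, since a single step length must later serve every
    constraint; the margin e depends on s. *)
Lemma local_slater_step (l d : vec n) (B : R) (i : 'I_m) :
  0 <= B -> g l i <= 0 -> (g l i = 0 -> dot (gradg i l) d < 0) ->
  exists s0, 0 < s0 /\ forall s, 0 < s <= s0 -> exists e, 0 < e /\
    forall x w, vnorm (vsub x l) < e -> g x i <= 0 -> 0 <= w i <= B ->
      Gbar g gradg (vadd x (vscale s d)) x w i <= - e.
Proof.
move=> B0 gl Hact; have D0 := pow2_ge_0 (vnorm d); set D := vnorm d ^ 2 in D0.
have BD0 : 0 <= B * D by exact: Rmult_le_pos.
have quad w s : 0 <= w i <= B -> 0 < s -> w i / 2 * (s * s * D) <= s * s * (B * D) / 2.
  move=> Hw Hs; have : 0 <= s * s * D by apply: Rmult_le_pos; nra.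
  nra.
case: (Req_dec (g l i) 0) => [gl0|gl0].
  pose eta := - dot (gradg i l) d / 2.
  have eta0 : 0 < eta by rewrite /eta; have := Hact gl0; lra.
  have s00 : 0 < eta / (B * D + 1) by apply: Rdiv_lt_0_compat; lra.
  exists (eta / (B * D + 1)); split=> // s [s0 Hs].
  have [del [del0 Hdel]] := @cont_v_dot n (gradg i) d l eta (cgradg i) eta0.
  have seta : 0 < s * eta by exact: Rmult_lt_0_compat.
  exists (Rmin del (s * eta / 2)); split; first by apply: Rmin_glb_lt; lra.
  move=> x w Hx gx Hw; rewrite Gbar_along -/D.
  have H1 := Hdel x (Rlt_le_trans _ _ _ Hx (Rmin_l _ _)).
  have H2 := Rmin_r del (s * eta / 2).
  have H3 := quad w s Hw s0.
  have H4 : s * (B * D + 1) <= eta.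
    have := Rmult_le_compat_r (B * D + 1) _ _ (ltac:(lra)) Hs.
    by have -> : eta / (B * D + 1) * (B * D + 1) = eta by field; lra.
  have H5 : s * dot (gradg i x) d <= s * - eta.
    apply: Rmult_le_compat_l; first lra.
    by move: H1; rewrite /eta; lra.
  nra.
pose gam := - g l i / 2.
have gam0 : 0 < gam by rewrite /gam; lra.
pose K := Rabs (dot (gradg i l) d) + 1 + B * D.
have K1 : 1 <= K by rewrite /K; have := Rabs_pos (dot (gradg i l) d); lra.
have s00 : 0 < Rmin 1 (gam / (2 * K)).
  by apply: Rmin_glb_lt; [lra | apply: Rdiv_lt_0_compat; lra].
exists (Rmin 1 (gam / (2 * K))); split=> // s [s0 Hs].
have s1 : s <= 1 := Rle_trans _ _ _ Hs (Rmin_l _ _).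
have sK : s * K <= gam / 2.
  have := Rmult_le_compat_r K _ _ (ltac:(lra)) (Rle_trans _ _ _ Hs (Rmin_r _ _)).
  by have -> : gam / (2 * K) * K = gam / 2 by field; lra.
have [del [del0 Hdel]] := @cont_v_dot n (gradg i) d l 1 (cgradg i) Rlt_0_1.
have [del' [del'0 Hdel']] := @cg i l _ gam0.
exists (Rmin (Rmin del del') (gam / 2)); split.
  by repeat apply: Rmin_glb_lt => //; lra.
move=> x w Hx gx Hw; rewrite Gbar_along -/D.
have Hx' := Rlt_le_trans _ _ _ Hx (Rmin_l _ _).
have H1 := Hdel x (Rlt_le_trans _ _ _ Hx' (Rmin_l _ _)).
have := Hdel' x (Rlt_le_trans _ _ _ Hx' (Rmin_r _ _)) => /Rabs_def2 [H1' _].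
have H2 := Rmin_r (Rmin del del') (gam / 2).
have H3 := quad w s Hw s0.
have H4 : s * dot (gradg i x) d <= s * (Rabs (dot (gradg i l) d) + 1).
  by apply: Rmult_le_compat_l; [lra | have := Rle_abs (dot (gradg i l) d); lra].
have H5 : s * s * (B * D) / 2 <= s * (B * D).
  have : 0 <= s * (B * D) by apply: Rmult_le_pos; lra.
  nra.
rewrite /K in sK; rewrite /gam in H1' H2 sK *; nra.
Qed.

(** MFCQ gives a direction at each feasible l, and x + s d with this direction is strictly feasible
    for the subproblem at every feasible x near l and every weight w in the box. Compactness makes
    the margin e and the distance K uniform; e is what will bound the multipliers. *)
Lemma uniform_slater (M B : R) :
  MFCQ g gradg -> 0 <= B ->
  exists e K, 0 < e /\ 0 <= K /\ forall x w, vle0 (g x) -> vnorm x <= M -> (forall i, 0 <= w i <= B) ->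
    exists z, vnorm (vsub z x) <= K /\ forall i, Gbar g gradg z x w i <= - e.
Proof.
move=> mfcq B0.
pose S (A : vec n -> Prop) e K := forall x w, A x -> (forall i, 0 <= w i <= B) ->
    exists z, vnorm (vsub z x) <= K /\ forall i, Gbar g gradg z x w i <= - e.
pose Q (A : vec n -> Prop) := exists e K, 0 < e /\ 0 <= K /\ S A e K.
suff : Q (fun x => vle0 (g x) /\ vnorm x <= M).
  by move=> [e [K [He [HK H]]]]; exists e, K; split=> //; split=> // x w gx Hx; apply: H.
apply: (@ideal_local_global _ _ id _ M) => [|x []|l] //.
  split; first by exists 1, 1; split; [lra|split; [lra|]].
  - by move=> A A' HA [e [K [He [HK H]]]]; exists e, K; split=> //; split=> // x w /HA; exact: H.
  - move=> A A' [e [K [He [HK H]]]] [e' [K' [He' [HK' H']]]]; exists (Rmin e e'), (K + K').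
    split; first exact: Rmin_glb_lt.
    split; first lra.
    move=> x w [Ax|Ax] Hw; [have [z [Hz Hi]] := H x w Ax Hw|have [z [Hz Hi]] := H' x w Ax Hw];
      exists z; split=> [|i]; try lra; have := Hi i.
      by have := Rmin_l e e'; lra.
    by have := Rmin_r e e'; lra.
case: (classic (vle0 (g l))) => [gl|]; last first.
  (* Near an infeasible l there are no feasible points, so any constants do. *)
  move=> /not_all_ex_not [i /Rnot_le_lt gl].
  have [d [d0 Hd]] := @cg i l _ gl; exists d; split=> //.
  exists 1, 1; split; [lra|split; [lra|]] => x w [[gx _] /Hd /Rabs_def2 [_ H]].
  by have := gx i; lra.
have [d Hd] := mfcq l gl.
have [s [s0 Hs]] : exists s, 0 < s /\ forall i, exists e, 0 < e /\
    forall x w, vnorm (vsub x l) < e -> g x i <= 0 -> 0 <= w i <= B ->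
      Gbar g gradg (vadd x (vscale s d)) x w i <= - e.
  have [s [s0 Hs]] : exists s0, 0 < s0 /\ forall i, forall s, 0 < s <= s0 -> exists e, 0 < e /\
    forall x w, vnorm (vsub x l) < e -> g x i <= 0 -> 0 <= w i <= B ->
      Gbar g gradg (vadd x (vscale s d)) x w i <= - e.
    apply: finite_pos_lower_bound => [i a a' Ha H s Hs|i]; first by apply: H; lra.
    by apply: local_slater_step => //; exact: Hd.
  by exists s; split=> // i; apply: Hs; lra.
have [e [e0 He]] : exists e, 0 < e /\ forall i,
    forall x w, vnorm (vsub x l) < e -> g x i <= 0 -> 0 <= w i <= B ->
      Gbar g gradg (vadd x (vscale s d)) x w i <= - e.
  apply: finite_pos_lower_bound => [i a a' Ha H x w Hx gx Hw|//].
  by have := H x w (ltac:(lra)) gx Hw; lra.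
exists e; split=> //; exists e, (vnorm (vscale s d)); split=> //; split; first exact: vnorm_ge0.
move=> x w [[gx _] Hx] Hw; exists (vadd x (vscale s d)); split=> [|i]; last exact: He.
right; congr (vnorm _); apply: vec_ext => j; rewrite /vsub /vadd; ring.
Qed.
End UniformSlater.

(** * Bounds on the line search parameters and on the multipliers *)

Lemma Gbar_majorizes n m (g : vec n -> vec m) (gradg : 'I_m -> vec n -> vec n) (L : R) x z w i :
  (forall z, has_grad (fun y => g y i) z (gradg i z)) -> lipschitz (gradg i) L -> L <= w i ->
  g z i <= Gbar g gradg z x w i.
Proof.
move=> Hg HL Hw; have := descent_lemma x z Hg HL; rewrite /Gbar.
have := pow2_ge_0 (vnorm (vsub z x)); nra.
Qed.

(** Backtracking multiplies the whole vector Lg by tau, so its entries stay between s * Llo and s *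
    Lhi for one common scale s. A trial violating constraint i has Lg_i < K by majorization, hence s
    * Llo < K and the next scale is at most tau K / Llo. A trial without sufficient decrease has Lf
    < Lipf + c, hence the next Lf stays below tau (Lipf + c). *)
Lemma ls_run_spec n m (f P1 P2 : vec n -> R) (g : vec n -> vec m)
    (gradf : vec n -> vec n) (gradg : 'I_m -> vec n -> vec n) (Lipf K c Llo Lhi tau BF S : R)
    (x xi : vec n) Lf0 Lg0 Lf Lg xn :
  (forall z, has_grad f z (gradf z)) -> lipschitz gradf Lipf ->
  (forall i z, has_grad (fun y => g y i) z (gradg i z)) -> (forall i, lipschitz (gradg i) K) ->
  1 < tau -> 0 < Llo -> tau * (Lipf + c) <= BF -> tau * K / Llo <= S ->
  vle0 (g x) -> csubgrad P2 x xi ->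
  ls_run f P1 P2 g gradf gradg c tau x xi Lf0 Lg0 Lf Lg xn ->
  0 < Lf0 <= BF -> (exists s, 1 <= s <= S /\ forall i, s * Llo <= Lg0 i <= s * Lhi) ->
  [/\ 0 < Lf <= BF, exists s, 1 <= s <= S /\ forall i, s * Llo <= Lg i <= s * Lhi,
      sub_min P1 g gradf gradg x xi Lf Lg xn, vle0 (g xn) &
      Fval f P1 P2 xn <= Fval f P1 P2 x - c / 2 * vnorm (vsub xn x) ^ 2].
Proof.
move=> Hf HLf Hg HLg Htau HLlo HBF HS gx Hxi; elim=> {Lf0 Lg0 Lf Lg xn}.
- by move=> Lf Lg xt Hmin gxt Hdec HL Hs; split.
- move=> Lf Lg xt Lf' Lg' xn Hmin /not_all_ex_not [i /Rnot_le_lt gxt] _ IH HL [s [Hs HsL]].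
  apply: IH => //; exists (tau * s).
  have HK : Lg i < K.
    apply: Rnot_le_lt => HK; have := Gbar_majorizes x xt (Hg i) (HLg i) HK.
    by have [Hfeas _] := Hmin; have := Hfeas i; lra.
  split; last by move=> j; rewrite /vscale; have := HsL j; nra.
  split; first nra.
  apply: Rle_trans HS; apply: (Rmult_le_reg_r Llo) => //.
  have -> : tau * K / Llo * Llo = tau * K by field; lra.
  have [H1 _] := HsL i.
  by rewrite Rmult_assoc; apply: Rmult_le_compat_l; lra.
- move=> Lf Lg xt Lf' Lg' xn Hmin gxt /Rnot_le_lt Hfail _ IH HL Hs.
  apply: IH => //; have N0 := pow2_ge_0 (vnorm (vsub xt x)).
  have Hlt : Lf < Lipf + c.
    have [_ Hopt] := Hmin.
    (* The current iterate x is feasible for the subproblem. Comparing xt with it, and using the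
       descent lemma for f and the subgradient of P2, gives F(xt) <= F(x) + (Lipf - Lf) / 2 |xt -
       x|^2. *)
    have := Hopt x; rewrite /sub_obj vsubxx.
    have -> : dot (vsub (gradf x) xi) (vsub x x) = 0 by rewrite dotBr; ring.
    have Hx : vle0 (Gbar g gradg x x Lg).
      move=> i; rewrite /Gbar vsubxx dotBr; have := gx i; lra.
    move=> /(_ Hx); rewrite dotBl.
    have := descent_lemma x xt Hf HLf; have := Hxi xt.
    rewrite /Fval in Hfail; move=> H1 H2 H3; apply: Rnot_le_lt => H4; nra.
  split; nra.
Qed.

Lemma sub_obj_bounded n (P1 : vec n -> R) (gradf : vec n -> vec n) (M Kxi BF K : R) :
  cont_r P1 -> cont_v gradf -> 0 <= M -> 0 <= Kxi -> 0 <= K -> 0 <= BF ->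
  exists C, 0 <= C /\ forall x xi L z, vnorm x <= M -> vnorm xi <= Kxi -> 0 <= L <= BF ->
    vnorm (vsub z x) <= K -> Rabs (sub_obj P1 gradf x xi L z) <= C.
Proof.
move=> cP cf M0 Kxi0 K0 BF0.
have [Kf [Kf0 HKf]] := cont_v_bounded M cf.
have [KP [KP0 HKP]] := cont_r_bounded (K + M) cP.
have C0 : 0 <= (Kf + Kxi) * K + BF / 2 * (K * K) by apply: Rplus_le_le_0_compat; nra.
exists ((Kf + Kxi) * K + BF / 2 * (K * K) + KP); split; first lra.
move=> x xi L z Hx Hxi HL Hz; rewrite /sub_obj.
set N := vnorm (vsub z x) in Hz *; have N0 : 0 <= N := vnorm_ge0 _.
have H1 : Rabs (dot (vsub (gradf x) xi) (vsub z x)) <= (Kf + Kxi) * K.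
  apply: Rle_trans; first exact: cauchy_schwarz.
  have := vnormB (gradf x) xi; have := HKf x Hx; rewrite -/N.
  by move=> ? ?; apply: Rmult_le_compat => //; [exact: vnorm_ge0 | lra].
have H2 : 0 <= L / 2 * N ^ 2 <= BF / 2 * (K * K).
  split; first nra.
  by rewrite (_ : N ^ 2 = N * N); [apply: Rmult_le_compat; nra | ring].
have H3 : Rabs (P1 z) <= KP.
  by apply: HKP; have := vnorm_le_sub z x; rewrite -/N; lra.
apply: Rle_trans; first exact: Rabs_triang.
apply: Rle_trans; first by apply: Rplus_le_compat_r; exact: Rabs_triang.
rewrite (Rabs_pos_eq (L / 2 * _)); lra.
Qed.

(** The Lagrangian inequality at the Slater point, where every constraint is at most -e, bounds e *
    lam_i by the difference of two objective values, hence by 2 * C. *)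
Lemma multipliers_bounded n m (P1 : vec n -> R) (g : vec n -> vec m)
    (gradf : vec n -> vec n) (gradg : 'I_m -> vec n -> vec n) (M Kxi BF BG : R) :
  convex_fun P1 -> cont_r P1 -> cont_v gradf -> (forall i, cont_r (fun z => g z i)) ->
  (forall i, cont_v (gradg i)) -> MFCQ g gradg -> 0 <= M -> 0 <= Kxi -> 0 <= BF -> 0 <= BG ->
  exists Lam, 0 <= Lam /\ forall x xi L w xt, vle0 (g x) -> vnorm x <= M -> vnorm xi <= Kxi ->
    0 <= L <= BF -> (forall i, 0 <= w i <= BG) -> vnorm xt <= M ->
    sub_min P1 g gradf gradg x xi L w xt ->
    exists lam : vec m,
      [/\ forall i, 0 <= lam i <= Lam, forall i, lam i * Gbar g gradg xt x w i = 0 &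
          csubgrad P1 xt (fun j => - (gradf x j - xi j + L * (xt j - x j)
           + \big[Rplus/0]_(i < m) (lam i * (gradg i x j + w i * (xt j - x j)))))].
Proof.
move=> cvP cP cf cg cgg mfcq M0 Kxi0 BF0 BG0.
have [e [K [e0 [K0 Hsl]]]] := uniform_slater cg cgg M mfcq BG0.
(* The radius K + 2 M covers both the Slater point and the subproblem solution, which lies in the
   ball of radius M. *)
have K2 : 0 <= K + 2 * M by lra.
have [C [C0 HC]] := sub_obj_bounded cP cf M0 Kxi0 K2 BF0.
exists (2 * C / e); split; first by apply: Rmult_le_pos; [lra | apply: Rlt_le; exact: Rinv_0_lt_compat].
move=> x xi L w xt gx Hx Hxi HL Hw Hxt Hmin.
have [z [Hz Hzi]] := Hsl x w gx Hx Hw.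
have [|i|i|lam [lam0 Hlag Hcompl Hsub]] := subproblem_kkt cvP _ _ (z0 := z) _ Hmin.
- lra.
- by have := Hw i; lra.
- by have := Hzi i; lra.
exists lam; split=> // i; split; first exact: lam0.
apply: (Rmult_le_reg_r e) => //; have -> : 2 * C / e * e = 2 * C by field; lra.
have H1 := HC x xi L z Hx Hxi HL (ltac:(lra)).
have H2 := HC x xi L xt Hx Hxi HL (ltac:(have := vnormB xt x; lra)).
have H3 : \big[Rplus/0]_(i < m) (lam i * Gbar g gradg z x w i) <= - (lam i * e).
  apply: (Rle_trans _ (\big[Rplus/0]_(i < m) (-1 * (lam i * e)))).
    by apply: sumR_le => j _; have := Rmult_le_compat_l _ _ _ (lam0 j) (Hzi j); lra.
  rewrite sumR_scale.
  have := @sumR_term_le _ (fun i => lam i * e) i (fun j => Rmult_le_pos _ _ (lam0 j) (Rlt_le _ _ e0)).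
  lra.
have := Hlag z; have := Rle_abs (sub_obj P1 gradf x xi L z).
have := Rle_abs (- sub_obj P1 gradf x xi L xt); rewrite Rabs_Ropp; lra.
Qed.

(** * Frechet subgradients of Fbar *)

(** Frechet differentiability on triples. The derivative is a bare function of linear growth, which
    is the property that the sum and product rules propagate. *)
Definition diff3 n m (F : E3 n m -> R) (z0 : E3 n m) (l : E3 n m -> R) : Prop :=
  (exists C, 0 <= C /\ forall h, Rabs (l h) <= C * norm3 h) /\
  forall eps, 0 < eps -> exists d, 0 < d /\ forall z, norm3 (sub3 z z0) < d ->
    Rabs (F z - F z0 - l (sub3 z z0)) <= eps * norm3 (sub3 z z0).

Section Diff3.
Variables n m : nat.
Implicit Types (F G : E3 n m -> R) (z h : E3 n m) (l : E3 n m -> R).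

Lemma diff3_ext F F' z0 l l' :
  (forall z, F z = F' z) -> (forall h, l h = l' h) -> diff3 F z0 l -> diff3 F' z0 l'.
Proof.
move=> EF El [[C [C0 HC]] H]; split; first by exists C; split=> // h; rewrite -El.
by move=> eps He; have [d [Hd Hz]] := H eps He; exists d; split=> // z; rewrite -!EF -El; exact: Hz.
Qed.

Lemma diff3_affine F z0 l (C : R) :
  0 <= C -> (forall h, Rabs (l h) <= C * norm3 h) -> (forall z, F z - F z0 = l (sub3 z z0)) ->
  diff3 F z0 l.
Proof.
move=> C0 HC HF; split; first by exists C.
move=> eps He; exists 1; split; first lra.
move=> z _; rewrite HF Rminus_diag Rabs_R0; apply: Rmult_le_pos; [lra | exact: norm3_ge0].
Qed.

Lemma diff3_const a z0 : diff3 (fun _ => a) z0 (fun _ => 0).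
Proof.
by apply: (@diff3_affine _ _ _ 0) => [|h|z]; rewrite ?Rabs_R0; lra.
Qed.

Lemma diff3_add F G z0 l k :
  diff3 F z0 l -> diff3 G z0 k -> diff3 (fun z => F z + G z) z0 (fun h => l h + k h).
Proof.
move=> [[C [C0 HC]] H] [[C' [C'0 HC']] H']; split.
  exists (C + C'); split; first lra.
  by move=> h; have := Rabs_triang (l h) (k h); have := HC h; have := HC' h; lra.
move=> eps He; have [d [Hd Hz]] := H (eps / 2) (ltac:(lra)); have [d' [Hd' Hz']] := H' (eps / 2) (ltac:(lra)).
exists (Rmin d d'); split; first exact: Rmin_glb_lt.
move=> z Hzd; have := Hz z (Rlt_le_trans _ _ _ Hzd (Rmin_l _ _)).
have := Hz' z (Rlt_le_trans _ _ _ Hzd (Rmin_r _ _)).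
have := Rabs_triang (F z - F z0 - l (sub3 z z0)) (G z - G z0 - k (sub3 z z0)).
rewrite (_ : F z - F z0 - l (sub3 z z0) + (G z - G z0 - k (sub3 z z0)) =
  F z + G z - (F z0 + G z0) - (l (sub3 z z0) + k (sub3 z z0))); [lra | ring].
Qed.

Lemma diff3_local_lipschitz F z0 l :
  diff3 F z0 l -> exists C d, 0 <= C /\ 0 < d /\ forall z, norm3 (sub3 z z0) < d ->
    Rabs (F z - F z0) <= C * norm3 (sub3 z z0).
Proof.
move=> [[C [C0 HC]] H]; have [d [Hd Hz]] := H 1 Rlt_0_1.
exists (C + 1), d; split; first lra.
split=> // z /Hz; have := HC (sub3 z z0).
have := Rabs_triang (F z - F z0 - l (sub3 z z0)) (l (sub3 z z0)).
rewrite (_ : F z - F z0 - l (sub3 z z0) + l (sub3 z z0) = F z - F z0); [lra | ring].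
Qed.

Lemma diff3_mul F G z0 l k :
  diff3 F z0 l -> diff3 G z0 k ->
  diff3 (fun z => F z * G z) z0 (fun h => F z0 * k h + G z0 * l h).
Proof.
move=> dF dG; have [cF [d1 [cF0 [d10 HF]]]] := diff3_local_lipschitz dF.
have [cG [d2 [cG0 [d20 HG]]]] := diff3_local_lipschitz dG.
case: dF dG => [[C [C0 HC]] H] [[C' [C'0 HC']] H'].
have aF := Rabs_pos (F z0); have aG := Rabs_pos (G z0).
split.
  exists (Rabs (F z0) * C' + Rabs (G z0) * C); split; first by apply: Rplus_le_le_0_compat; nra.
  move=> h; apply: Rle_trans; first exact: Rabs_triang.
  rewrite !Rabs_mult; have := Rmult_le_compat_l _ _ _ aF (HC' h).
  by have := Rmult_le_compat_l _ _ _ aG (HC h); lra.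
move=> eps He.
(* K adds the coefficients of the two first-order remainders and of the product of increments;
   keeping the distance below eps / K makes that product linear too. *)
pose K := Rabs (F z0) + Rabs (G z0) + cF * cG + 1.
have cc : 0 <= cF * cG by exact: Rmult_le_pos.
have K0 : 1 <= K by rewrite /K; lra.
have e0 : 0 < eps / K by apply: Rdiv_lt_0_compat; lra.
have [d3 [d30 Hz]] := H _ e0; have [d4 [d40 Hz']] := H' _ e0.
exists (Rmin (Rmin (Rmin d1 d2) (Rmin d3 d4)) (eps / K)); split.
  by repeat apply: Rmin_glb_lt.
move=> z; set N := norm3 (sub3 z z0) => HN.
have N0 : 0 <= N := norm3_ge0 _.
have L1 := Rlt_le_trans _ _ _ HN (Rmin_l _ _).
have Le := Rlt_le_trans _ _ _ HN (Rmin_r _ _).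
have L12 := Rlt_le_trans _ _ _ L1 (Rmin_l _ _); have L34 := Rlt_le_trans _ _ _ L1 (Rmin_r _ _).
have {}HF := HF z (Rlt_le_trans _ _ _ L12 (Rmin_l _ _)).
have {}HG := HG z (Rlt_le_trans _ _ _ L12 (Rmin_r _ _)).
have {}Hz := Hz z (Rlt_le_trans _ _ _ L34 (Rmin_l _ _)).
have {}Hz' := Hz' z (Rlt_le_trans _ _ _ L34 (Rmin_r _ _)).
rewrite -/N in HF HG Hz Hz'.
set rF := F z - F z0 - _ in Hz; set rG := G z - G z0 - _ in Hz'.
have -> : F z * G z - F z0 * G z0 - (F z0 * k (sub3 z z0) + G z0 * l (sub3 z z0)) =
  F z0 * rG + G z0 * rF + (F z - F z0) * (G z - G z0) by rewrite /rF /rG; ring.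
apply: Rle_trans; first exact: Rabs_triang.
apply: Rle_trans; first by apply: Rplus_le_compat_r; exact: Rabs_triang.
rewrite !Rabs_mult.
have H1 := Rmult_le_compat_l _ _ _ aF Hz'; have H2 := Rmult_le_compat_l _ _ _ aG Hz.
have H3 : Rabs (F z - F z0) * Rabs (G z - G z0) <= (cF * N) * (cG * N).
  by apply: Rmult_le_compat => //; exact: Rabs_pos.
have H4 : (cF * N) * (cG * N) <= (cF * cG) * (eps / K * N).
  have -> : cF * N * (cG * N) = (cF * cG) * (N * N) by ring.
  by apply: Rmult_le_compat_l => //; apply: Rmult_le_compat_r => //; lra.
have H5 : eps * N = (Rabs (F z0) + Rabs (G z0) + cF * cG + 1) * (eps / K * N).
  by rewrite -/K; field; lra.
have := Rmult_le_pos _ _ (Rlt_le _ _ e0) N0; lra.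
Qed.

Lemma diff3_scale a F z0 l : diff3 F z0 l -> diff3 (fun z => a * F z) z0 (fun h => a * l h).
Proof.
move=> H; apply: (diff3_ext _ _ (diff3_mul (diff3_const a z0) H)) => // h /=; ring.
Qed.

Lemma diff3_sum (I : finType) (F : I -> E3 n m -> R) z0 (l : I -> E3 n m -> R) :
  (forall i, diff3 (F i) z0 (l i)) ->
  diff3 (fun z => \big[Rplus/0]_(i : I) F i z) z0 (fun h => \big[Rplus/0]_(i : I) l i h).
Proof.
move=> H; elim: (index_enum I) => [|i r IH].
  by apply: diff3_ext (diff3_const 0 z0) => z; rewrite big_nil.
by apply: diff3_ext (diff3_add (H i) IH) => z; rewrite big_cons.
Qed.

Lemma norm3_proj1 h : vnorm h.1.1 <= norm3 h.
Proof. by case: h => [[a b] w]; have [] := norm3_ge_comp a b w. Qed.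

Lemma norm3_proj2 h : vnorm h.1.2 <= norm3 h.
Proof. by case: h => [[a b] w]; have [? []] := norm3_ge_comp a b w. Qed.

Lemma norm3_proj3 h : vnorm h.2 <= norm3 h.
Proof. by case: h => [[a b] w]; have [? []] := norm3_ge_comp a b w. Qed.

Lemma sub3E z h : sub3 z h = (vsub z.1.1 h.1.1, vsub z.1.2 h.1.2, vsub z.2 h.2).
Proof. by case: z h => [[a b] w] [[a' b'] w']. Qed.

Lemma diff3_comp (pr : E3 n m -> vec n) (f : vec n -> R) (v : vec n) z0 :
  (forall z h, pr (sub3 z h) = vsub (pr z) (pr h)) -> (forall h, vnorm (pr h) <= norm3 h) ->
  has_grad f (pr z0) v -> diff3 (fun z => f (pr z)) z0 (fun h => dot v (pr h)).
Proof.
move=> Hsub Hpr Hg; split.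
  exists (vnorm v); split=> [|h]; first exact: vnorm_ge0.
  apply: Rle_trans; first exact: cauchy_schwarz.
  by apply: Rmult_le_compat_l => //; exact: vnorm_ge0.
move=> eps He; have [d [Hd Hy]] := Hg eps He; exists d; split=> // z Hz; rewrite Hsub.
have Hle := Hpr (sub3 z z0); rewrite Hsub in Hle.
apply: Rle_trans; first by apply: Hy; lra.
by apply: Rmult_le_compat_l => //; lra.
Qed.

Definition fst3 (z : E3 n m) : vec n := z.1.1.
Definition snd3 (z : E3 n m) : vec n := z.1.2.

Lemma diff3_fst (f : vec n -> R) (v : vec n) z0 :
  has_grad f (fst3 z0) v -> diff3 (fun z => f (fst3 z)) z0 (fun h => dot v (fst3 h)).
Proof. by apply: diff3_comp => [z h|h]; [rewrite sub3E | exact: norm3_proj1]. Qed.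

Lemma diff3_snd (f : vec n -> R) (v : vec n) z0 :
  has_grad f (snd3 z0) v -> diff3 (fun z => f (snd3 z)) z0 (fun h => dot v (snd3 h)).
Proof. by apply: diff3_comp => [z h|h]; [rewrite sub3E | exact: norm3_proj2]. Qed.

Lemma diff3_gap z0 j :
  diff3 (fun z => fst3 z j - snd3 z j) z0 (fun h => fst3 h j - snd3 h j).
Proof.
apply: (@diff3_affine _ _ _ 2) => [|h|z]; first lra.
  have := Rabs_triang (fst3 h j) (- snd3 h j); rewrite Rabs_Ropp.
  have := coord_le (fst3 h) j; have := coord_le (snd3 h) j.
  have := norm3_proj1 h; have := norm3_proj2 h; rewrite -/(fst3 h) -/(snd3 h).
  rewrite -/(Rminus _ _); lra.
by rewrite sub3E /fst3 /snd3 /vsub /=; ring.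
Qed.

Lemma diff3_coord3 z0 i : diff3 (fun z => z.2 i) z0 (fun h => h.2 i).
Proof.
apply: (@diff3_affine _ _ _ 1) => [|h|z]; first lra.
  by have := coord_le h.2 i; have := norm3_proj3 h; lra.
by rewrite sub3E /vsub.
Qed.
End Diff3.

Section FrechetFbar.
Variables (n m : nat) (f P1 P2 : vec n -> R) (g : vec n -> vec m).
Variables (gradg : 'I_m -> vec n -> vec n) (hessg : 'I_m -> vec n -> 'I_n -> vec n).

Definition Gbar_dx (i : 'I_m) (x y : vec n) (w : vec m) : vec n :=
  vadd (gradg i y) (vscale (w i) (vsub x y)).
(** Partial gradient in y: the gradient of g_i(y) cancels against the derivative of -y in the linear
    term, leaving the transposed Hessian applied to x - y and the quadratic part. *)
Definition Gbar_dy (i : 'I_m) (x y : vec n) (w : vec m) : vec n :=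
  vsub (wsum_grad (vsub x y) (fun j z => hessg i z j) y) (vscale (w i) (vsub x y)).

Lemma Gbar_diff3 (x y : vec n) (w : vec m) i :
  has_grad (fun z => g z i) y (gradg i y) ->
  (forall j, has_grad (fun z => gradg i z j) y (hessg i y j)) ->
  diff3 (fun z : E3 n m => Gbar g gradg z.1.1 z.1.2 z.2 i) (x, y, w)
    (fun h => dot (Gbar_dx i x y w) h.1.1 + dot (Gbar_dy i x y w) h.1.2
              + vnorm (vsub x y) ^ 2 / 2 * h.2 i).
Proof.
move=> Hg Hh.
have D1 := @diff3_snd n m (fun z => g z i) (gradg i y) (x, y, w) Hg.
have D2 : diff3 (fun z : E3 n m => \big[Rplus/0]_(j < n) (gradg i (snd3 z) j * (fst3 z j - snd3 z j)))
   (x, y, w) (fun h => \big[Rplus/0]_(j < n) (gradg i y j * (fst3 h j - snd3 h j)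
      + (x j - y j) * dot (hessg i y j) (snd3 h))).
  apply: diff3_sum => j; apply: (diff3_mul (F := fun z => gradg i (snd3 z) j)); last exact: diff3_gap.
  exact: (@diff3_snd n m (fun z => gradg i z j) _ (x, y, w) (Hh j)).
have D3 : diff3 (fun z : E3 n m => \big[Rplus/0]_(j < n) ((fst3 z j - snd3 z j) * (fst3 z j - snd3 z j)))
   (x, y, w) (fun h => \big[Rplus/0]_(j < n) ((x j - y j) * (fst3 h j - snd3 h j)
      + (x j - y j) * (fst3 h j - snd3 h j))).
  by apply: diff3_sum => j; apply: diff3_mul; exact: diff3_gap.
have D4 := diff3_scale (1 / 2) (diff3_mul (@diff3_coord3 n m (x, y, w) i) D3).
have D := diff3_add (diff3_add D1 D2) D4.
apply: diff3_ext D => [z|h].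
  by rewrite /Gbar vnorm_sq /dot /vsub /fst3 /snd3; field.
rewrite /= -/(fst3 h) -/(snd3 h) !sumR_add vnorm_sq.
have -> : \big[Rplus/0]_(j < n) (gradg i y j * (fst3 h j - snd3 h j)) =
   dot (gradg i y) (fst3 h) - dot (gradg i y) (snd3 h).
  by rewrite -dotBr.
have -> : \big[Rplus/0]_(j < n) ((x j - y j) * dot (hessg i y j) (snd3 h)) =
   dot (wsum_grad (vsub x y) (fun j z => hessg i z j) y) (snd3 h).
  by rewrite dot_wsum_grad.
have -> : \big[Rplus/0]_(j < n) ((x j - y j) * (fst3 h j - snd3 h j)) =
   dot (vsub x y) (fst3 h) - dot (vsub x y) (snd3 h).
  by rewrite -dotBr.
have -> : \big[Rplus/0]_(j < n) ((x j - y j) * (x j - y j)) = dot (vsub x y) (vsub x y) by [].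
rewrite /Gbar_dx /Gbar_dy dotDl dotZl (dotBl (wsum_grad _ _ _)) dotZl.
field.
Qed.

(** On the domain of [Fbar] the sum of lam_i Gbar_i is nonpositive, and it vanishes at the base
    point. So [Fbar] dominates f + P1 - P2 plus this sum, with equality at the base point, and a
    Frechet subgradient of the minorant is one of [Fbar]. P2 enters with a minus sign, so its
    gradient is used: a subgradient would bound -P2 from the wrong side. *)
Lemma frechet_subdiff_Fbar (x y u gf p : vec n) (w lam : vec m) :
  vle0 (Gbar g gradg x y w) -> (forall i, 0 <= lam i) ->
  (forall i, lam i * Gbar g gradg x y w i = 0) ->
  csubgrad P1 x u -> has_grad f x gf -> has_grad P2 x p ->
  (forall i, has_grad (fun z => g z i) y (gradg i y)) ->
  (forall i j, has_grad (fun z => gradg i z j) y (hessg i y j)) ->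
  frechet_subdiff (@sub3 n m) (@ip3 n m) (Fbar f P1 P2 g gradg) (x, y, w)
    (vadd (vsub (vadd gf u) p) (wsum_grad lam (fun i _ => Gbar_dx i x y w) y),
     wsum_grad lam (fun i _ => Gbar_dy i x y w) y,
     fun i => lam i * (vnorm (vsub x y) ^ 2 / 2)).
Proof.
move=> Hfeas lam0 Hcompl Hu Hf HP2 Hg Hh.
exists (Fval f P1 P2 x); split.
  by rewrite /Fbar; case: excluded_middle_informative.
have DG := diff3_sum (fun i => diff3_scale (lam i) (Gbar_diff3 x w (Hg i) (Hh i))).
have Df := @diff3_fst n m f gf (x, y, w) Hf.
have DP := @diff3_fst n m P2 p (x, y, w) HP2.
have [_ D] := diff3_add (diff3_add Df (diff3_scale (-1) DP)) DG.
move=> eps He; have [d [Hd Hz]] := D eps He; exists d; split=> // z hz Hzd.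
have E0 : \big[Rplus/0]_(i < m) (lam i * Gbar g gradg x y w i) = 0.
  by apply: big1 => i _; exact: Hcompl.
have {Hz} := Hz z Hzd; rewrite /= E0 -[ex_norm _ _]/(norm3 (sub3 z (x, y, w))).
case: z Hzd => [[x' y'] w'] /= Hzd Hz; case: excluded_middle_informative => // Hfeas' [<-].
rewrite /fst3 /= in Hz.
have Hsum : \big[Rplus/0]_(i < m) (lam i * Gbar g gradg x' y' w' i) <= 0.
  apply: (Rle_trans _ (\big[Rplus/0]_(i < m) 0)); last by rewrite big1 //; lra.
  by apply: sumR_le => i _; have := lam0 i; have := Hfeas' i; nra.
have Hux := Hu x'.
have H2 := Rle_trans _ _ _ (Rle_abs _) (eq_ind_r (fun t => t <= _) Hz (Rabs_Ropp _)).
rewrite /Fval dotDl (dotBl (vadd gf u)) dotDl !dot_wsum_grad.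
have E3 : dot (fun i => lam i * (vnorm (vsub x y) ^ 2 / 2)) (vsub w' w) =
   \big[Rplus/0]_(i < m) (lam i * (vnorm (vsub x y) ^ 2 / 2 * vsub w' w i)).
  by apply: eq_bigr => i _; ring.
rewrite E3.
have E4 : \big[Rplus/0]_(i < m) (lam i * (dot (Gbar_dx i x y w) (vsub x' x)
      + dot (Gbar_dy i x y w) (vsub y' y) + vnorm (vsub x y) ^ 2 / 2 * vsub w' w i)) =
   \big[Rplus/0]_(i < m) (lam i * dot (Gbar_dx i x y w) (vsub x' x)) +
   \big[Rplus/0]_(i < m) (lam i * dot (Gbar_dy i x y w) (vsub y' y)) +
   \big[Rplus/0]_(i < m) (lam i * (vnorm (vsub x y) ^ 2 / 2 * vsub w' w i)).
  by rewrite -!sumR_add; apply: eq_bigr => i _; ring.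
rewrite E4 in H2; move: H2 Hux Hsum.
set S0 := \big[Rplus/0]_(i < m) (lam i * Gbar _ _ _ _ _ _).
set S1 := \big[Rplus/0]_(i < m) (lam i * dot (Gbar_dx _ _ _ _) _).
set S2 := \big[Rplus/0]_(i < m) (lam i * dot (Gbar_dy _ _ _ _) _).
set S3 := \big[Rplus/0]_(i < m) (lam i * (_ * vsub w' w _)).
move: S0 S1 S2 S3 => S0 S1 S2 S3; lra.
Qed.
End FrechetFbar.

Lemma frechet_limiting n m (h : E3 n m -> option R) (z v : E3 n m) :
  frechet_subdiff (@sub3 n m) (@ip3 n m) h z v -> limiting_subdiff (@sub3 n m) (@ip3 n m) h z v.
Proof.
move=> Hz; have [hz [E _]] := Hz; exists hz; split=> //; exists (fun _ => z), (fun _ => v).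
have N0 (a : E3 n m) : norm3 (sub3 a a) = 0.
  apply: Rle_antisym; last exact: norm3_ge0.
  case: a => [[a b] w] /=; apply: Rle_trans; first exact: norm3_le_sum.
  by rewrite !vsubxx; lra.
split; first by move=> eps He; exists 0%N => k _; rewrite -[ex_norm _ _]/(norm3 _) N0.
split; first by move=> eps He; exists 0%N => k _; rewrite -[ex_norm _ _]/(norm3 _) N0.
split=> // eps He; exists 0%N => k _; exists hz; split=> //.
by rewrite Rminus_diag Rabs_R0.
Qed.

(** * Desingularizing functions, finite length and rates *)

(** Here [psi] is the derivative of [phi]. Concavity enters as the tangent inequality and continuity
    as smallness near 0; both survive addition on the smaller interval, as uniformization
    requires. *)
Definition desingularizing (phi psi : R -> R) (a : R) : Prop :=
  [/\ 0 < a, phi 0 = 0,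
      forall s, 0 <= s < a -> 0 <= phi s,
      forall eps, 0 < eps -> exists d, 0 < d /\ forall s, 0 <= s < a -> s < d -> phi s < eps &
      forall s, 0 < s < a -> [/\ 0 < psi s, derivable_pt_lim phi s (psi s) &
        forall s', 0 <= s' < a -> phi s' <= phi s + psi s * (s' - s)]].

(** An excess over the tangent at s' would, by concavity, leave at least the fraction th of itself
    at s + th (s' - s), whereas differentiability at s makes it o(th). *)
Lemma concave_below_tangent (phi : R -> R) (a s s' l : R) :
  (forall s1 s2 th, 0 <= s1 < a -> 0 <= s2 < a -> 0 <= th <= 1 ->
      th * phi s1 + (1 - th) * phi s2 <= phi (th * s1 + (1 - th) * s2)) ->
  0 <= s < a -> 0 <= s' < a -> derivable_pt_lim phi s l -> phi s' <= phi s + l * (s' - s).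
Proof.
move=> conc Hs Hs' Hder; apply: Rnot_lt_le => Hlt.
case: (Req_dec s' s) => [E|ne]; first by rewrite E in Hlt; lra.
set D := s' - s in Hlt; have D0 : D <> 0 by rewrite /D; lra.
have aD : 0 < Rabs D by exact: Rabs_pos_lt.
set gap := phi s' - phi s - l * D; have gap0 : 0 < gap by rewrite /gap; lra.
have e0 : 0 < gap / (2 * Rabs D) by apply: Rdiv_lt_0_compat; lra.
have [[d d0] /= Hd] := Hder _ e0.
pose th := Rmin 1 (d / (2 * Rabs D)).
have th0 : 0 < th by apply: Rmin_glb_lt; [lra | apply: Rdiv_lt_0_compat; lra].
have th1 : th <= 1 := Rmin_l _ _.
have Ah : Rabs (th * D) = th * Rabs D by rewrite Rabs_mult (Rabs_pos_eq th) //; lra.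
have hd : Rabs (th * D) < d.
  rewrite Ah; have := Rmult_le_compat_r (Rabs D) _ _ (Rlt_le _ _ aD) (Rmin_r 1 (d / (2 * Rabs D))).
  have -> : d / (2 * Rabs D) * Rabs D = d / 2 by field; lra.
  rewrite -/th; lra.
have h0 : th * D <> 0 by apply: Rmult_integral_contrapositive; split; lra.
have := Hd _ h0 hd; set h := th * D in h0 hd Ah *.
set r := (phi (s + h) - phi s) / h - l => Hr.
have Er : phi (s + h) - phi s = l * h + r * h by rewrite /r; field.
have Hrh : Rabs (r * h) <= th * (gap / 2).
  rewrite Rabs_mult Ah; have := Rmult_le_compat_r (th * Rabs D) _ _ (ltac:(nra)) (Rlt_le _ _ Hr).
  by have -> : gap / (2 * Rabs D) * (th * Rabs D) = th * (gap / 2) by field; lra.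
have := conc s' s th Hs' Hs (conj (Rlt_le _ _ th0) th1).
have -> : th * s' + (1 - th) * s = s + h by rewrite /h /D; ring.
have := Rle_abs (r * h); have : th * gap = th * phi s' - th * phi s - l * h by rewrite /gap /h; ring.
have : 0 < th * gap by exact: Rmult_lt_0_compat.
lra.
Qed.

Lemma KL_with_desingularizing (E : Type) (sub : E -> E -> E) (ip : E -> E -> R)
    (h : E -> option R) (xh : E) (phi : R -> R) :
  KL_with sub ip h xh phi -> exists a r psi, [/\ 0 < r, desingularizing phi psi a &
    exists hxh, h xh = Some hxh /\
      forall x hx, ex_norm ip (sub x xh) < r -> h x = Some hx -> hxh < hx < hxh + a ->
        forall v, limiting_subdiff sub ip h x v -> 1 <= psi (hx - hxh) * ex_norm ip v].
Proof.
move=> [a [r [psi [a0 [r0 [phi0 [phi_ge0 [phic [conc [Hder HKL]]]]]]]]]].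
exists a, r, psi; split=> //; split=> //.
  move=> eps He; have [d [d0 Hd]] := phic 0 (ltac:(lra)) eps He; exists d; split=> // s Hs Hsd.
  have := Hd s Hs (ltac:(rewrite Rabs_pos_eq; lra)); rewrite phi0 Rabs_pos_eq; first lra.
  by have := phi_ge0 s Hs; lra.
move=> s Hs; have [D [_ psi0]] := Hder s Hs; split=> // s' Hs'.
by apply: (concave_below_tangent conc) => //; lra.
Qed.

Lemma desingularizing_add phi psi a phi' psi' a' :
  desingularizing phi psi a -> desingularizing phi' psi' a' ->
  desingularizing (fun s => phi s + phi' s) (fun s => psi s + psi' s) (Rmin a a').
Proof.
move=> [a0 z p c D] [a0' z' p' c' D'].
have L s : 0 <= s < Rmin a a' -> 0 <= s < a /\ 0 <= s < a'.
  by have := Rmin_l a a'; have := Rmin_r a a'; lra.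
split.
- exact: Rmin_glb_lt.
- by rewrite z z' Rplus_0_r.
- by move=> s /L [/p H /p' H']; lra.
- move=> eps He; have [d [d0 Hd]] := c (eps / 2) (ltac:(lra)).
  have [d' [d0' Hd']] := c' (eps / 2) (ltac:(lra)).
  exists (Rmin d d'); split; first exact: Rmin_glb_lt.
  move=> s /L [Hs Hs'] Hlt; have := Hd s Hs (Rlt_le_trans _ _ _ Hlt (Rmin_l _ _)).
  by have := Hd' s Hs' (Rlt_le_trans _ _ _ Hlt (Rmin_r _ _)); lra.
- move=> s Hs; have [Ha Ha'] := L s (ltac:(lra)).
  have [q0 dq t] := D s (ltac:(lra)); have [q0' dq' t'] := D' s (ltac:(lra)).
  split; first lra.
    exact: derivable_pt_lim_plus.
  by move=> s' /L [/t H /t' H']; lra.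
Qed.

(** * Finite length from the KL inequality *)

Section KLLength.
Variables (c C a : R) (phi psi : R -> R) (s del : nat -> R) (N : nat).
Hypotheses (c0 : 0 < c) (C0 : 0 < C) (Hphi : desingularizing phi psi a).
Hypothesis del0 : forall t, 0 <= del t.
Hypothesis s0 : forall t, 0 <= s t.
Hypothesis sa : forall t, (N <= t)%nat -> s t < a.
Hypothesis dec : forall t, s t.+1 + c / 2 * del t ^ 2 <= s t.
Hypothesis kl : forall t, (N <= t)%nat -> 0 < s t.+1 -> 1 <= psi (s t.+1) * (C * del t).

(** The tangent inequality turns the decrease s_{t+1} - s_{t+2} >= c / 2 d_{t+1}^2 into a drop of
    phi of at least psi(s_{t+1}) times as much; multiplied by 1 <= psi(s_{t+1}) C d_t, this bounds
    d_{t+1}^2 by 2 (C / c) d_t times the drop. If s_{t+1} = 0 the KL inequality is silent, but the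
    decrease forces d_{t+1} = 0. *)
Lemma kl_step t : (N <= t)%nat ->
  del t.+1 <= del t / 2 + C / c * (phi (s t.+1) - phi (s t.+2)).
Proof.
move=> Nt; have [_ phi0 phi_ge0 _ D] := Hphi.
have Hc : 0 < C / c by exact: Rdiv_lt_0_compat.
have S1 := conj (s0 t.+1) (@sa t.+1 (leqW Nt)); have S2 := conj (s0 t.+2) (@sa t.+2 (leqW (leqW Nt))).
have dt := dec t.+1; have d1 := del0 t.+1; have d0 := del0 t.
case: (Req_dec (s t.+1) 0) => [E|ne].
  have sq : c / 2 * del t.+1 ^ 2 <= 0 by lra.
  have E2 : s t.+2 = 0.
    by have : 0 <= c / 2 * del t.+1 ^ 2 by [have := pow2_ge_0 (del t.+1); nra]; lra.
  have : del t.+1 = 0.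
    apply: Rle_antisym => //; apply: Rnot_lt_le => Hlt.
    have : 0 < del t.+1 ^ 2 by exact: pow_lt.
    nra.
  by rewrite E E2; lra.
have sp : 0 < s t.+1 by lra.
have [psi0 _ tang] := D _ (conj sp (proj2 S1)).
have T := tang _ S2; have K := kl Nt sp.
set Dphi := phi (s t.+1) - phi (s t.+2); set p := psi (s t.+1) in psi0 T K.
have H1 : p * (c / 2 * del t.+1 ^ 2) <= Dphi.
  have : p * (c / 2 * del t.+1 ^ 2) <= p * (s t.+1 - s t.+2) by apply: Rmult_le_compat_l; lra.
  rewrite /Dphi; lra.
have sq0 := pow2_ge_0 (del t.+1).
have H2 : del t.+1 ^ 2 <= 2 * (C / c) * Dphi * del t.
  have : del t.+1 ^ 2 * 1 <= del t.+1 ^ 2 * (p * (C * del t)) by apply: Rmult_le_compat_l.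
  have : p * (c / 2 * del t.+1 ^ 2) * (2 * (C / c) * del t) <= Dphi * (2 * (C / c) * del t).
    by apply: Rmult_le_compat_r => //; apply: Rmult_le_pos => //; lra.
  have -> : p * (c / 2 * del t.+1 ^ 2) * (2 * (C / c) * del t) = del t.+1 ^ 2 * (p * (C * del t)) by field; lra.
  lra.
have Dphi0 : 0 <= Dphi.
  apply: Rle_trans H1; apply: Rmult_le_pos; first lra.
  by apply: Rmult_le_pos; lra.
(* AM-GM: sqrt (d * X) <= (d + X) / 2 with X = 2 (C / c) Dphi *)
apply: Rsqr_incr_0_var; last by apply: Rplus_le_le_0_compat; [lra | apply: Rmult_le_pos; lra].
rewrite !Rsqr_pow2; set X := C / c * Dphi in H2 *.
have -> : (del t / 2 + X) ^ 2 = (del t / 2 - X) ^ 2 + 2 * X * del t by field.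
have := pow2_ge_0 (del t / 2 - X).
have : 2 * (C / c) * Dphi * del t = 2 * X * del t by rewrite /X; ring.
lra.
Qed.

Lemma kl_length t p : (N <= t)%nat ->
  \big[Rplus/0]_(k < p) del (t.+1 + k)%nat <= del t + 2 * C / c * phi (s t.+1).
Proof.
move=> Nt; have [_ phi0 phi_ge0 _ D] := Hphi.
have Hc : 0 < C / c by exact: Rdiv_lt_0_compat.
(* Twice [kl_step] says that d_t + 2 (C / c) phi(s_{t+1}) is a potential which loses at least
   d_{t+1} at each step; the induction telescopes it. *)
suff H : \big[Rplus/0]_(k < p) del (t.+1 + k)%nat + del (t + p)%nat
     + 2 * (C / c) * phi (s (t + p).+1) <= del t + 2 * (C / c) * phi (s t.+1).
  have := del0 (t + p)%nat.
  have : 0 <= C / c * phi (s (t + p).+1).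
    by apply: Rmult_le_pos; [lra|apply: phi_ge0; split => //; apply: sa; lia].
  have -> : 2 * C / c = 2 * (C / c) by field; lra.
  lra.
elim: p => [|p IH]; first by rewrite big_ord0 addn0; lra.
rewrite big_ord_recr /=.
have H := @kl_step (t + p)%nat (leq_trans Nt (leq_addr _ _)).
rewrite addSn addnS; move: IH; set S := \big[Rplus/0]_(k < p) _; move: S => S IH; lra.
Qed.
End KLLength.

Lemma vcv_le_bound n (x : nat -> vec n) (l y : vec n) (B : R) (N : nat) :
  vcv x l -> (forall t, (N <= t)%nat -> vnorm (vsub y (x t)) <= B) -> vnorm (vsub y l) <= B.
Proof.
move=> /vcv_norm H HB; apply: Rnot_lt_le => Hlt.
have [N' HN] := H (vnorm (vsub y l) - B) (ltac:(lra)).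
have := HN (maxn N N') (leq_maxr _ _); have := HB (maxn N N') (leq_maxl _ _).
by have := vnorm_sub_tri y (x (maxn N N')) l; lra.
Qed.

(** One bound on tail lengths gives both the Cauchy property and, for p tending to infinity, the
    distance to the limit. *)
Lemma finite_length_cv n (x : nat -> vec n) (B : nat -> R) (N : nat) :
  Un_cv B 0 ->
  (forall t p, (N <= t)%nat ->
     \big[Rplus/0]_(k < p) vnorm (vsub (x (t.+1 + k).+1) (x (t.+1 + k)%nat)) <= B t) ->
  exists l, vcv x l /\ forall t, (N <= t)%nat -> vnorm (vsub (x t.+1) l) <= B t.
Proof.
move=> /Un_cv_ssr HB Hlen.
have tele t p : (N <= t)%nat -> vnorm (vsub (x t.+1) (x (t.+1 + p)%nat)) <= B t.
  move=> Nt; apply: Rle_trans (Hlen t p Nt); elim: p => [|p IH].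
    by rewrite addn0 vsubxx big_ord0; lra.
  rewrite big_ord_recr /= addnS.
  have := vnorm_sub_tri (x t.+1) (x (t.+1 + p)%nat) (x (t.+1 + p).+1).
  rewrite (vnorm_sub_sym (x (t.+1 + p)%nat)) => H; apply: Rle_trans H _.
  exact: Rplus_le_compat_r.
have Hcauchy i : Cauchy_crit (fun t => x t i).
  move=> eps He; have [N' HN] := HB (eps / 2) (ltac:(lra)).
  exists (maxn N N').+1 => p q Hp Hq.
  have Hb := HN (maxn N N') (leq_maxr _ _).
  have near r : (r >= (maxn N N').+1)%coq_nat -> Rabs (x (maxn N N').+1 i - x r i) < eps / 2.
    move=> Hr; apply: Rle_lt_trans (coord_le (vsub (x (maxn N N').+1) (x r)) i) _.
    have -> : r = ((maxn N N').+1 + (r - (maxn N N').+1))%nat by lia.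
    apply: Rle_lt_trans (tele _ _ (leq_maxl _ _)) _.
    by have := Rle_abs (B (maxn N N') - 0); lra.
  rewrite /Rdist; have := near p Hp; have := near q Hq; move: (x (maxn N N').+1 i) => m Hm Hm'.
  have := Rabs_triang (m - x q i) (- (m - x p i)); rewrite Rabs_Ropp.
  by have -> : m - x q i + - (m - x p i) = x p i - x q i by [ring]; lra.
pose l i := proj1_sig (R_complete _ (Hcauchy i)).
have Hl : vcv x l by move=> i; rewrite /l; case: R_complete.
exists l; split=> // t Nt; apply: (@vcv_le_bound _ x l _ _ t.+1) => // r Hr.
by rewrite (_ : r = (t.+1 + (r - t.+1))%nat); [exact: tele | lia].
Qed.

(** * Rates for scalar recursions *)

Lemma linear_rate (s : nat -> R) (q : R) (N : nat) :
  0 < q -> (forall t, 0 <= s t) -> (forall t, (N <= t)%nat -> s t.+1 <= q * s t) ->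
  exists K, 0 < K /\ forall t, (N <= t)%nat -> s t <= K * q ^ t.
Proof.
move=> q0 s0 H; have qN := pow_lt q N q0.
exists ((s N + 1) / q ^ N); split.
  by apply: Rdiv_lt_0_compat => //; have := s0 N; lra.
move=> t; elim: t => [|t IH].
  by rewrite leqn0 => /eqP E; rewrite E in qN *; rewrite pow_O Rdiv_1_r; lra.
rewrite leq_eqVlt => /orP [/eqP E|].
  rewrite -E (_ : (s N + 1) / q ^ N * q ^ N = s N + 1); [lra | field; lra].
rewrite ltnS => Nt; apply: Rle_trans (H t Nt) _.
have := Rmult_le_compat_l _ _ _ (Rlt_le _ _ q0) (IH Nt).
have -> : q ^ t.+1 = q * q ^ t by [].
lra.
Qed.

Lemma Rpower_gt0 (x y : R) : 0 < Rpower x y.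
Proof. exact: exp_pos. Qed.

Lemma ln_le_sub1 (y : R) : 0 <= y -> ln (1 + y) <= y.
Proof.
move=> y0; apply: Rnot_lt_le => /exp_increasing; rewrite exp_ln; last lra.
by have := exp_ineq1_le y; lra.
Qed.

(** Convexity of T^(-q), obtained as (1 + 1/T)^(-q) >= 1 - q / T from exp y >= 1 + y and ln (1 + y)
    <= y. *)
Lemma Rpower_neg_decrement (T q : R) : 0 < T -> 0 < q ->
  Rpower T (- q) - Rpower (T + 1) (- q) <= q * Rpower T (- (q + 1)).
Proof.
move=> T0 q0; have iT : 0 < / T by exact: Rinv_0_lt_compat.
have E1 : Rpower (T + 1) (- q) = Rpower T (- q) * exp (- q * ln (1 + / T)).
  rewrite /Rpower -exp_plus (_ : T + 1 = T * (1 + / T)); last by field; lra.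
  by rewrite ln_mult; [congr exp; ring | lra | lra].
have E2 : Rpower T (- (q + 1)) = Rpower T (- q) * / T.
  by rewrite Ropp_plus_distr Rpower_plus (Rpower_Ropp T 1) Rpower_1.
rewrite E1 E2; have P := Rpower_gt0 T (- q).
have := exp_ineq1_le (- q * ln (1 + / T)); have := ln_le_sub1 (Rlt_le _ _ iT).
move=> H1 H2; have H3 : 1 - q * / T <= exp (- q * ln (1 + / T)) by nra.
have := Rmult_le_compat_l _ _ _ (Rlt_le _ _ P) H3; lra.
Qed.

Lemma Rpower_neg_shift (T r : R) : 1 <= T -> 0 <= r ->
  Rpower T (- r) <= Rpower 2 r * Rpower (T + 1) (- r).
Proof.
move=> T1 r0; have Hle := @Rle_Rpower_l (T + 1) (2 * T) r r0 (ltac:(lra)).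
rewrite -Rpower_mult_distr in Hle; try lra.
rewrite !Rpower_Ropp; have P1 := Rpower_gt0 T r; have P2 := Rpower_gt0 (T + 1) r.
apply: (Rmult_le_reg_r (Rpower T r * Rpower (T + 1) r)); first exact: Rmult_lt_0_compat.
have -> : / Rpower T r * (Rpower T r * Rpower (T + 1) r) = Rpower (T + 1) r by field; lra.
have -> : Rpower 2 r * / Rpower (T + 1) r * (Rpower T r * Rpower (T + 1) r) =
  Rpower 2 r * Rpower T r by field; lra.
exact: Hle.
Qed.

Lemma Rpower_lt_l (a b p : R) : 0 < p -> 0 < a < b -> Rpower a p < Rpower b p.
Proof.
by move=> p0 Hab; apply: exp_increasing; apply: Rmult_lt_compat_l => //; apply: ln_increasing; lra.
Qed.

(* The sequence a t^(-q) with q = 1 / (p - 1) is a supersolution of the recursion for large a. *)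
Lemma sublinear_rate (s : nat -> R) (K p : R) (N : nat) :
  0 < K -> 1 < p -> (1 <= N)%nat -> (forall t, 0 <= s t) ->
  (forall t, (N <= t)%nat -> 0 < s t.+1 -> Rpower (s t.+1) p <= K * (s t - s t.+1)) ->
  exists a, 0 < a /\ forall t, (N <= t)%nat -> s t <= a * Rpower (INR t) (- (1 / (p - 1))).
Proof.
move=> K0 p1 N1 s0 H; set q := 1 / (p - 1).
have q0 : 0 < q by apply: Rdiv_lt_0_compat; lra.
have qp : q * p = q + 1 by rewrite /q; field; lra.
have INR1 t : (N <= t)%nat -> 1 <= INR t.
  by move=> Nt; have := le_INR 1 t (ltac:(lia)); rewrite INR_1.
pose D := K * q * Rpower 2 (q + 1).
have D0 : 0 < D by apply: Rmult_lt_0_compat; [exact: Rmult_lt_0_compat | exact: Rpower_gt0].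
(* The first summand makes a^(p-1) >= D, the supersolution condition, because q (p - 1) = 1; the
   second covers the initial value at N. *)
have [a Ea] : exists a, a = Rpower D q + s N * Rpower (INR N) q by eexists.
have aN : 0 <= s N * Rpower (INR N) q by apply: Rmult_le_pos => //; apply: Rlt_le; exact: Rpower_gt0.
have a0 : 0 < a by have := Rpower_gt0 D q; rewrite Ea; lra.
have aD : D <= Rpower a (p - 1).
  have -> : D = Rpower (Rpower D q) (p - 1).
    by rewrite Rpower_mult /q (_ : 1 / (p - 1) * (p - 1) = 1) ?Rpower_1 //; field; lra.
  by apply: Rle_Rpower_l; [lra | split; [exact: Rpower_gt0 | rewrite Ea; lra]].
exists a; split=> // t; elim: t => [|t IH].
  by rewrite leqn0 => /eqP E; move: N1; rewrite E.
rewrite leq_eqVlt => /orP [/eqP E|].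
  rewrite -E Rpower_Ropp; apply: (Rmult_le_reg_r (Rpower (INR N) q)); first exact: Rpower_gt0.
  rewrite Rmult_assoc Rinv_l; last by have := Rpower_gt0 (INR N) q; lra.
  by have := Rpower_gt0 D q; rewrite Ea; lra.
rewrite ltnS => Nt; have {}IH := IH Nt; have T1 := INR1 t Nt.
(* Suppose s_{t+1} > b = a (T + 1)^(-q). Then b^p < K (s_t - s_{t+1}) <= a D (T + 1)^(-(q+1)) <= a^p
   (T + 1)^(-(q+1)) = b^p, a contradiction. *)
apply: Rnot_lt_le => Hlt; rewrite S_INR in Hlt; set T := INR t in IH T1 Hlt.
have b0 : 0 < a * Rpower (T + 1) (- q) by apply: Rmult_lt_0_compat => //; exact: Rpower_gt0.
have Hrec := H t Nt (ltac:(lra)).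
have Hb : Rpower (a * Rpower (T + 1) (- q)) p < Rpower (s t.+1) p by apply: Rpower_lt_l; lra.
rewrite -Rpower_mult_distr // in Hb; last exact: Rpower_gt0.
rewrite Rpower_mult (_ : - q * p = - (q + 1)) in Hb; last by rewrite -qp; ring.
set W := Rpower (T + 1) (- (q + 1)) in Hb; have W0 : 0 < W := Rpower_gt0 _ _.
have G1 := @Rpower_neg_decrement T q (ltac:(lra)) q0.
have G2 := @Rpower_neg_shift T (q + 1) T1 (ltac:(lra)); rewrite -/W in G2.
have G3 : s t - s t.+1 <= a * (q * (Rpower 2 (q + 1) * W)).
  have : s t - s t.+1 <= a * (Rpower T (- q) - Rpower (T + 1) (- q)) by lra.
  move=> G; apply: Rle_trans G _; apply: Rmult_le_compat_l; first lra.
  apply: Rle_trans G1 _; apply: Rmult_le_compat_l => //; lra.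
have G4 := Rmult_le_compat_l _ _ _ (Rlt_le _ _ K0) G3.
have G5 : Rpower a p = a * Rpower a (p - 1).
  by have := Rpower_plus 1 (p - 1) a; rewrite Rpower_1 // (_ : 1 + (p - 1) = p) //; ring.
have G6 : a * D * W <= a * Rpower a (p - 1) * W.
  by apply: Rmult_le_compat_r; [lra | apply: Rmult_le_compat_l; lra].
rewrite /D in G6; rewrite G5 in Hb; lra.
Qed.

Lemma phi_pow_deriv (A alpha s : R) : 0 < s ->
  derivable_pt_lim (phi_pow A alpha) s (A * ((1 - alpha) * Rpower s (- alpha))).
Proof.
move=> s0.
apply: (@derivable_pt_lim_locally_ext (fun u => A * Rpower u (1 - alpha)) _ s (s / 2) (2 * s)); first lra.
  by move=> u Hu; rewrite /phi_pow; case: Rle_dec => // ?; lra.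
apply: (derivable_pt_lim_scal (fun u => Rpower u (1 - alpha))).
have := @derivable_pt_lim_power s (1 - alpha) s0.
by rewrite (_ : 1 - alpha - 1 = - alpha); last ring.
Qed.

Lemma phi_pow_add (A B alpha : R) :
  phi_pow (A + B) alpha = fun s => phi_pow A alpha s + phi_pow B alpha s.
Proof.
apply: functional_extensionality => s; rewrite /phi_pow; case: (Rle_dec s 0) => ? /=; ring.
Qed.

Lemma Rpower_le_small (s y y' : R) : 0 < s <= 1 -> y <= y' -> Rpower s y' <= Rpower s y.
Proof.
move=> Hs [Hy|->]; last by lra.
case: (Req_dec s 1) => [->|ne]; first by rewrite /Rpower ln_1 !Rmult_0_r; lra.
have l0 : ln s < 0 by rewrite -ln_1; apply: ln_increasing; lra.
by apply: Rlt_le; apply: exp_increasing; nra.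
Qed.

Lemma phi_pow_mono (alpha s s' : R) : alpha <= 1 -> 0 <= s' <= s ->
  phi_pow 1 alpha s' <= phi_pow 1 alpha s.
Proof.
move=> a1 Hs; rewrite /phi_pow; case: (Rle_dec s' 0) => h' /=; case: (Rle_dec s 0) => h /=; try lra.
  by have := Rpower_gt0 s (1 - alpha); lra.
by rewrite !Rmult_1_l; apply: Rle_Rpower_l; lra.
Qed.

Lemma sqrt_pow (q : R) (t : nat) : 0 <= q -> sqrt (q ^ t) = sqrt q ^ t.
Proof.
move=> q0; elim: t => [|t IH]; first by rewrite !pow_O sqrt_1.
have E (a : R) : a ^ t.+1 = a * a ^ t by [].
by rewrite !E sqrt_mult ?IH //; exact: pow_le.
Qed.

Section Rates.
Variables (s del r : nat -> R) (alpha c K K2 : R) (N : nat).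
Hypotheses (c0 : 0 < c) (K0 : 0 < K) (K20 : 0 <= K2) (alpha1 : alpha < 1).
Hypotheses (s0 : forall t, 0 <= s t) (del0 : forall t, 0 <= del t).
Hypothesis dec : forall t, s t.+1 + c / 2 * del t ^ 2 <= s t.
Hypothesis scv : Un_cv s 0.
Hypothesis kl2 : forall t, (N <= t)%nat -> 0 < s t.+1 ->
  Rpower (s t.+1) (2 * alpha) <= K * (s t - s t.+1).
Hypothesis rbound : forall t, (N <= t)%nat -> r t.+1 <= del t + K2 * phi_pow 1 alpha (s t.+1).

Lemma rates_decr t : s t.+1 <= s t.
Proof. by have := dec t; have := pow2_ge_0 (del t); nra. Qed.

Lemma step_le_sqrt t : del t <= sqrt (2 / c) * sqrt (s t).
Proof.
have q0 : 0 <= 2 / c by apply: Rlt_le; apply: Rdiv_lt_0_compat; lra.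
rewrite -sqrt_mult //; apply: Rsqr_incr_0_var; last exact: sqrt_pos.
rewrite Rsqr_sqrt ?Rsqr_pow2; last exact: Rmult_le_pos.
have := dec t; have := s0 t.+1 => h1 h2.
have : 2 / c * (c / 2 * del t ^ 2) <= 2 / c * s t by apply: Rmult_le_compat_l => //; lra.
by have -> : 2 / c * (c / 2 * del t ^ 2) = del t ^ 2 by field; lra.
Qed.

Lemma eventually_small eps : 0 < eps ->
  exists N1 : nat, [/\ (N <= N1)%nat, (1 <= N1)%nat & forall t, (N1 <= t)%nat -> s t < eps].
Proof.
move=> He; have [N2 HN2] := (proj1 (Un_cv_ssr _ _) scv) eps He.
exists (maxn N (maxn 1 N2)); split; [lia | lia |] => t Nt.
by have := HN2 t (ltac:(lia)) => /Rabs_def2; lra.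
Qed.

(** For alpha = 0 the recursion reads 1 <= K (s_t - s_{t+1}) while s_{t+1} > 0, which is impossible
    once s_t < 1 / K. *)
Lemma finite_termination : alpha = 0 ->
  exists N1 : nat, (1 <= N1)%nat /\ forall t, (N1 < t)%nat -> r t <= 0.
Proof.
move=> a0; have [N1 [NN1 N11 Hs]] := eventually_small (Rinv_0_lt_compat _ K0).
have z t : (N1 <= t)%nat -> s t.+1 = 0.
  move=> Nt; apply: NNPP => ne; have sp : 0 < s t.+1 by have := s0 t.+1; lra.
  have := kl2 (leq_trans NN1 Nt) sp; rewrite a0 Rmult_0_r Rpower_O // => H.
  have := Rmult_lt_compat_l K _ _ K0 (Hs t Nt); rewrite Rinv_r; last lra.
  by nra.
(* The extra shift is needed because s_{t+1} = 0 stops the step d_{t+1}, and the tail bound with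
   that step concerns r_{t+2}. *)
exists N1.+1; split=> // -[|[|t]] // Nt.
have Ht : (N1 <= t)%nat by lia.
have := @rbound t.+1 (ltac:(lia)); rewrite (z t.+1) ?(leqW Ht) //.
rewrite /phi_pow; case: (Rle_dec 0 0) => /= h; last lra.
have := step_le_sqrt t.+1; rewrite (z t Ht) sqrt_0; lra.
Qed.

(** When s <= 1 and 2 alpha <= 1, s is at most s^(2 alpha), so s_{t+1} <= K / (1 + K) s_t. Both the
    step and s^(1 - alpha) are of order sqrt s, hence the ratio sqrt q for the iterates. *)
Lemma kl_linear_rate : 0 < alpha <= 1 / 2 ->
  exists (N1 : nat) a0 a1, [/\ (1 <= N1)%nat, 0 < a0 < 1, 0 < a1 &
    forall t, (N1 < t)%nat -> r t <= a1 * a0 ^ t].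
Proof.
move=> Ha; have [N1 [NN1 N11 Hs]] := eventually_small Rlt_0_1.
pose q := K / (1 + K); have q0 : 0 < q by apply: Rdiv_lt_0_compat; lra.
have q1 : q < 1.
  by apply: (Rmult_lt_reg_r (1 + K)); [lra | rewrite /q; field_simplify; lra].
have step t : (N1 <= t)%nat -> s t.+1 <= q * s t.
  move=> Nt; case: (Req_dec (s t.+1) 0) => [->|ne]; first by apply: Rmult_le_pos; [lra | exact: s0].
  have sp : 0 < s t.+1 by have := s0 t.+1; lra.
  have := kl2 (leq_trans NN1 Nt) sp; have := Hs t.+1 (leqW Nt) => s1.
  have := @Rpower_le_small (s t.+1) (2 * alpha) 1 (ltac:(lra)) (ltac:(lra)); rewrite Rpower_1 // => h1 h2.
  apply: (Rmult_le_reg_r (1 + K)); first lra.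
  have -> : q * s t * (1 + K) = K * s t by rewrite /q; field; lra.
  lra.
have [B [B0 HB]] := linear_rate q0 s0 step.
have sq0 : 0 < sqrt q by exact: sqrt_lt_R0.
have sq1 : sqrt q < 1 by rewrite -sqrt_1; apply: sqrt_lt_1; lra.
have c1 := sqrt_pos (2 / c); have sB := sqrt_lt_R0 _ B0.
pose a1 := (sqrt (2 / c) + K2 + 1) * sqrt B.
have a10 : 0 < a1 by apply: Rmult_lt_0_compat; lra.
(* The division by sqrt q pays for bounding r_{t+1} through s_t. *)
exists N1, (sqrt q), (a1 / sqrt q); split=> //; first exact: Rdiv_lt_0_compat.
move=> [|t] // Nt; have {}Nt : (N1 <= t)%nat by lia.
have -> : a1 / sqrt q * sqrt q ^ t.+1 = a1 * sqrt q ^ t.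
  by rewrite (_ : sqrt q ^ t.+1 = sqrt q * sqrt q ^ t) //; field; lra.
have s1 := Hs t.+1 (leqW Nt).
have Hphi : phi_pow 1 alpha (s t.+1) <= sqrt (s t).
  rewrite /phi_pow; case: (Rle_dec (s t.+1) 0) => h /=; first exact: sqrt_pos.
  rewrite Rmult_1_l; apply: (Rle_trans _ (Rpower (s t.+1) (/ 2))).
    by apply: Rpower_le_small; lra.
  by rewrite Rpower_sqrt; [apply: sqrt_le_1 => //; exact: rates_decr | lra].
have Hsq : sqrt (s t) <= sqrt B * sqrt q ^ t.
  rewrite -sqrt_pow; last lra.
  rewrite -sqrt_mult; [|lra|by apply: pow_le; lra].
  apply: sqrt_le_1 => //; last exact: HB.
  by apply: Rmult_le_pos; [lra | apply: pow_le; lra].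
have := rbound (leq_trans NN1 Nt); have := step_le_sqrt t => h1 h2.
have := Rmult_le_compat_l _ _ _ K20 Hphi.
have := Rmult_le_compat_l _ _ _ (ltac:(lra) : 0 <= sqrt (2 / c) + K2) Hsq.
have : 0 <= sqrt B * sqrt q ^ t by apply: Rle_trans Hsq; exact: sqrt_pos.
rewrite /a1; lra.
Qed.

(** For alpha > 1/2 and s <= 1 the step term sqrt s is dominated by s^(1 - alpha); raising s_t <= a
    t^(-1 / (2 alpha - 1)) to the power 1 - alpha gives the exponent. *)
Lemma kl_sublinear_rate : 1 / 2 < alpha ->
  exists (N1 : nat) a2, [/\ (1 <= N1)%nat, 0 < a2 &
    forall t, (N1 < t)%nat -> r t <= a2 * Rpower (INR t) (- ((1 - alpha) / (2 * alpha - 1)))].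
Proof.
move=> Ha; have [N1 [NN1 N11 Hs]] := eventually_small Rlt_0_1.
have kl2' t : (N1 <= t)%nat -> 0 < s t.+1 -> Rpower (s t.+1) (2 * alpha) <= K * (s t - s t.+1).
  by move=> Nt; apply: kl2; lia.
have [a [a0 Has]] := @sublinear_rate s K (2 * alpha) N1 K0 (ltac:(lra)) N11 s0 kl2'.
set rho := (1 - alpha) / (2 * alpha - 1).
have rho0 : 0 <= rho by apply: Rlt_le; apply: Rdiv_lt_0_compat; lra.
have c1 := sqrt_pos (2 / c).
pose b := (sqrt (2 / c) + K2 + 1) * Rpower a (1 - alpha).
have b0 : 0 < b by apply: Rmult_lt_0_compat; [lra | exact: Rpower_gt0].
(* The factor 2^rho compensates the passage from t^(-rho) to (t + 1)^(-rho). *)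
exists N1, (b * Rpower 2 rho); split=> //; first by apply: Rmult_lt_0_compat => //; exact: Rpower_gt0.
move=> [|t] // Nt; have {}Nt : (N1 <= t)%nat by lia.
have T1 : 1 <= INR t by have := @le_INR 1 t (ltac:(lia)); rewrite INR_1.
have Tp := Rpower_gt0 (INR t) (- rho).
have Hphi : phi_pow 1 alpha (s t) <= Rpower a (1 - alpha) * Rpower (INR t) (- rho).
  rewrite /phi_pow; case: (Rle_dec (s t) 0) => h /=.
    by apply: Rmult_le_pos; [apply: Rlt_le; exact: Rpower_gt0 | lra].
  rewrite Rmult_1_l.
  apply: (Rle_trans _ (Rpower (a * Rpower (INR t) (- (1 / (2 * alpha - 1)))) (1 - alpha))).
    by apply: Rle_Rpower_l; [lra | split; [lra | exact: Has]].
  rewrite -Rpower_mult_distr //; last exact: Rpower_gt0.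
  rewrite Rpower_mult (_ : - (1 / (2 * alpha - 1)) * (1 - alpha) = - rho); first lra.
  by rewrite /rho; field; lra.
have Hsq : sqrt (s t) <= phi_pow 1 alpha (s t).
  have st1 := Hs t Nt; rewrite /phi_pow; case: (Rle_dec (s t) 0) => h /=.
    by rewrite (_ : s t = 0) ?sqrt_0; [lra | have := s0 t; lra].
  rewrite Rmult_1_l -Rpower_sqrt; last lra.
  by apply: Rpower_le_small; lra.
have Hmon := @phi_pow_mono alpha (s t) (s t.+1) (ltac:(lra)) (conj (s0 _) (rates_decr t)).
have H1 : r t.+1 <= b * Rpower (INR t) (- rho).
  have := rbound (leq_trans NN1 Nt); have := step_le_sqrt t => h1 h2.
  have := Rmult_le_compat_l _ _ _ K20 (Rle_trans _ _ _ Hmon Hphi).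
  have := Rmult_le_compat_l _ _ _ c1 (Rle_trans _ _ _ Hsq Hphi).
  have := Rmult_lt_0_compat _ _ (Rpower_gt0 a (1 - alpha)) Tp.
  rewrite /b; lra.
apply: Rle_trans H1 _; rewrite S_INR Rmult_assoc; apply: Rmult_le_compat_l; first lra.
exact: Rpower_neg_shift.
Qed.
End Rates.

(** * The sequential convex programming iteration *)

(** Both expansions are compared along u - v. This identifies the chosen xi_t with the gradient of
    P2 once x_t lies in the smooth region. *)
Lemma csubgrad_grad n (P : vec n -> R) (x u v : vec n) :
  csubgrad P x u -> has_grad P x v -> u = v.
Proof.
move=> Hu Hv; apply: vnorm0_eq; apply: Rnot_lt_le => N0.
set w := vsub u v in N0; have [d [d0 Hd]] := Hv (vnorm w / 2) (ltac:(lra)).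
pose s := d / (2 * vnorm w); have s0 : 0 < s by apply: Rdiv_lt_0_compat; lra.
set y := vadd x (vscale s w).
have Ey : vsub y x = vscale s w by apply: vec_ext => i; rewrite /y /vsub /vadd /vscale; ring.
have Ny : vnorm (vsub y x) = s * vnorm w by rewrite Ey vnormZ_pos //; lra.
have := Hu y; have := Hd y; rewrite Ny Ey !dotZr => H1 H2.
have {}H1 : Rabs (P y - P x - s * dot v w) <= vnorm w / 2 * (s * vnorm w).
  apply: H1; have -> : s * vnorm w = d / 2 by rewrite /s; field; lra.
  lra.
have H3 := Rle_trans _ _ _ (Rle_abs _) H1.
have E : dot u w - dot v w = vnorm w ^ 2 by rewrite vnorm_sq -dotBl.
have : s * (dot u w - dot v w) <= vnorm w / 2 * (s * vnorm w) by lra.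
rewrite E; have -> : vnorm w / 2 * (s * vnorm w) = s * vnorm w ^ 2 / 2 by field.
have : 0 < s * vnorm w ^ 2 by apply: Rmult_lt_0_compat => //; exact: pow_lt.
lra.
Qed.

Lemma vnorm_wsum_grad n m (lam : vec m) (G : 'I_m -> vec n -> vec n) y :
  vnorm (wsum_grad lam G y) <= \big[Rplus/0]_(i < m) (Rabs (lam i) * vnorm (G i y)).
Proof.
rewrite /wsum_grad; elim: (index_enum 'I_m) => [|i r IH].
  rewrite big_nil (_ : (fun j => _) = (fun _ => 0)) ?vnorm0; first lra.
  by apply: vec_ext => j; rewrite big_nil.
rewrite big_cons.
have -> : (fun j => \big[Rplus/0]_(i0 <- i :: r) (lam i0 * G i0 y j)) =
   vadd (vscale (lam i) (G i y)) (fun j => \big[Rplus/0]_(i0 <- r) (lam i0 * G i0 y j)).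
  by apply: vec_ext => j; rewrite big_cons.
apply: (Rle_trans _ _ _ (vnormD _ _)).
by rewrite vnormZ; apply: Rplus_le_compat_l.
Qed.

Lemma cv_bounded_mul0 (a b : nat -> R) (B : R) :
  (forall k, Rabs (a k) <= B) -> Un_cv b 0 -> Un_cv (fun k => a k * b k) 0.
Proof.
move=> Ha /Un_cv_ssr Hb; apply/Un_cv_ssr => eps He.
have B0 : 0 <= B := Rle_trans _ _ _ (Rabs_pos _) (Ha 0%N).
have q0 : 0 < eps / (B + 1) by apply: Rdiv_lt_0_compat; lra.
have [N HN] := Hb _ q0.
exists N => t /HN; rewrite !Rminus_0_r Rabs_mult => H.
have := Rmult_le_compat_r _ _ _ (Rabs_pos (b t)) (Ha t).
have : (B + 1) * Rabs (b t) < eps.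
  have := Rmult_lt_compat_l (B + 1) _ _ (ltac:(lra)) H.
  by have -> : (B + 1) * (eps / (B + 1)) = eps by field; lra.
have := Rabs_pos (b t); lra.
Qed.

Lemma cv_eq (u : nat -> R) a b : Un_cv u a -> a = b -> Un_cv u b.
Proof. by move=> H <-. Qed.

Lemma cont_r_Fval n (f P1 P2 : vec n -> R) :
  cont_r f -> cont_r P1 -> cont_r P2 -> cont_r (Fval f P1 P2).
Proof.
move=> cf c1 c2 x eps He; have He3 : 0 < eps / 3 by lra.
have [d1 [p1 H1]] := cf x _ He3; have [d2 [p2 H2]] := c1 x _ He3; have [d3 [p3 H3]] := c2 x _ He3.
exists (Rmin d1 (Rmin d2 d3)); split; first by repeat apply: Rmin_glb_lt.
move=> y Hy; have Hy' := Rlt_le_trans _ _ _ Hy (Rmin_r _ _).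
have := H1 y (Rlt_le_trans _ _ _ Hy (Rmin_l _ _)); have := H2 y (Rlt_le_trans _ _ _ Hy' (Rmin_l _ _)).
have := H3 y (Rlt_le_trans _ _ _ Hy' (Rmin_r _ _)).
rewrite /Fval => /Rabs_def2 ? /Rabs_def2 ? /Rabs_def2 ?; apply: Rabs_def1; lra.
Qed.

Lemma has_grad_cont n (f : vec n -> R) (gradf : vec n -> vec n) :
  (forall z, has_grad f z (gradf z)) -> cont_r f.
Proof.
move=> Hf x eps He; have [d [d0 Hd]] := Hf x 1 Rlt_0_1.
have K0 := vnorm_ge0 (gradf x).
have q0 : 0 < eps / (vnorm (gradf x) + 2) by apply: Rdiv_lt_0_compat; lra.
exists (Rmin d (eps / (vnorm (gradf x) + 2))); split; first exact: Rmin_glb_lt.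
move=> y Hy; have := Hd y (Rlt_le_trans _ _ _ Hy (Rmin_l _ _)).
have Hlt := Rlt_le_trans _ _ _ Hy (Rmin_r _ _); set N := vnorm (vsub y x) in Hlt *.
have N0 : 0 <= N := vnorm_ge0 _.
have := cauchy_schwarz (gradf x) (vsub y x); rewrite -/N => H1 H2.
have := Rabs_triang (f y - f x - dot (gradf x) (vsub y x)) (dot (gradf x) (vsub y x)).
have -> : f y - f x - dot (gradf x) (vsub y x) + dot (gradf x) (vsub y x) = f y - f x by ring.
have : N * (vnorm (gradf x) + 2) < eps.
  have := Rmult_lt_compat_r (vnorm (gradf x) + 2) _ _ (ltac:(lra)) Hlt.
  by have -> : eps / (vnorm (gradf x) + 2) * (vnorm (gradf x) + 2) = eps by field; lra.
nra.
Qed.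

Lemma choice_nat (T : Type) (P : nat -> T -> Prop) :
  (forall k, exists t, P k t) -> exists s : nat -> T, forall k, P k (s k).
Proof.
move=> H; exists (fun k => proj1_sig (constructive_indefinite_description _ (H k))) => k.
by case: constructive_indefinite_description.
Qed.

Definition frequently_near n (x : nat -> vec n) (l : vec n) : Prop :=
  forall eps, 0 < eps -> forall N : nat, exists t : nat, (N <= t)%nat /\ vnorm (vsub (x t) l) < eps.

Lemma not_frequently_near n (x : nat -> vec n) (l : vec n) :
  ~ frequently_near x l -> exists eps N, 0 < eps /\ forall t : nat, (N <= t)%nat -> eps <= vnorm (vsub (x t) l).
Proof.
move=> H; apply: NNPP => Hno; apply: H => eps He N; apply: NNPP => Hno2; apply: Hno.
exists eps, N; split=> // t Nt; apply: Rnot_lt_le => Hlt; apply: Hno2; by exists t.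
Qed.

Lemma frequently_near_subseq n (x : nat -> vec n) (l : vec n) :
  frequently_near x l -> exists s : nat -> nat, (forall k, (k <= s k)%nat) /\ vcv (fun k => x (s k)) l.
Proof.
move=> H; have Hp (k : nat) : 0 < / (INR k + 1) by apply: Rinv_0_lt_compat; have := pos_INR k; lra.
have [s Hs] := choice_nat (fun k => H _ (Hp k) k).
exists s; split=> [k|]; first by case: (Hs k).
apply/vcv_norm => eps He; have [N [HN N0]] := archimed_cor1 eps He.
exists N => k Hk; have [_ H1] := Hs k; apply: (Rlt_trans _ _ _ H1); apply: Rle_lt_trans HN.
apply: Rinv_le_contravar; first exact: lt_0_INR.
by have := @le_INR N k (ltac:(lia)); lra.
Qed.

Section SCP.
Variables (n m : nat) (f P1 P2 : vec n -> R) (g : vec n -> vec m)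
  (gradf : vec n -> vec n) (gradg : 'I_m -> vec n -> vec n)
  (hessg : 'I_m -> vec n -> 'I_n -> vec n) (Lipf : R) (Lipg : 'I_m -> R)
  (c Llo Lhi tau : R) (x : nat -> vec n) (Lf : nat -> R) (Lg : nat -> vec m).
Hypotheses (Hfgrad : forall z, has_grad f z (gradf z)) (Hfcont : cont_v gradf)
  (HP1conv : convex_fun P1) (HP1cont : cont_r P1)
  (HP2conv : convex_fun P2) (HP2cont : cont_r P2)
  (Hgcont : forall i, cont_r (fun z => g z i))
  (HAf : lipschitz gradf Lipf)
  (HAg : forall i z, has_grad (fun y => g y i) z (gradg i z))
  (HAgL : forall i, lipschitz (gradg i) (Lipg i))
  (HAlev : level_bounded (Fext f P1 P2 g))
  (HBc1 : forall i, cont_v (gradg i)) (HBmfcq : MFCQ g gradg)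
  (Hc : 0 < c) (HL : 0 < Llo < Lhi) (Htau : 1 < tau)
  (Halg : SCP_ls_seq f P1 P2 g gradf gradg c Llo Lhi tau x Lf Lg).

Let F := Fval f P1 P2.
Let del t := vnorm (vsub (x t.+1) (x t)).

(** Minus the gradient at xn of the Lagrangian of the subproblem posed at xo, without its term
    P1. *)
Definition kkt_residual (xi : vec n) (L : R) (lam : vec m) (w : vec m) (xn xo : vec n) : vec n :=
  fun j => - (gradf xo j - xi j + L * (xn j - xo j)
           + \big[Rplus/0]_(i < m) (lam i * (gradg i xo j + w i * (xn j - xo j)))).

Lemma lipschitz_weaken (G : vec n -> vec n) (K K' : R) : K <= K' -> lipschitz G K -> lipschitz G K'.
Proof.
move=> HK H a b; apply: Rle_trans (H a b) _; apply: Rmult_le_compat_r => //; exact: vnorm_ge0.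
Qed.

Lemma iterates_accepted : exists BF BG, 0 <= BF /\ 0 <= BG /\ forall t,
  [/\ vle0 (g (x t)), F (x t.+1) <= F (x t) - c / 2 * del t ^ 2, forall i, 0 <= Lg t i <= BG &
   exists xi, [/\ csubgrad P2 (x t) xi, 0 <= Lf t <= BF &
     sub_min P1 g gradf gradg (x t) xi (Lf t) (Lg t) (x t.+1)]].
Proof.
have [K [K0 HK]] := finite_upper_bound (fun i => @lipschitz_weaken (gradg i))
  (fun i => ex_intro _ _ (HAgL i)).
(* The first summands cover the initial trials (at most Lhi, scale 1), the second ones the values
   reached after a failed trial. *)
pose BF := Lhi + Rabs (tau * (Lipf + c)); pose S := 1 + tau * K / Llo.
have q0 : 0 <= tau * K / Llo.
  by apply: Rmult_le_pos; [nra | apply: Rlt_le; apply: Rinv_0_lt_compat; lra].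
have HBF : tau * (Lipf + c) <= BF by rewrite /BF; have := Rle_abs (tau * (Lipf + c)); lra.
have HBL : Lhi <= BF by rewrite /BF; have := Rabs_pos (tau * (Lipf + c)); lra.
exists BF, (S * Lhi); split; first lra.
split; first by rewrite /S; nra.
have [g0 Hstep] := Halg.
have step t : vle0 (g (x t)) ->
  [/\ vle0 (g (x t.+1)), F (x t.+1) <= F (x t) - c / 2 * del t ^ 2, forall i, 0 <= Lg t i <= S * Lhi &
   exists xi, [/\ csubgrad P2 (x t) xi, 0 <= Lf t <= BF &
     sub_min P1 g gradf gradg (x t) xi (Lf t) (Lg t) (x t.+1)]].
  move=> gt; have [xi [Lf0 [Lg0 [/subdiff_csubgrad Hxi [HLf0 [HLg0 Hrun]]]]]] := Hstep t.
  have {}Hxi := Hxi HP2conv HP2cont.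
  have HS : tau * K / Llo <= S by rewrite /S; lra.
  have HLf0' : 0 < Lf0 <= BF by lra.
  have HLg0' : exists s, 1 <= s <= S /\ forall i, s * Llo <= Lg0 i <= s * Lhi.
    by exists 1; split=> [|i]; [rewrite /S; lra | have := HLg0 i; lra].
  have [HLf [s [Hs HsL]] Hmin gn Hdec] :=
    ls_run_spec Hfgrad HAf HAg HK Htau (proj1 HL) HBF HS gt Hxi Hrun HLf0' HLg0'.
  split=> //; last by exists xi; split=> //; lra.
  by move=> i; have := HsL i; nra.
move=> t; have gt : vle0 (g (x t)) by elim: t => // t /step [].
by have [? ? ? ?] := step t gt; split.
Qed.

(** Monotonicity of F keeps all iterates in the level set of x_0, which is bounded; its radius M
    then yields bounds on xi_t and on the multipliers that are uniform in t. *)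
Lemma iterates_kkt : exists M BF BG Kxi Lam, [/\ 0 <= M, 0 <= BF, 0 <= BG, 0 <= Lam & forall t,
  [/\ vle0 (g (x t)), vnorm (x t) <= M, F (x t.+1) <= F (x t) - c / 2 * del t ^ 2,
      forall i, 0 <= Lg t i <= BG &
   exists xi lam, [/\ csubgrad P2 (x t) xi, vnorm xi <= Kxi, 0 <= Lf t <= BF,
     vle0 (Gbar g gradg (x t.+1) (x t) (Lg t)) &
     [/\ forall i, 0 <= lam i <= Lam, forall i, lam i * Gbar g gradg (x t.+1) (x t) (Lg t) i = 0 &
      csubgrad P1 (x t.+1) (kkt_residual xi (Lf t) lam (Lg t) (x t.+1) (x t))]]]].
Proof.
have [BF [BG [BF0 [BG0 Hit]]]] := iterates_accepted.
have Fdec t : F (x t.+1) <= F (x t).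
  by have [_ H _ _] := Hit t; have := pow2_ge_0 (del t); nra.
have F0 t : F (x t) <= F (x 0%N) by elim: t => [|t IH]; [lra | have := Fdec t; lra].
have [M HM] := HAlev (F (x 0%N)).
have Hx t : vnorm (x t) <= M.
  apply: (HM _ (F (x t))) => //; rewrite /Fext; case: excluded_middle_informative => // Hno.
  by case: Hno; case: (Hit t).
have M0 : 0 <= M by have := Hx 0%N; have := vnorm_ge0 (x 0%N); lra.
have [Kxi [Kxi0 HKxi]] := csubgrad_bounded M HP2cont.
have [Lam [Lam0 Hlam]] := multipliers_bounded HP1conv HP1cont Hfcont Hgcont HBc1 HBmfcq M0 Kxi0 BF0 BG0.
exists M, BF, BG, Kxi, Lam; split=> // t.
have [gt dec wt [xi [Hxi HLf Hmin]]] := Hit t.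
split=> //; have nxi := HKxi _ _ (Hx t) Hxi.
have [lam [l0 lc ls]] := Hlam _ _ _ _ _ gt (Hx t) nxi HLf wt (Hx t.+1) Hmin.
by exists xi, lam; split=> //; case: Hmin.
Qed.

Lemma values_converge : exists Fs, [/\ Un_cv (fun t => F (x t)) Fs, forall t, Fs <= F (x t),
  forall t, F (x t.+1) <= F (x t) - c / 2 * del t ^ 2 & Un_cv del 0].
Proof.
have [M [BF [BG [Kxi [Lam [M0 _ _ _ Hit]]]]]] := iterates_kkt.
have [K [K0 HK]] := cont_r_bounded M (cont_r_Fval (has_grad_cont Hfgrad) HP1cont HP2cont).
have dec t : F (x t.+1) <= F (x t) - c / 2 * del t ^ 2 by case: (Hit t).
have Fdec : Un_decreasing (fun t => F (x t)).
  by move=> t; have := dec t; have := pow2_ge_0 (del t); nra.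
have [Fs HFs] : exists l, Un_cv (fun t => F (x t)) l.
  have [l Hl] := decreasing_cv _ Fdec (ltac:(exists K => y [t ->]; rewrite /opp_seq;
    have [_ Hx _ _ _] := Hit t; have := HK _ Hx; have := Rle_abs (- F (x t)); rewrite Rabs_Ropp /F; lra)).
  by exists l.
have Fge := decreasing_ineq _ _ Fdec HFs.
exists Fs; split=> //; apply/Un_cv_ssr => eps He.
(* A step of length eps or more would use up c / 2 eps^2, more than what remains to be lost. *)
have q0 : 0 < c / 2 * eps ^ 2 by apply: Rmult_lt_0_compat; [lra | exact: pow_lt].
have [N HN] := (proj1 (Un_cv_ssr _ _) HFs) _ q0.
exists N => t /HN /Rabs_def2 [H _]; have d0 : 0 <= del t := vnorm_ge0 _.
rewrite Rminus_0_r Rabs_pos_eq //; apply: Rnot_le_lt => Hle.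
have := dec t; have := Fge t.+1; have := pow_incr eps (del t) 2 (ltac:(lra)).
move=> H1 H2 H3; have : c / 2 * eps ^ 2 <= c / 2 * del t ^ 2 by apply: Rmult_le_compat_l; lra.
lra.
Qed.

(** Subsequences are extracted in turn for x_t, xi_t and the multipliers. Lf_t and Lg_t are left
    without a limit: they are bounded and always multiply a power of the vanishing step. *)
Lemma accumulation_stationary l : frequently_near x l -> stationary f P1 P2 g gradf gradg l.
Proof.
move=> Hfreq; have [M [BF [BG [Kxi [Lam [M0 BF0 BG0 _ Hit]]]]]] := iterates_kkt.
have [Fs [_ _ _ Hdel]] := values_converge.
have [s0 [Hs0 Hx0]] := frequently_near_subseq Hfreq.
pose Pr k (q : vec n * vec m) := [/\ csubgrad P2 (x (s0 k)) q.1, vnorm q.1 <= Kxi,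
   forall i, 0 <= q.2 i <= Lam, forall i, q.2 i * Gbar g gradg (x (s0 k).+1) (x (s0 k)) (Lg (s0 k)) i = 0 &
   csubgrad P1 (x (s0 k).+1) (kkt_residual q.1 (Lf (s0 k)) q.2 (Lg (s0 k)) (x (s0 k).+1) (x (s0 k)))].
have [q Hq] : exists q : nat -> vec n * vec m, forall k, Pr k (q k).
  apply: choice_nat => k; have [_ _ _ _ [xi [lam [H1 H2 _ _ [H3 H4 H5]]]]] := Hit (s0 k).
  by exists (xi, lam).
have [s1 [xi [Hs1 Hxi]]] := @bolzano_weierstrass_vec _ (fun k => (q k).1) Kxi (fun k => let: And5 _ h _ _ _ := Hq k in h).
have Hlamb k : vnorm ((q (s1 k)).2) <= INR m * Lam.
  by apply: vnorm_le_coords => i; have [_ _ H _ _] := Hq (s1 k); have := H i => ?; rewrite Rabs_pos_eq; lra.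
have [s2 [lam [Hs2 Hlam]]] := bolzano_weierstrass_vec Hlamb.
pose s k := s1 (s2 k); pose t k := s0 (s k).
have Hs k : (k <= s k)%nat by apply: leq_trans (Hs2 k) (Hs1 _).
have Ht k : (k <= t k)%nat by apply: leq_trans (Hs k) (Hs0 _).
have cvx : vcv (fun k => x (t k)) l by exact: (vcv_sub Hs Hx0).
have cvxi : vcv (fun k => (q (s k)).1) xi by exact: (vcv_sub Hs2 Hxi).
have cvd : Un_cv (fun k => del (t k)) 0 by exact: Un_cv_sub.
have cvgap j : Un_cv (fun k => x (t k).+1 j - x (t k) j) 0.
  apply/Un_cv_ssr => eps He; have [N HN] := (proj1 (Un_cv_ssr _ _) cvd) eps He.
  exists N => k /HN; rewrite !Rminus_0_r (Rabs_pos_eq (del _)); last exact: vnorm_ge0.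
  by apply: Rle_lt_trans; exact: (coord_le (vsub (x (t k).+1) (x (t k)))).
have cvx' : vcv (fun k => x (t k).+1) l.
  move=> j; apply: (@Un_cv_ext (fun k => (x (t k).+1 j - x (t k) j) + x (t k) j)) => [k|]; first by ring.
  by apply: (cv_eq (CV_plus _ _ _ _ (cvgap j) (cvx j))); ring.
have Bw k i : Rabs (Lg (t k) i) <= BG.
  by have [_ _ _ H _] := Hit (t k); have := H i => ?; rewrite Rabs_pos_eq; lra.
have Bl k : Rabs (Lf (t k)) <= BF.
  by have [_ _ _ _ [? [? [_ _ ? _ _]]]] := Hit (t k); rewrite Rabs_pos_eq; lra.
have cvg i : Un_cv (fun k => g (x (t k)) i) (g l i) := cont_r_cv (Hgcont i) cvx.
have cvgradg i : vcv (fun k => gradg i (x (t k))) (gradg i l) := cont_v_cv (HBc1 i) cvx.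
split.
  move=> i; apply: (Rle_cv_lim _ (cvg i) (cv_const 0)) => k.
  by have [H _ _ _ _] := Hit (t k); exact: H.
exists lam; split.
  move=> i; apply: (Rle_cv_lim _ (cv_const 0) (Hlam i)) => k.
  by have [_ _ H _ _] := Hq (s k); case: (H i).
split.
  move=> i; have cv0 : Un_cv (fun k => (q (s k)).2 i * Gbar g gradg (x (t k).+1) (x (t k)) (Lg (t k)) i)
     (lam i * (g l i + 0 + 0)).
    apply: CV_mult; first exact: Hlam.
    apply: CV_plus; first apply: CV_plus; first exact: cvg.
      apply: (cv_eq (cv_dot (cvgradg i) (_ : vcv _ (fun _ => 0)))); first by move=> j; exact: cvgap.
      by apply: big1 => j _; ring.
    apply: (@cv_bounded_mul0 _ _ BG) => [k|].
      rewrite /Rdiv Rabs_mult (Rabs_pos_eq (/ 2)); last lra.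
      by have := Bw k i; have := Rabs_pos (Lg (t k) i); lra.
    apply: (@Un_cv_ext (fun k => del (t k) * del (t k))) => [k|]; first by rewrite /del; ring.
    by apply: (cv_eq (CV_mult _ _ _ _ cvd cvd)); ring.
  have := UL_sequence _ _ _ cv0 (Un_cv_ext _ _ (fun k => esym (let: And5 _ _ _ h _ := Hq (s k) in h i)) _ (cv_const 0)).
  lra.
(* The zeros are the limits of the terms that carry Lf and Lg. *)
pose u : vec n := fun j => - (gradf l j - xi j + 0 + \big[Rplus/0]_(i < m) (lam i * (gradg i l j + 0))).
exists u, xi.
have cvu : vcv (fun k => kkt_residual (q (s k)).1 (Lf (t k)) (q (s k)).2 (Lg (t k)) (x (t k).+1) (x (t k))) u.
  move=> j; apply: CV_opp; apply: CV_plus; first apply: CV_plus; first apply: CV_minus.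
  - exact: (cont_v_cv Hfcont cvx).
  - exact: cvxi.
  - exact: (cv_bounded_mul0 Bl).
  apply: cv_sum => i; apply: CV_mult; first exact: Hlam.
  apply: CV_plus; first exact: cvgradg.
  by apply: (@cv_bounded_mul0 _ _ BG) => // k; exact: Bw.
split.
  apply: csubgrad_subdiff; apply: (csubgrad_cv HP1cont cvx' cvu) => k.
  by have [_ _ _ _ H] := Hq (s k); exact: H.
split.
  apply: csubgrad_subdiff; apply: (csubgrad_cv HP2cont cvx cvxi) => k.
  by have [H _ _ _ _] := Hq (s k); exact: H.
move=> j; rewrite /u /wsum_grad.
have -> : \big[Rplus/0]_(i < m) (lam i * (gradg i l j + 0)) = \big[Rplus/0]_(i < m) (lam i * gradg i l j).
  by apply: eq_bigr => i _; rewrite Rplus_0_r.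
ring.
Qed.

(** * Subgradient estimate and KL argument for the iterates *)

Variables (Gam : vec n -> Prop) (gradP2 : vec n -> vec n).
Hypotheses (HGopen : forall z, Gam z -> exists r, 0 < r /\ forall y, vnorm (vsub y z) < r -> Gam y)
  (HGstat : forall z, stationary f P1 P2 g gradf gradg z -> Gam z)
  (HGgrad : forall z, Gam z -> has_grad P2 z (gradP2 z))
  (HGlip : forall z, Gam z -> exists r L, 0 < r /\
        forall y1 y2, Gam y1 -> Gam y2 -> vnorm (vsub y1 z) < r -> vnorm (vsub y2 z) < r ->
          vnorm (vsub (gradP2 y1) (gradP2 y2)) <= L * vnorm (vsub y1 y2))
  (HCg : forall i j z, has_grad (fun y => gradg i y j) z (hessg i z j))
  (HCcont : forall i j, cont_v (fun z => hessg i z j)).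

(** Each point l is either an accumulation point, hence stationary and surrounded by a ball in [Gam]
    where the gradient of P2 is Lipschitz, or it is eventually avoided. Compactness extracts one
    Lipschitz constant and one starting index. *)
Lemma eventually_smooth : exists N K, 0 <= K /\ forall t : nat, (N <= t)%nat ->
  has_grad P2 (x t.+1) (gradP2 (x t.+1)) /\
  forall xi, csubgrad P2 (x t) xi -> vnorm (vsub xi (gradP2 (x t.+1))) <= K * del t.
Proof.
have [M [BF [BG [Kxi [Lam [M0 BF0 BG0 _ Hit]]]]]] := iterates_kkt.
have [Fs [_ _ _ /Un_cv_ssr Hdel]] := values_converge.
pose R t K := has_grad P2 (x t.+1) (gradP2 (x t.+1)) /\
  forall xi, csubgrad P2 (x t) xi -> vnorm (vsub xi (gradP2 (x t.+1))) <= K * del t.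
have Rmon t K K' : K <= K' -> R t K -> R t K'.
  move=> HK [H1 H2]; split=> // xi /H2 H; apply: Rle_trans H _.
  by apply: Rmult_le_compat_r => //; exact: vnorm_ge0.
pose Q (A : nat -> Prop) := exists (N : nat) K, 0 <= K /\ forall t, A t -> (N <= t)%nat -> R t K.
suff : Q (fun _ => True) by move=> [N [K [HK H]]]; exists N, K; split=> // t; exact: H.
apply: (@ideal_local_global _ _ x _ M) => [|t _|l]; last 2 first.
- by case: (Hit t).
- case: (classic (frequently_near x l)) => [Hl|/not_frequently_near [eps [N [He Hfar]]]]; last first.
    exists eps; split=> //; exists N, 0; split; first lra.
    by move=> t [_ Hlt] /Hfar; lra.
  have Gl := HGstat (accumulation_stationary Hl).
  have [r1 [r10 Hr1]] := HGopen Gl; have [r [L [r0 Hlip]]] := HGlip Gl.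
  (* Half the radius: x_t is within it of l and the step is shorter than it, so x_{t+1} stays in the
     ball too. *)
  have e0 : 0 < Rmin r1 r / 2 by have := Rmin_glb_lt _ _ _ r10 r0; lra.
  have [N HN] := Hdel _ e0.
  exists (Rmin r1 r / 2); split=> //; exists N, (Rabs L); split; first exact: Rabs_pos.
  move=> t [_ Hx] Nt; have := HN t Nt; rewrite Rminus_0_r Rabs_pos_eq; last exact: vnorm_ge0.
  move=> Hd; have := vnorm_sub_tri (x t.+1) (x t) l; rewrite -/(del t) => Htri.
  have m1 := Rmin_l r1 r; have m2 := Rmin_r r1 r.
  have Gx : Gam (x t) by apply: Hr1; lra.
  have Gx' : Gam (x t.+1) by apply: Hr1; lra.
  split; first exact: HGgrad.
  move=> xi /csubgrad_grad /(_ (HGgrad Gx)) ->.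
  rewrite vnorm_sub_sym; apply: (Rle_trans _ (L * del t)); first by apply: Hlip => //; lra.
  by apply: Rmult_le_compat_r; [exact: vnorm_ge0 | exact: Rle_abs].
split; first by exists 0%N, 0; split; [lra|].
  by move=> A B HAB [N [K [HK H]]]; exists N, K; split=> // t /HAB; exact: H.
move=> A B [N [K [HK H]]] [N' [K' [HK' H']]]; exists (maxn N N'), (K + K'); split; first lra.
move=> t [/H Ht|/H' Ht] Nt.
  by apply: Rmon (Ht _); [lra | lia].
by apply: Rmon (Ht _); [lra | lia].
Qed.

(** Inserting the KKT subgradient of P1 cancels the multiplier terms of the first block and leaves
    gradf(x_{t+1}) - gradf(x_t) + xi_t - gradP2(x_{t+1}) - Lf_t (x_{t+1} - x_t). The other two
    blocks contain the step as a factor. C1, C2 and C3 bound the three blocks. *)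
Lemma relative_error : exists N C, 0 < C /\ forall t : nat, (N <= t)%nat ->
  exists v, limiting_subdiff (@sub3 n m) (@ip3 n m) (Fbar f P1 P2 g gradg) (x t.+1, x t, Lg t) v /\
    norm3 v <= C * del t.
Proof.
have [M [BF [BG [Kxi [Lam [M0 BF0 BG0 Lam0 Hit]]]]]] := iterates_kkt.
have [N [K [K0 Hsm]]] := eventually_smooth.
have [H [H0 HH]] : exists H, 0 <= H /\ forall (ij : 'I_m * 'I_n) z, vnorm z <= M -> vnorm (hessg ij.1 z ij.2) <= H.
  apply: finite_upper_bound => [ij a b Hab Ha z /Ha|[i j]]; first lra.
  by have [b [_ Hb]] := cont_v_bounded M (HCcont i j); exists b.
have n0 := pos_INR n; have m0 := pos_INR m.
pose C1 := Rabs Lipf + K + BF; pose C2 := INR m * (Lam * (INR n * H + BG)); pose C3 := INR m * (Lam * M).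
have C10 : 0 <= C1 by rewrite /C1; have := Rabs_pos Lipf; lra.
have nH : 0 <= INR n * H by exact: Rmult_le_pos.
have C20 : 0 <= C2 by apply: Rmult_le_pos => //; apply: Rmult_le_pos; lra.
have C30 : 0 <= C3 by apply: Rmult_le_pos => //; apply: Rmult_le_pos; lra.
exists N, (C1 + C2 + C3 + 1); split; first lra.
move=> t Nt; have [_ Hx _ Hw [xi [lam [Hxi _ HLf Hfeas [Hlam Hcompl Hu]]]]] := Hit t.
have [HP2 Hxi2] := Hsm t Nt.
have := frechet_subdiff_Fbar Hfeas (fun i => proj1 (Hlam i)) Hcompl Hu (Hfgrad (x t.+1)) HP2
   (fun i => HAg i (x t)) (fun i j => HCg i j (x t)).
set v1 := vadd _ _; set v2 := wsum_grad _ _ _; set v3 := (fun i => _) => Hfr.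
exists (v1, v2, v3); split; first exact: frechet_limiting.
have d0 : 0 <= del t := vnorm_ge0 _.
apply: Rle_trans; first exact: norm3_le_sum.
have N1 : vnorm v1 <= C1 * del t.
  have -> : v1 = vadd (vadd (vsub (gradf (x t.+1)) (gradf (x t))) (vsub xi (gradP2 (x t.+1))))
     (vscale (- Lf t) (vsub (x t.+1) (x t))).
    apply: vec_ext => j; rewrite /v1 /kkt_residual /wsum_grad /Gbar_dx /vadd /vsub /vscale.
    by set S := \big[Rplus/0]_(i < m) _; ring.
  apply: Rle_trans; first exact: vnormD.
  have := vnormD (vsub (gradf (x t.+1)) (gradf (x t))) (vsub xi (gradP2 (x t.+1))).
  have := Hxi2 xi Hxi; have := HAf (x t.+1) (x t); rewrite -/(del t).
  rewrite vnormZ Rabs_Ropp (Rabs_pos_eq (Lf t)); last lra.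
  have := Rmult_le_compat_r _ _ _ d0 (Rle_abs Lipf).
  have := Rmult_le_compat_r _ _ _ d0 (proj2 HLf).
  rewrite /C1 -/(del t); lra.
have N2 : vnorm v2 <= C2 * del t.
  apply: Rle_trans; first exact: vnorm_wsum_grad.
  have -> : C2 * del t = INR #|'I_m| * (Lam * ((INR n * H + BG) * del t)) by rewrite card_ord /C2; ring.
  apply: sumR_const_bound => i; rewrite Rabs_pos_eq; last by case: (Hlam i).
  apply: Rmult_le_compat; [by case: (Hlam i) | exact: vnorm_ge0 | by case: (Hlam i) |].
  apply: Rle_trans; first exact: vnormB.
  rewrite vnormZ_pos; last by case: (Hw i).
  rewrite -/(del t) Rmult_plus_distr_r; apply: Rplus_le_compat; last first.
    by apply: Rmult_le_compat_r => //; case: (Hw i).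
  apply: Rle_trans; first exact: vnorm_wsum_grad.
  have -> : INR n * H * del t = INR #|'I_n| * (del t * H) by rewrite card_ord; ring.
  apply: sumR_const_bound => j; apply: Rmult_le_compat; [exact: Rabs_pos | exact: vnorm_ge0 | exact: coord_le |].
  exact: (HH (i, j)).
have N3 : vnorm v3 <= C3 * del t.
  apply: Rle_trans; first exact: vnorm_le_sum.
  have -> : C3 * del t = INR #|'I_m| * (Lam * (M * del t)) by rewrite card_ord /C3; ring.
  (* The third block is quadratic in the step; boundedness of the iterates makes it linear. *)
  have dM : del t <= 2 * M.
    have [_ Hx' _ _ _] := Hit t.+1; have := vnormB (x t.+1) (x t); rewrite -/(del t); lra.
  have sq0 := pow2_ge_0 (del t).
  apply: sumR_const_bound => i; rewrite /v3 -/(del t) Rabs_pos_eq; last first.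
    by apply: Rmult_le_pos; [case: (Hlam i) | lra].
  apply: Rmult_le_compat; [by case: (Hlam i) | lra | by case: (Hlam i) |].
  have -> : del t ^ 2 / 2 = del t / 2 * del t by field.
  by apply: Rmult_le_compat_r => //; lra.
lra.
Qed.

Let z3 t : E3 n m := (x t.+1, x t, Lg t).
Notation acc3 := (acc_point (@sub3 n m) (@ip3 n m) z3).

(** Since the steps vanish, the two x-blocks of an accumulation point agree. Membership in the
    domain of the subdifferential is what makes the KL hypothesis on [Fbar] applicable there. *)
Lemma accumulation_point_spec om Fs :
  Un_cv (fun t => F (x t)) Fs -> acc3 om ->
  exists l w, [/\ om = (l, l, w), frequently_near x l, Fbar f P1 P2 g gradg om = Some Fs &
    exists v, limiting_subdiff (@sub3 n m) (@ip3 n m) (Fbar f P1 P2 g gradg) om v].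
Proof.
case: om => [[l' l] w] HFs Hacc.
have [Fs' [_ _ _ /Un_cv_ssr Hdel]] := values_converge.
have Hcomp eps (N : nat) : 0 < eps -> exists t : nat, [/\ (N <= t)%nat, vnorm (vsub (x t.+1) l') < eps,
   vnorm (vsub (x t) l) < eps & del t < eps].
  move=> He; have [N' HN'] := Hdel eps He; have [t [Nt Ht]] := Hacc eps He (maxn N N').
  have [c1 [c2 _]] := norm3_ge_comp (vsub (x t.+1) l') (vsub (x t) l) (vsub (Lg t) w).
  have Hn : norm3 (vsub (x t.+1) l', vsub (x t) l, vsub (Lg t) w) < eps by exact: Ht.
  exists t; split; [lia | lra | lra |].
  by have := HN' t (ltac:(lia)); rewrite Rminus_0_r Rabs_pos_eq //; exact: vnorm_ge0.
have El : l' = l.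
  apply: vnorm0_eq; apply: Rnot_lt_le => Hlt.
  have [t [_ h1 h2 h3]] := Hcomp (vnorm (vsub l' l) / 3) 0%N (ltac:(lra)).
  have := vnorm_sub_tri l' (x t.+1) l; have := vnorm_sub_tri (x t.+1) (x t) l.
  rewrite (vnorm_sub_sym l' (x t.+1)) -/(del t); lra.
subst l'.
have Hfreq : frequently_near x l.
  by move=> eps He N; have [t [Nt _ Ht _]] := Hcomp eps N He; exists t.
have Hstat := accumulation_stationary Hfreq; have [gl [_ [_ [_ [u [_ [Hu _]]]]]]] := Hstat.
have Gl := HGstat Hstat.
have EF : F l = Fs.
  have [s [Hs Hx]] := frequently_near_subseq Hfreq.
  apply: UL_sequence (cont_r_cv (cont_r_Fval (has_grad_cont Hfgrad) HP1cont HP2cont) Hx) _.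
  exact: (@Un_cv_sub (fun t => F (x t))).
have Gbarl : vle0 (Gbar g gradg l l w).
  move=> i; rewrite /Gbar vsubxx dotBr; have := gl i; lra.
exists l, w; split=> //.
  by rewrite /Fbar; case: excluded_middle_informative => // ?; rewrite -EF.
have Hu' := subdiff_csubgrad HP1conv HP1cont Hu.
(* Zero multipliers suffice: some subgradient is wanted, not a small one. *)
have := @frechet_subdiff_Fbar n m f P1 P2 g gradg hessg l l u _ _ w (fun _ => 0) Gbarl
  (fun _ => Rle_refl 0) (fun _ => Rmult_0_l _) Hu' (Hfgrad l) (HGgrad Gl)
  (fun i => HAg i l) (fun i j => HCg i j l).
by move=> /frechet_limiting H; eexists; exact: H.
Qed.

(* Uniformization: one desingularizing function of the class serves all accumulation points, since
   the bounded sequence is eventually covered by finitely many KL neighbourhoods and the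
   corresponding functions can be added. *)
Lemma uniform_kl (Cls : (R -> R) -> Prop) Fs C N0 :
  (forall phi phi', Cls phi -> Cls phi' -> Cls (fun s => phi s + phi' s)) ->
  Un_cv (fun t => F (x t)) Fs -> (forall t, Fs <= F (x t)) ->
  (forall t, F (x t.+1) <= F (x t)) ->
  (forall t : nat, (N0 <= t)%nat ->
     exists v, limiting_subdiff (@sub3 n m) (@ip3 n m) (Fbar f P1 P2 g gradg) (z3 t) v /\
       norm3 v <= C * del t) ->
  (forall om, acc3 om -> exists phi, Cls phi /\
     KL_with (@sub3 n m) (@ip3 n m) (Fbar f P1 P2 g gradg) om phi) ->
  exists phi psi a (N : nat), [/\ Cls phi, desingularizing phi psi a,
    forall t, (N <= t)%nat -> F (x t) - Fs < a &
    forall t, (N <= t)%nat -> 0 < F (x t.+1) - Fs -> 1 <= psi (F (x t.+1) - Fs) * (C * del t)].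
Proof.
move=> Cadd HFs Fge Fdec Hrel Hkl.
have [M [BF [BG [Kxi [Lam [M0 BF0 BG0 _ Hit]]]]]] := iterates_kkt.
have [_ [_ _ _ /Un_cv_ssr Hdel]] := values_converge.
have HFs' := proj1 (Un_cv_ssr _ _) HFs.
pose Good (A : nat -> Prop) := exists phi psi a (N : nat), [/\ Cls phi, desingularizing phi psi a,
    forall t, (N <= t)%nat -> F (x t) - Fs < a &
    forall t, A t -> (N <= t)%nat -> 0 < F (x t.+1) - Fs -> 1 <= psi (F (x t.+1) - Fs) * (C * del t)].
pose Fin (A : nat -> Prop) := exists N : nat, forall t, A t -> (t < N)%nat.
(* Finite sets are a separate alternative, because [Good] demands a member of [Cls] and none is at
   hand near a point that is not an accumulation point. *)
pose Q A := Fin A \/ Good A.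
have GoodFin A B : Fin A -> Good B -> Good (fun t => A t \/ B t).
  move=> [N HN] [phi [psi [a [N' [h1 h2 h3 h4]]]]]; exists phi, psi, a, (maxn N N'); split=> //.
    by move=> t Nt; apply: h3; lia.
  by move=> t [/HN Ht|Bt] Nt; [lia | apply: h4 => //; lia].
suff [[N HN]|[phi [psi [a [N [h1 h2 h3 h4]]]]]] : Q (fun _ => True).
- by have := HN N I; lia.
- by exists phi, psi, a, N; split=> // t; exact: h4.
apply: (@ideal_local_global2 _ _ _ x Lg _ M (INR m * BG)) => [|t _|t _|l w].
- split; first by left; exists 0%N.
    move=> A B HAB [[N HN]|[phi [psi [a [N [h1 h2 h3 h4]]]]]]; first by left; exists N => t /HAB /HN.
    by right; exists phi, psi, a, N; split=> // t /HAB; exact: h4.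
  move=> A B [FA|GA] [FB|GB].
  + left; case: FA FB => N HN [N' HN']; exists (maxn N N') => t [/HN|/HN']; lia.
  + by right; exact: GoodFin.
  + right; have [phi [psi [a [N [h1 h2 h3 h4]]]]] := GoodFin _ _ FB GA.
    by exists phi, psi, a, N; split=> // t Ht; apply: h4; tauto.
  + right; case: GA GB => phi [psi [a [N [h1 h2 h3 h4]]]] [phi' [psi' [a' [N' [h1' h2' h3' h4']]]]].
    exists (fun s => phi s + phi' s), (fun s => psi s + psi' s), (Rmin a a'), (maxn N N').
    have bnd t : (maxn N N' <= t)%nat -> F (x t) - Fs < a /\ F (x t) - Fs < a'.
      by move=> Nt; split; [apply: h3; lia | apply: h3'; lia].
    split; [exact: Cadd | exact: desingularizing_add | |].
      by move=> t /bnd [? ?]; exact: Rmin_glb_lt.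
    move=> t AB Nt sp; have [ba ba'] := bnd t.+1 (leqW Nt).
    have [_ _ _ _ D] := h2; have [_ _ _ _ D'] := h2'.
    have [p0 _ _] := D _ (conj sp ba); have [p0' _ _] := D' _ (conj sp ba').
    (* One of the two KL inequalities forces C d_t > 0; only then does adding the other derivative
       preserve it. *)
    have Cd : 0 < C * del t.
      case: AB => [At|Bt].
        by have := h4 t At (ltac:(lia)) sp => H; apply: Rnot_le_lt => Hle; nra.
      by have := h4' t Bt (ltac:(lia)) sp => H; apply: Rnot_le_lt => Hle; nra.
    rewrite Rmult_plus_distr_r; have q := Rmult_lt_0_compat _ _ p0 Cd; have q' := Rmult_lt_0_compat _ _ p0' Cd.
    case: AB => [At|Bt].
      by have := h4 t At (ltac:(lia)) sp; lra.
    by have := h4' t Bt (ltac:(lia)) sp; lra.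
- by case: (Hit t).
- apply: vnorm_le_coords => i; have [_ _ _ H _] := Hit t; have := H i => ?.
  by rewrite Rabs_pos_eq; lra.
(* The covering controls only x_t and Lg_t; x_{t+1} is reached through the step and costs 2 e,
   whence the factor 4. *)
have dist t e : vnorm (vsub (x t) l) < e -> vnorm (vsub (Lg t) w) < e -> del t < e ->
    norm3 (sub3 (z3 t) (l, l, w)) < 4 * e.
  move=> d1 d2 d3; apply: Rle_lt_trans; first exact: norm3_le_sum.
  by have := vnorm_sub_tri (x t.+1) (x t) l; rewrite -/(del t); lra.
case: (classic (acc3 (l, l, w))) => [Hacc|Hnacc]; last first.
  have [e [N [e0 Hfar]]] : exists e (N : nat), 0 < e /\ forall t, (N <= t)%nat -> e <= norm3 (sub3 (z3 t) (l, l, w)).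
    apply: NNPP => Hno; apply: Hnacc => e He N; apply: NNPP => Hno2; apply: Hno.
    exists e, N; split=> // t Nt; apply: Rnot_lt_le => Hlt; apply: Hno2; by exists t.
  have e4 : 0 < e / 4 by lra.
  have [N' HN'] := Hdel _ e4.
  exists (e / 4); split=> //; left; exists (maxn N N') => t [_ [h1 h2]].
  rewrite ltnNge; apply/negP => Nt; have := Hfar t (ltac:(lia)).
  have := HN' t (ltac:(lia)); rewrite Rminus_0_r Rabs_pos_eq; last exact: vnorm_ge0.
  by move=> h3; have := dist t _ h1 h2 h3; lra.
have [phi [Cphi HK]] := Hkl _ Hacc.
have [a [r [psi [r0 Hdes [h [Eh HKLr]]]]]] := KL_with_desingularizing HK.
have [l' [w' [_ _ EF _]]] := accumulation_point_spec HFs Hacc.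
have {Eh EF} Eh : h = Fs by rewrite Eh in EF; case: EF.
subst h; have r4 : 0 < r / 4 by lra.
have [N1 HN1] := Hdel _ r4; have [a0 _ _ _ D] := Hdes; have [N2 HN2] := HFs' _ a0.
exists (r / 4); split=> //; right; exists phi, psi, a, (maxn N0 (maxn N1 N2)).
have sa t : (maxn N0 (maxn N1 N2) <= t)%nat -> F (x t) - Fs < a.
  by move=> Nt; have := HN2 t (ltac:(lia)) => /Rabs_def2; lra.
split=> // t [_ [h1 h2]] Nt sp.
have h3 : del t < r / 4.
  by have := HN1 t (ltac:(lia)); rewrite Rminus_0_r Rabs_pos_eq //; exact: vnorm_ge0.
have [v [Hv Nv]] := Hrel t (ltac:(lia)).
have st : F (x t.+1) - Fs < a by have := sa t Nt; have := Fdec t; lra.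
have [p0 _ _] := D _ (conj sp st).
have Hval : Fbar f P1 P2 g gradg (z3 t) = Some (F (x t.+1)).
  rewrite /Fbar /z3; case: excluded_middle_informative => // Hno; case: Hno.
  by have [_ _ _ _ [? [? [_ _ _ H _]]]] := Hit t.
have hr : norm3 (sub3 (z3 t) (l, l, w)) < r by have := dist t _ h1 h2 h3; lra.
apply: Rle_trans (HKLr (z3 t) (F (x t.+1)) hr Hval _ v Hv) _; first lra.
by apply: Rmult_le_compat_l => //; lra.
Qed.

(** The class [Cls] lets one argument serve twice: with all functions it gives convergence, with the
    multiples of s^(1 - alpha) it keeps the shape of phi needed for the rates. *)
Lemma kl_convergence (Cls : (R -> R) -> Prop) :
  (forall phi phi', Cls phi -> Cls phi' -> Cls (fun s => phi s + phi' s)) ->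
  (forall om, acc3 om -> exists phi, Cls phi /\
     KL_with (@sub3 n m) (@ip3 n m) (Fbar f P1 P2 g gradg) om phi) ->
  exists l Fs C phi psi a (N : nat),
    [/\ [/\ vcv x l, Cls phi, desingularizing phi psi a & 0 < C],
     Un_cv (fun t => F (x t)) Fs, forall t, Fs <= F (x t),
     forall t, F (x t.+1) <= F (x t) - c / 2 * del t ^ 2 &
     forall t, (N <= t)%nat -> [/\ F (x t) - Fs < a,
       0 < F (x t.+1) - Fs -> 1 <= psi (F (x t.+1) - Fs) * (C * del t) &
       vnorm (vsub (x t.+1) l) <= del t + 2 * C / c * phi (F (x t.+1) - Fs)]].
Proof.
move=> Cadd Hkl; have [Fs [HFs Fge dec Hdel]] := values_converge.
have Fdec t : F (x t.+1) <= F (x t) by have := dec t; have := pow2_ge_0 (del t); nra.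
have [N0 [C [C0 Hrel]]] := relative_error.
have [phi [psi [a [N [Cphi Hdes sa klt]]]]] := uniform_kl Cadd HFs Fge Fdec Hrel Hkl.
pose s t := F (x t) - Fs.
have s0 t : 0 <= s t by rewrite /s; have := Fge t; lra.
have sdec t : s t.+1 + c / 2 * del t ^ 2 <= s t by rewrite /s; have := dec t; lra.
have Hlen t p (Nt : (N <= t)%nat) := @kl_length c C a phi psi s del N Hc C0 Hdes (fun t => vnorm_ge0 _) s0 sa sdec klt t p Nt.
have HB : Un_cv (fun t => del t + 2 * C / c * phi (s t.+1)) 0.
  have [a0 phi0 phi_ge0 phic _] := Hdes.
  have phicv : Un_cv (fun t => phi (s t.+1)) 0.
    apply/Un_cv_ssr => eps He; have [d [d0 Hd]] := phic eps He.
    have [N1 HN1] := (proj1 (Un_cv_ssr _ _) HFs) d d0; exists (maxn N N1) => t Nt.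
    have sr : 0 <= s t.+1 < a by split=> //; apply: sa; lia.
    rewrite Rminus_0_r Rabs_pos_eq; last exact: phi_ge0.
    by apply: Hd => //; have := HN1 t.+1 (ltac:(lia)) => /Rabs_def2 []; rewrite /s; lra.
  apply: (cv_eq (CV_plus _ _ _ _ Hdel (CV_mult _ _ _ _ (cv_const (2 * C / c)) phicv))); ring.
have [l [Hl Hb]] := finite_length_cv HB Hlen.
exists l, Fs, C, phi, psi, a, N; split=> // t Nt; split; [exact: sa | exact: klt | exact: Hb].
Qed.

Lemma scp_converges :
  KL_function (@sub3 n m) (@ip3 n m) (Fbar f P1 P2 g gradg) ->
  exists l, stationary f P1 P2 g gradf gradg l /\ vcv x l.
Proof.
move=> HKL; have [Fs [HFs _ _ _]] := values_converge.
have [//|om Hom|l [_ [_ [_ [_ [_ [_ [[Hl _ _ _] _ _ _ _]]]]]]]] := @kl_convergence (fun _ => True).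
  have [_ [_ [_ _ _ Hdom]]] := accumulation_point_spec HFs Hom.
  by have [phi Hphi] := HKL om Hdom; exists phi.
exists l; split=> //; apply: accumulation_stationary => eps He N.
have [N' HN'] := (proj1 (vcv_norm _ _) Hl) eps He.
by exists (maxn N N'); split; [lia | apply: HN'; lia].
Qed.

Lemma scp_rates xs alpha : vcv x xs -> 0 <= alpha < 1 ->
  (forall om, acc3 om -> KL_exponent (@sub3 n m) (@ip3 n m) (Fbar f P1 P2 g gradg) om alpha) ->
  exists tl : nat, (1 <= tl)%nat /\
    (alpha = 0 -> forall t : nat, (tl < t)%nat -> x t = xs) /\
    (0 < alpha <= 1 / 2 -> exists a0 a1, 0 < a0 < 1 /\ 0 < a1 /\
        forall t : nat, (tl < t)%nat -> vnorm (vsub (x t) xs) <= a1 * a0 ^ t) /\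
    (1 / 2 < alpha < 1 -> exists a2, 0 < a2 /\
        forall t : nat, (tl < t)%nat ->
          vnorm (vsub (x t) xs) <= a2 * Rpower (INR t) (- ((1 - alpha) / (2 * alpha - 1)))).
Proof.
move=> Hxs Ha Hexp.
pose Cls (phi : R -> R) := exists A, 0 < A /\ phi = phi_pow A alpha.
have [|om Hom|l [Fs [C [phi [psi [a [N [[Hl [A [A0 Ephi]] Hdes C0] HFs Fge dec HN]]]]]]]] := @kl_convergence Cls.
- move=> phi phi' [A [A0 ->]] [A' [A0' ->]]; exists (A + A'); split; first lra.
  by rewrite phi_pow_add.
- by have [A [A0 HA]] := Hexp om Hom; exists (phi_pow A alpha); split=> //; exists A.
have El : l = xs by apply: vec_ext => i; exact: UL_sequence (Hl i) (Hxs i).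
subst l phi; pose s t := F (x t) - Fs.
have s0 t : 0 <= s t by rewrite /s; have := Fge t; lra.
have del0 t : 0 <= del t by exact: vnorm_ge0.
have sdec t : s t.+1 + c / 2 * del t ^ 2 <= s t by rewrite /s; have := dec t; lra.
have scv : Un_cv s 0 by apply: (cv_eq (CV_minus _ _ _ _ HFs (cv_const Fs))); ring.
(* The KL inequality becomes s_{t+1}^alpha <= E d_t; squaring it and using d_t^2 <= (2 / c) (s_t -
   s_{t+1}) gives K. *)
pose E := A * (1 - alpha) * C.
have E0 : 0 < E by apply: Rmult_lt_0_compat => //; apply: Rmult_lt_0_compat; lra.
pose K := E * E * (2 / c).
have K0 : 0 < K.
  by apply: Rmult_lt_0_compat; [exact: Rmult_lt_0_compat | apply: Rdiv_lt_0_compat; lra].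
have kl2 t : (N <= t)%nat -> 0 < s t.+1 -> Rpower (s t.+1) (2 * alpha) <= K * (s t - s t.+1).
  move=> Nt sp; have [_ klt _] := HN t Nt; have [sa _ _] := HN t.+1 (leqW Nt).
  have [_ _ _ _ D] := Hdes; have [_ Dphi _] := D _ (conj sp sa).
  (* [psi] is known only as a derivative of [phi_pow]; uniqueness of derivatives makes it
     explicit. *)
  have Epsi := uniqueness_limite _ _ _ _ Dphi (phi_pow_deriv A alpha sp).
  have := klt sp; rewrite Epsi Rpower_Ropp => H.
  have P := Rpower_gt0 (s t.+1) alpha.
  have {}H : Rpower (s t.+1) alpha <= E * del t.
    have := Rmult_le_compat_r _ _ _ (Rlt_le _ _ P) H; rewrite Rmult_1_l.
    by rewrite (_ : _ * _ * Rpower _ _ = E * del t); [|rewrite /E /s; field; exact: Rgt_not_eq].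
  rewrite (_ : 2 * alpha = alpha + alpha) ?Rpower_plus; last ring.
  apply: (Rle_trans _ (E * del t * (E * del t))); first by apply: Rmult_le_compat; lra.
  have -> : E * del t * (E * del t) = K * (c / 2 * del t ^ 2) by rewrite /K; field; lra.
  by apply: Rmult_le_compat_l; [lra | have := sdec t; lra].
have rb t : (N <= t)%nat ->
    vnorm (vsub (x t.+1) xs) <= del t + 2 * C / c * A * phi_pow 1 alpha (s t.+1).
  move=> Nt; have [_ _ H] := HN t Nt; apply: Rle_trans H _; right.
  rewrite /phi_pow -/(s t.+1); case: (Rle_dec (s t.+1) 0) => ? /=; ring.
have K20 : 0 <= 2 * C / c * A.
  by apply: Rlt_le; apply: Rmult_lt_0_compat => //; apply: Rdiv_lt_0_compat; lra.
have R1 := @finite_termination s del (fun t => vnorm (vsub (x t) xs)) alpha c K _ N Hc K0 s0 sdec scv kl2 rb.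
have R2 := @kl_linear_rate s del (fun t => vnorm (vsub (x t) xs)) alpha c K _ N Hc K0 K20 (proj2 Ha) s0 sdec scv kl2 rb.
have R3 := @kl_sublinear_rate s del (fun t => vnorm (vsub (x t) xs)) alpha c K _ N Hc K0 K20 (proj2 Ha) s0 sdec scv kl2 rb.
(* The index [tl] is chosen before the three implications, so alpha decides which rate supplies
   it. *)
case: (Req_dec alpha 0) => [a0|ane].
  have [tl [tl1 Htl]] := R1 a0; exists tl; split=> //; split; last by split=> ?; lra.
  by move=> _ t /Htl; exact: vnorm0_eq.
case: (Rle_dec alpha (1 / 2)) => Hle.
  have [tl [a0 [a1 [tl1 Ha0 Ha1 Htl]]]] := R2 (ltac:(lra)).
  exists tl; split=> //; split; first by [].
  by split=> [_|?]; [exists a0, a1 | lra].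
have [tl [a2 [tl1 Ha2 Htl]]] := R3 (ltac:(lra)).
exists tl; split=> //; split; first by [].
by split=> [?|_]; [lra | exists a2].
Qed.
End SCP.

Theorem mainTheorem7
  (n m : nat) (f P1 P2 : vec n -> R) (g : vec n -> vec m)
  (gradf : vec n -> vec n) (gradg : 'I_m -> vec n -> vec n)
  (hessg : 'I_m -> vec n -> 'I_n -> vec n)
  (Lipf : R) (Lipg : 'I_m -> R)
  (c Llo Lhi tau : R) (x : nat -> vec n) (Lf : nat -> R) (Lg : nat -> vec m)
  (* standing assumptions of (P) *)
  (Hfgrad : forall z, has_grad f z (gradf z))
  (Hfcont : cont_v gradf)
  (HP1conv : convex_fun P1) (HP1cont : cont_r P1)
  (HP2conv : convex_fun P2) (HP2cont : cont_r P2)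
  (Hgcont : forall i, cont_r (fun z => g z i))
  (Hfeas : exists z, vle0 (g z))
  (* Assumption A *)
  (HAf : lipschitz gradf Lipf)
  (HAg : forall i z, has_grad (fun y => g y i) z (gradg i z))
  (HAgL : forall i, lipschitz (gradg i) (Lipg i))
  (HAlev : level_bounded (Fext f P1 P2 g))
  (* Assumption B *)
  (HBc1 : forall i, cont_v (gradg i))
  (HBmfcq : MFCQ g gradg)
  (* Assumption C *)
  (HCg : forall i j z, has_grad (fun y => gradg i y j) z (hessg i z j))
  (HCcont : forall i j, cont_v (fun z => hessg i z j))
  (* Assumption D *)
  (HD : exists (Gam : vec n -> Prop) (gradP2 : vec n -> vec n),
     (forall z, Gam z -> exists r, 0 < r /\ forall y, vnorm (vsub y z) < r -> Gam y) /\
     (forall z, stationary f P1 P2 g gradf gradg z -> Gam z) /\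
     (forall z, Gam z -> has_grad P2 z (gradP2 z)) /\
     (forall z, Gam z -> forall eps, 0 < eps -> exists delta, 0 < delta /\
        forall y, Gam y -> vnorm (vsub y z) < delta ->
          vnorm (vsub (gradP2 y) (gradP2 z)) < eps) /\
     (forall z, Gam z -> exists r L, 0 < r /\
        forall y1 y2, Gam y1 -> Gam y2 -> vnorm (vsub y1 z) < r -> vnorm (vsub y2 z) < r ->
          vnorm (vsub (gradP2 y1) (gradP2 y2)) <= L * vnorm (vsub y1 y2)))
  (* Fbar is a KL function *)
  (HKL : KL_function (@sub3 n m) (@ip3 n m) (Fbar f P1 P2 g gradg))
  (* the algorithm *)
  (Hc : 0 < c) (HL : 0 < Llo < Lhi) (Htau : 1 < tau)
  (Halg : SCP_ls_seq f P1 P2 g gradf gradg c Llo Lhi tau x Lf Lg) :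
  exists xstar : vec n,
    stationary f P1 P2 g gradf gradg xstar /\
    conv_to (@vsub n) (@dot n) x xstar /\
    forall alpha : R, 0 <= alpha < 1 ->
      (forall om : E3 n m,
         acc_point (@sub3 n m) (@ip3 n m) (fun t => (x (S t), x t, Lg t)) om ->
         KL_exponent (@sub3 n m) (@ip3 n m) (Fbar f P1 P2 g gradg) om alpha) ->
      exists tl : nat, (1 <= tl)%nat /\
        (alpha = 0 -> forall t : nat, (tl < t)%nat -> x t = xstar) /\
        (0 < alpha <= 1 / 2 -> exists a0 a1, 0 < a0 < 1 /\ 0 < a1 /\
            forall t : nat, (tl < t)%nat -> vnorm (vsub (x t) xstar) <= a1 * a0 ^ t) /\
        (1 / 2 < alpha < 1 -> exists a2, 0 < a2 /\
            forall t : nat, (tl < t)%nat ->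
              vnorm (vsub (x t) xstar) <= a2 * Rpower (INR t) (- ((1 - alpha) / (2 * alpha - 1)))).
Proof.
have [Gam [gradP2 [HGopen [HGstat [HGgrad [_ HGlip]]]]]] := HD.
have [xs [Hstat Hcv]] := scp_converges Hfgrad Hfcont HP1conv HP1cont HP2conv HP2cont Hgcont HAf HAg
  HAgL HAlev HBc1 HBmfcq Hc HL Htau Halg HGopen HGstat HGgrad HGlip HCg HCcont HKL.
exists xs; split=> //; split; first by apply/conv_to_vcv.
move=> alpha Ha Hexp.
exact: (scp_rates Hfgrad Hfcont HP1conv HP1cont HP2conv HP2cont Hgcont HAf HAg
  HAgL HAlev HBc1 HBmfcq Hc HL Htau Halg HGopen HGstat HGgrad HGlip HCg HCcont Hcv Ha Hexp).
Qed.
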